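(* Let $n\ge 1$. The expected value $E_n\big(e^{r\,\mathrm{tr}\,U+s\,\overline{\mathrm{tr}\,U}}\big)$ over $n\times n$ unitary matrices $U$ (Haar measure) depends on the parameters $r,s$ only through the product $rs$, and for $r=s=t$ it equals $D_n(t)=\det T_n(f)$. Moreover, with $U_n=(T_n(f)^{-1}f^+,\delta^-)$, the function $\Phi_n=1-U_n^2$ of $t$ satisfies $$\Phi_n''=\frac12\Big(\frac1{\Phi_n-1}+\frac1{\Phi_n}\Big)(\Phi_n')^2-\frac1t\,\Phi_n'-8\,\Phi_n(\Phi_n-1)+\frac{2n^2}{t^2}\,\frac{\Phi_n-1}{\Phi_n}$$ (as an identity between meromorphic functions of $t$; primes denote $d/dt$), and for $t>0$ $$D_n(t)=\exp\Big(4\int_0^t\log(t/\tau)\,\tau\,\Phi_n(\tau)\,d\tau\Big).$$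
   Context: For a function $g$ on the unit circle with Fourier coefficients $g_k=\frac1{2\pi}\int_0^{2\pi}g(e^{i\theta})e^{-ik\theta}\,d\theta$, let $T_n(g)=(g_{j-k})_{j,k=0,\dots,n-1}$ be the associated $n\times n$ Toeplitz matrix. Put $f(z)=e^{t(z+z^{-1})}$, with Fourier coefficients $f_k=f_k(t)$, and $D_n(t)=\det T_n(f)$. Define the column $n$-vectors $f^+=(f_1,f_2,\dots,f_n)^{T}$ and $\delta^-=(0,\dots,0,1)^{T}$. Let $(a,b)=\sum_j a_jb_j$ denote the bilinear inner product, and $U_n=U_n(t)=(T_n(f)^{-1}f^+,\delta^-)$ (a scalar function of $t$; not to be confused with the random unitary matrix $U$). $E_n$ denotes expectation with respect to normalized Haar measure on the group of $n\times n$ unitary matrices. *)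

(* Defs.v *)
From HB Require Import structures.
From mathcomp Require Import all_boot all_order all_algebra.
From mathcomp Require Import spectral complex.
From mathcomp Require Import all_classical all_reals all_analysis.

Set Implicit Arguments.
Unset Strict Implicit.
Unset Printing Implicit Defensive.

Import Order.TTheory GRing.Theory Num.Theory.
Import numFieldNormedType.Exports.

Local Open Scope classical_set_scope.
Local Open Scope ring_scope.
Local Open Scope complex_scope.

(* [R[i]] packed as a [numClosedFieldType]: instances on an abstract           *)
(* [numClosedFieldType] then give it, and matrices over it, their norm and     *)
(* topology, and give [derivable] and [^`()] their complex meaning.            *)
Definition Cplx (R : realType) : numClosedFieldType := R[i].

Definition cexp (R : realType) (z : Cplx R) : Cplx R :=
  (expR (complex.Re z))%:C * (cos (complex.Im z) +i* sin (complex.Im z)).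

Definition cintegrable d (T : measurableType d) (R : realType)
    (mu : {measure set T -> \bar R}) (D : set T) (F : T -> Cplx R) : Prop :=
  mu.-integrable D (EFin \o (fun x => complex.Re (F x))) /\
  mu.-integrable D (EFin \o (fun x => complex.Im (F x))).

Definition cintegral d (T : measurableType d) (R : realType)
    (mu : {measure set T -> \bar R}) (D : set T) (F : T -> Cplx R) : Cplx R :=
  Rintegral mu D (fun x => complex.Re (F x)) +i* Rintegral mu D (fun x => complex.Im (F x)).

Definition borelM (R : realType) (n : nat) :=
  g_sigma_algebraType (@open 'M[Cplx R]_n).

Definition unitary_group (R : realType) (n : nat) : set (borelM R n) :=
  [set U : 'M[Cplx R]_n | U \is unitarymx].

(* Normalized Haar measure of U(n), seen as a Borel probability measure on     *)
(* n x n matrices carried by U(n). Since U(n) is compact, left invariance      *)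
(* determines it.                                                              *)
Definition is_haar (R : realType) (n : nat) (P : probability (borelM R n) R) :
    Prop :=
  P (@unitary_group R n) = 1%E /\
  forall V : 'M[Cplx R]_n, V \is unitarymx ->
  forall A : set (borelM R n), measurable A ->
    P [set U : 'M[Cplx R]_n | A (V *m U)] = P A.

Definition expect_tr (R : realType) (n : nat) (P : probability (borelM R n) R)
    (r s : Cplx R) : Cplx R :=
  cintegral P (@unitary_group R n)
    (fun U : 'M[Cplx R]_n => cexp (r * \tr U + s * (\tr U)^*)).

Definition fourier (R : realType) (g : Cplx R -> Cplx R) (k : int) : Cplx R :=
  ((2 * pi)^-1)%:C *
  cintegral (@lebesgue_measure R) `[0, 2 * pi]
    (fun theta => g (cexp ('i * theta%:C)) * cexp (- ('i * k%:~R * theta%:C))).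

Definition toeplitz (R : realType) (n : nat) (g : Cplx R -> Cplx R) :
    'M[Cplx R]_n :=
  \matrix_(j < n, k < n) fourier g (j%:Z - k%:Z).

Definition symbol (R : realType) (t z : Cplx R) : Cplx R :=
  cexp (t * (z + z^-1)).

Definition Dn (R : realType) (n : nat) (t : Cplx R) : Cplx R :=
  \det (toeplitz n (symbol t)).

Definition fplus (R : realType) (n : nat) (t : Cplx R) : 'cV[Cplx R]_n :=
  \col_(j < n) fourier (symbol t) j.+1%:Z.

Definition deltaminus (R : realType) (n : nat) : 'cV[Cplx R]_n :=
  \col_(j < n) (j.+1 == n)%:R.

(* Bilinear, not Hermitian. *)
Definition bilin (R : realType) (n : nat) (a b : 'cV[Cplx R]_n) : Cplx R :=
  \sum_(j < n) a j 0 * b j 0.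

(* [invmx] is the identity on singular matrices, so the value of [Un] is       *)
(* meaningful only at those [t] where [toeplitz n (symbol t)] is invertible.   *)
Definition Un (R : realType) (n : nat) (t : Cplx R) : Cplx R :=
  bilin (invmx (toeplitz n (symbol t)) *m fplus n t) (deltaminus R n).

Definition Phi (R : realType) (n : nat) (t : Cplx R) : Cplx R :=
  1 - Un n t ^+ 2.

(* Meromorphic on the whole plane. Values on a closed discrete set (the poles  *)
(* in particular) are disregarded: two such functions are identified when      *)
(* they agree on a punctured neighbourhood of every point.                     *)
Definition meromorphic (R : realType) (F : Cplx R -> Cplx R) : Prop :=
  forall z0 : Cplx R, exists g h : Cplx R -> Cplx R,
    (\forall z \near z0, derivable g z 1 /\ derivable h z 1) /\
    (\forall z \near z0^', h z != 0 /\ F z = g z / h z).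

(* Main.v *)
Require Import Defs.
From HB Require Import structures.
From mathcomp Require Import all_boot all_order all_algebra.
From mathcomp Require Import spectral complex.
From mathcomp Require Import all_classical all_reals all_analysis.
From mathcomp Require Import perm measurable_realfun ring lra zify.

(* Write [p_n] for the monic orthogonal polynomial of the weight [f], with     *)
(* coefficients given by Cramer's rule. Szego's recurrence and the relation    *)
(* [k f_k = t (f_(k-1) - f_(k+1))] for the Fourier coefficients give, first,   *)
(* the discrete Painleve II equation and a flow in [t] for [p_n(0)], hence the *)
(* differential equation for [Phi_n] (as [Phi_n = 1 - p_n(0)^2]) and a Toda    *)
(* equation for [D_n]; secondly, a closed linear system of ordinary            *)
(* differential equations in [t] for the coefficients of [D_n p_n].            *)
(*                                                                             *)
(* On the group side let [g_i(t)] be the expectation of the coefficient of     *)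
(* [z^i] in [det(z - U)] times [exp(t (tr U + conj(tr U)))]. Invariance of     *)
(* Haar measure under [U -> (1 + (w - 1) Q) U], to first order at [w = 1] for  *)
(* rank-one orthogonal projectors [Q], shows that the [g_i] solve the same     *)
(* system. It is singular at [t = 0], where it admits only one entire solution *)
(* with a given value of the leading coefficient; since [g_n(0) = 1 = D_n(0)], *)
(* [g_n = D_n], which is the integral over [U(n)] to be computed.              *)
(*                                                                             *)
(* Every function of [t] involved is entire of exponential type, so power      *)
(* series are replaced throughout by Taylor's formula with a factorially small *)
(* remainder.                                                                  *)

Set Implicit Arguments.
Unset Strict Implicit.
Unset Printing Implicit Defensive.

Import Order.TTheory GRing.Theory Num.Theory.
Import numFieldNormedType.Exports.

Local Open Scope classical_set_scope.
Local Open Scope ring_scope.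
Local Open Scope complex_scope.

(** * Complex modulus *)

(** Let p_n be the monic orthogonal polynomial of degree n for f, a_n = p_n(0), and l_n its
    coefficient of z^(n-1). Since f is even, a polynomial of degree at most n whose pairings with z,
    ..., z^(n-1) vanish is a combination of p_n and its reversal ([opuc_span]). For p_(n+1) - z p_n
    this is Szego's recurrence. For z p_n' - n p_n and for dp_n/dt it gives, when n >= 1, - n a_n =
    t (1 - a_n^2) (a_(n-1) + a_(n+1)), da_n/dt = (1 - a_n^2) (a_(n+1) - a_(n-1)). Together they form
    a first-order system in t for the pair (a_(n-1), a_n). As U_n = - a_n ([toep_fplus]), Phi_n = 1
    - a_n^2, and eliminating a_(n-1) gives the differential equation.

    The same relations yield D_n' = - 2 l_n D_n and (t l_n)' = - 2 t Phi_n, that is (t (log D_n)')'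
    = 4 t Phi_n ([toda_Dn]). Integrating twice from 0, where log D_n = 0, gives the exponential
    formula, once D_n is known to be positive on the real line; positivity is read off the group
    integral ([expect_tr_real]).

    The group integral is identified with D_n through a linear system instead of Weyl's integration
    formula. The coefficients of D_n p_n ([Dopuc_system]) and the averages of the coefficients of
    det(z - U), weighted by exp(t (tr U + conj(tr U))) ([hmom_system]), solve the same system of
    ordinary differential equations in t, and [linear_system_unique] says that the leading
    coefficient at t = 0 fixes the entire solution. On the group side the system is a combination of
    Schwinger-Dyson equations for the weighted determinant and for its products with resolvent
    entries, in which traces of the resolvent become derivatives of the characteristic polynomial in
    z.

    Dependence on rs alone comes from translation by scalar unitary matrices: the average of (tr
    U)^j conj(tr U)^k vanishes unless j = k ([mixed_moment0]).

    Divisions by the D_j are confined to points where enough of them are nonzero ([good]). These are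
    all points off a discrete set, as D_j(0) = 1, and identities between entire functions extend
    across that set ([exptype_near0]). *)

Section ComplexNorm.
Variable R : realType.
Local Notation C := (Cplx R).
Local Notation Re := complex.Re.
Local Notation Im := complex.Im.
Implicit Types z w : C.

Definition cn z : R := Re `|z|.

Lemma normr_cn z : `|z| = (cn z)%:C.
Proof. by case: z. Qed.

Lemma cnE z : cn z = Num.sqrt (Re z ^+ 2 + Im z ^+ 2).
Proof. by case: z. Qed.

Lemma cn_ge0 z : 0 <= cn z.
Proof. by rewrite cnE sqrtr_ge0. Qed.

Lemma cnM z w : cn (z * w) = cn z * cn w.
Proof. exact: (@ComplexField.Normc.normcM R). Qed.

Lemma cnD z w : cn (z + w) <= cn z + cn w.
Proof. exact: (@le_normcD R). Qed.

Lemma cnN z : cn (- z) = cn z.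
Proof. exact: (@normcN R). Qed.

Lemma cn0 : cn 0 = 0.
Proof. exact: (@ComplexField.Normc.normc0 R). Qed.

Lemma cn1 : cn 1 = 1.
Proof. exact: (@ComplexField.Normc.normc1 R). Qed.

Lemma cn_eq0 z : (cn z == 0) = (z == 0).
Proof.
apply/eqP/eqP => [|->]; [exact: (@ComplexField.Normc.eq0_normc R)|exact: cn0].
Qed.

Lemma cnV z : cn z^-1 = (cn z)^-1.
Proof. exact: (@ComplexField.Normc.normcV R). Qed.

Lemma cnX z n : cn (z ^+ n) = cn z ^+ n.
Proof. by elim: n => [|n IH]; rewrite ?expr0 ?cn1 // !exprS cnM IH. Qed.

Lemma cn_real (x : R) : cn (x%:C : C) = `|x|.
Proof. by rewrite cnE /= expr0n addr0 sqrtr_sqr. Qed.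

Lemma cn_nat n : cn (n%:R) = n%:R.
Proof.
have -> : (n%:R : C) = (n%:R : R)%:C by rewrite rmorph_nat.
by rewrite cn_real normr_nat.
Qed.

Lemma cReD z w : Re (z + w) = Re z + Re w. Proof. by case: z; case: w. Qed.
Lemma cImD z w : Im (z + w) = Im z + Im w. Proof. by case: z; case: w. Qed.
Lemma cReN z : Re (- z) = - Re z. Proof. by case: z. Qed.
Lemma cImN z : Im (- z) = - Im z. Proof. by case: z. Qed.
Lemma cReM z w : Re (z * w) = Re z * Re w - Im z * Im w.
Proof. by case: z; case: w. Qed.
Lemma cImM z w : Im (z * w) = Re z * Im w + Im z * Re w.
Proof. by case: z; case: w => a b c d /=; rewrite addrC. Qed.

Lemma cplx_ext z w : Re z = Re w -> Im z = Im w -> z = w.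
Proof. by case: z; case: w => a b c d /= -> ->. Qed.

Lemma Re_le_cn z : `|Re z| <= cn z.
Proof. by rewrite cnE -sqrtr_sqr ler_wsqrtr// lerDl sqr_ge0. Qed.

Lemma Im_le_cn z : `|Im z| <= cn z.
Proof. by rewrite cnE -sqrtr_sqr ler_wsqrtr// lerDr sqr_ge0. Qed.

Lemma cn_le_ReIm z : cn z <= `|Re z| + `|Im z|.
Proof.
rewrite cnE -[leRHS]ger0_norm ?addr_ge0// -[leRHS]sqrtr_sqr ler_wsqrtr//.
have := normr_ge0 (Re z); have := normr_ge0 (Im z).
rewrite -(real_normK (num_real (Re z))) -(real_normK (num_real (Im z))).
by nra.
Qed.

Lemma cnB z w : cn (z - w) <= cn z + cn w.
Proof. by rewrite -(cnN w) cnD. Qed.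

Lemma cn_sum I (r : seq I) (P : pred I) (F : I -> C) :
  cn (\sum_(i <- r | P i) F i) <= \sum_(i <- r | P i) cn (F i).
Proof.
elim/big_rec2: _ => [|i x y _ IH]; first by rewrite cn0.
by apply: (le_trans (cnD _ _)); rewrite lerD2l.
Qed.

Lemma cn_prod I (r : seq I) (P : pred I) (F : I -> C) :
  cn (\prod_(i <- r | P i) F i) = \prod_(i <- r | P i) cn (F i).
Proof. by elim/big_rec2: _ => [|i x y _ IH]; rewrite ?cn1 // cnM IH. Qed.

Lemma cn_conj z : cn z^* = cn z.
Proof. by case: z => a b; rewrite !cnE /= sqrrN. Qed.

End ComplexNorm.

(** * Entire functions of exponential type *)

Section ExpType.
Variable R : realType.
Local Notation C := (Cplx R).
Implicit Types (F G : C -> C) (z h : C).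

(** Complex differentiability with a quadratic remainder that is uniform on each ball. In this form
    products and integrals are differentiated by estimates alone, with no interchange of limits. *)
Definition qdiff F F' := forall rho : R, exists2 K : R, 0 <= K &
  forall z h, cn z <= rho -> cn (z + h) <= rho ->
    cn (F (z + h) - F z - h * F' z) <= K * cn h ^+ 2.

Definition ballbdd F := forall rho : R, exists2 K : R, 0 <= K &
  forall z, cn z <= rho -> cn (F z) <= K.

(** [G j] is the j-th derivative of [G 0]. The geometric bound on each ball is what exponential type
    provides, and it makes the Taylor remainder factorially small. *)
Definition expder (G : nat -> C -> C) := (forall j, qdiff (G j) (G j.+1)) /\
  forall rho : R, exists a b : R, [/\ 0 <= a, 0 <= b &
    forall j z, cn z <= rho -> cn (G j z) <= a * b ^+ j].

Definition exptype g := exists2 G, G 0%N = g & expder G.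

Lemma ballbdd_cst (c : C) : ballbdd (fun=> c).
Proof. by move=> rho; exists (cn c) => //; exact: cn_ge0. Qed.

Lemma ballbdd_id : ballbdd id.
Proof.
move=> rho; exists (Num.max 0 rho) => [|z zr]; first by rewrite le_max lexx.
by rewrite le_max zr orbT.
Qed.

Lemma ballbddD F G : ballbdd F -> ballbdd G -> ballbdd (fun z => F z + G z).
Proof.
move=> bF bG rho; have [K K0 FK] := bF rho; have [L L0 GL] := bG rho.
exists (K + L) => [|z zr]; first exact: addr_ge0.
by apply: (le_trans (cnD _ _)); rewrite lerD ?FK ?GL.
Qed.

Lemma ballbddM F G : ballbdd F -> ballbdd G -> ballbdd (fun z => F z * G z).
Proof.
move=> bF bG rho; have [K K0 FK] := bF rho; have [L L0 GL] := bG rho.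
exists (K * L) => [|z zr]; first exact: mulr_ge0.
by rewrite cnM ler_pM ?FK ?GL ?cn_ge0.
Qed.

Lemma ballbdd_expder (G : nat -> C -> C) j : expder G -> ballbdd (G j).
Proof.
move=> [_ bG] rho; have [a [b [a0 b0 Gab]]] := bG rho.
by exists (a * b ^+ j) => [|z zr]; [rewrite mulr_ge0 ?exprn_ge0|exact: Gab].
Qed.

Lemma qdiff_cst (c : C) : qdiff (fun=> c) (fun=> 0).
Proof.
by move=> rho; exists 0 => // z h _ _; rewrite subrr mulr0 subrr cn0 mul0r.
Qed.

Lemma qdiff_id : qdiff id (fun=> 1).
Proof.
move=> rho; exists 0 => // z h _ _.
by rewrite mulr1 [z + h]addrC addrK subrr cn0 mul0r.
Qed.

Lemma qdiffD F F' G G' : qdiff F F' -> qdiff G G' ->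
  qdiff (fun z => F z + G z) (fun z => F' z + G' z).
Proof.
move=> dF dG rho; have [K K0 FK] := dF rho; have [L L0 GL] := dG rho.
exists (K + L) => [|z h zr hr]; first exact: addr_ge0.
have -> : F (z + h) + G (z + h) - (F z + G z) - h * (F' z + G' z) =
  (F (z + h) - F z - h * F' z) + (G (z + h) - G z - h * G' z) by ring.
by apply: (le_trans (cnD _ _)); rewrite [leRHS]mulrDl lerD ?FK ?GL.
Qed.

Lemma cn_le2 (rho : R) z h : cn z <= rho -> cn (z + h) <= rho -> cn h <= 2 * rho.
Proof.
move=> zr hr; have -> : h = (z + h) - z by rewrite addrC addKr.
by apply: (le_trans (cnB _ _)); rewrite mulr_natl mulr2n lerD.
Qed.

Lemma qdiffM F F' G G' : qdiff F F' -> qdiff G G' ->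
  ballbdd F -> ballbdd F' -> ballbdd G -> ballbdd G' ->
  qdiff (fun z => F z * G z) (fun z => F' z * G z + F z * G' z).
Proof.
move=> dF dG bF bF' bG bG' rho.
have [K K0 FK] := dF rho; have [L L0 GL] := dG rho.
have [A A0 FA] := bF rho; have [A' A'0 FA'] := bF' rho.
have [B B0 GB] := bG rho; have [B' B'0 GB'] := bG' rho.
exists (K * B + A * L + A' * (L * (2 * `|rho|) + B')) => [|z h zr hr].
  by rewrite !(addr_ge0, mulr_ge0).
have h2 : cn h <= 2 * `|rho|.
  by apply: (le_trans (cn_le2 zr hr)); rewrite ler_wpM2l// ler_norm.
pose u := F (z + h) - F z - h * F' z; pose v := G (z + h) - G z - h * G' z.
have uK : cn u <= K * cn h ^+ 2 by exact: FK.
have vL : cn v <= L * cn h ^+ 2 by exact: GL.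
have -> : F (z + h) * G (z + h) - F z * G z - h * (F' z * G z + F z * G' z) =
  u * G (z + h) + F z * v + h * F' z * (v + h * G' z).
  by rewrite /u /v; ring.
have h0 := cn_ge0 h.
apply: (le_trans (cnD _ _)); rewrite [leRHS]mulrDl lerD//.
  apply: (le_trans (cnD _ _)); rewrite [leRHS]mulrDl lerD// cnM.
    by rewrite -mulrA [B * _]mulrC mulrA ler_pM ?cn_ge0 ?GB.
  by rewrite -mulrA ler_pM ?cn_ge0 ?FA.
rewrite !cnM; apply: (@le_trans _ _ (cn h * A' * (L * cn h ^+ 2 + cn h * B'))).
  rewrite ler_pM ?mulr_ge0 ?cn_ge0 ?ler_wpM2l ?FA'//.
  by apply: (le_trans (cnD _ _)); rewrite lerD// cnM ler_wpM2l ?GB'.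
have -> : cn h * A' * (L * cn h ^+ 2 + cn h * B') =
  A' * (L * cn h + B') * cn h ^+ 2 by ring.
by rewrite ler_wpM2r ?exprn_ge0// ler_wpM2l// lerD2r ler_wpM2l.
Qed.

Lemma qdiff_unique F F1 F2 : qdiff F F1 -> qdiff F F2 -> F1 =1 F2.
Proof.
move=> d1 d2 z; have [K1 K10 H1] := d1 (cn z + 1); have [K2 K20 H2] := d2 (cn z + 1).
apply/eqP; rewrite -subr_eq0 -cn_eq0; apply/eqP/le_anti; rewrite cn_ge0 andbT.
apply/ler_addgt0Pl => e e0; rewrite addr0.
pose t := Num.min 1 (e / (K1 + K2 + 1)).
have t0 : 0 < t by rewrite lt_min ltr01 divr_gt0// ltr_wpDl ?addr_ge0.
have t1 : t <= 1 by rewrite ge_min lexx.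
pose h : C := t%:C.
have hE : cn h = t by rewrite cn_real gtr0_norm.
have zh : cn (z + h) <= cn z + 1 by apply: (le_trans (cnD _ _)); rewrite hE lerD2l.
have zz : cn z <= cn z + 1 by rewrite lerDl.
have := H1 _ _ zz zh; have := H2 _ _ zz zh.
set a := _ - h * F2 z; set b := _ - h * F1 z => Ha Hb.
have : cn (h * (F1 z - F2 z)) <= (K1 + K2) * t ^+ 2.
  have -> : h * (F1 z - F2 z) = a - b by rewrite /a /b; ring.
  apply: (le_trans (cnB _ _)); rewrite addrC mulrDl -hE lerD//.
rewrite cnM hE expr2 mulrCA ler_pM2l// => /le_trans; apply.
apply: (@le_trans _ _ ((K1 + K2 + 1) * t)); first by rewrite ler_wpM2r ?(ltW t0)// lerDl.
by rewrite mulrC -ler_pdivlMr ?ltr_wpDl ?addr_ge0// ge_min lexx orbT.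
Qed.

Lemma qdiff_ext F F' G G' : F =1 G -> F' =1 G' -> qdiff F F' -> qdiff G G'.
Proof.
move=> FG FG' dF rho; have [K K0 H] := dF rho; exists K => // z h zr hr.
by rewrite -!FG -FG' H.
Qed.

Lemma le_archi (x y c : R) : 0 <= c -> (forall N : nat, x <= y + c / N.+1%:R) -> x <= y.
Proof.
move=> c0 H; apply/ler_addgt0Pl => e e0; rewrite addrC.
apply: (le_trans (H (Num.bound (c / e)))); rewrite lerD2l ler_pdivrMr ?ltr0n//.
rewrite -ler_pdivrMl// mulrC ltW//.
apply: lt_le_trans (archi_boundP _) _; first by rewrite divr_ge0// ltW.
by rewrite ler_nat.
Qed.

(** Mean value inequality. The segment is cut into N + 1 equal pieces; the quadratic errors add up
    to [K] |h|^2 / (N + 1), which [le_archi] removes. *)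
Lemma qdiff_mv F F' (M : R) z h : qdiff F F' ->
  (forall s : R, 0 <= s <= 1 -> cn (F' (z + s%:C * h)) <= M) ->
  cn (F (z + h) - F z) <= M * cn h.
Proof.
move=> dF HM; have [K K0 HK] := dF (cn z + cn h).
apply: (@le_archi _ _ (K * cn h ^+ 2)) => [|N]; first by rewrite mulr_ge0 ?exprn_ge0 ?cn_ge0.
pose s (k : nat) : R := k%:R / N.+1%:R.
have s01 k : (k <= N.+1)%N -> 0 <= s k <= 1.
  by move=> kN; rewrite divr_ge0//= ler_pdivrMr ?ltr0n// mul1r ler_nat.
have sb (x : R) : 0 <= x <= 1 -> cn (z + x%:C * h) <= cn z + cn h.
  move=> /andP[x0 x1]; apply: (le_trans (cnD _ _)); rewrite lerD2l cnM cn_real.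
  by rewrite ger0_norm// ler_piMl ?cn_ge0.
pose d : C := (N.+1%:R^-1)%:C * h.
have dE : cn d = cn h / N.+1%:R by rewrite cnM cn_real ger0_norm ?invr_ge0 ?ler0n 1?[LHS]mulrC.
have step k : z + (s k.+1)%:C * h = z + (s k)%:C * h + d.
  rewrite -addrA; congr (_ + _); rewrite -mulrDl -rmorphD; congr (_%:C * _).
  by rewrite /s -natr1 mulrDl mul1r.
have one k : (k <= N)%N -> cn (F (z + (s k.+1)%:C * h) - F (z + (s k)%:C * h)) <=
    M * (cn h / N.+1%:R) + K * (cn h / N.+1%:R) ^+ 2.
  move=> kN; rewrite step; set u := z + _ * h.
  have -> : F (u + d) - F u = d * F' u + (F (u + d) - F u - d * F' u) by ring.
  apply: (le_trans (cnD _ _)); rewrite lerD//.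
    by rewrite cnM dE mulrC ler_wpM2r ?divr_ge0 ?cn_ge0// HM// s01// ltnW.
  rewrite -dE HK//; first by rewrite sb// s01// ltnW.
  by rewrite -step sb// s01.
have -> : F (z + h) - F z = \sum_(0 <= k < N.+1) (F (z + (s k.+1)%:C * h) - F (z + (s k)%:C * h)).
  rewrite (telescope_sumr (fun k => F (z + (s k)%:C * h)))//.
  by rewrite /s mulfV ?pnatr_eq0// mul0r rmorph1 rmorph0 mul1r mul0r addr0.
apply: (le_trans (cn_sum _ _ _)).
apply: (@le_trans _ _ (\sum_(0 <= k < N.+1) (M * (cn h / N.+1%:R) + K * (cn h / N.+1%:R) ^+ 2))).
  by rewrite !big_mkord ler_sum// => k _; rewrite one// -ltnS.
rewrite sumr_const_nat subn0 -[_ *+ N.+1]mulr_natr le_eqVlt; apply/orP; left; apply/eqP.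
have : N.+1%:R != 0 :> R by rewrite pnatr_eq0.
move: (N.+1%:R : R) => c c0. by field.
Qed.

Lemma qdiff_bsubX z N : qdiff (fun u => (z - u) ^+ N) (fun u => - (N%:R * (z - u) ^+ N.-1))
  /\ ballbdd (fun u : C => (z - u) ^+ N).
Proof.
have dB : qdiff (fun u => z - u) (fun=> -1).
  have := qdiffD (qdiff_cst z) (qdiffM (qdiff_cst (-1)) qdiff_id (ballbdd_cst _)
    (ballbdd_cst _) ballbdd_id (ballbdd_cst _)).
  by apply: qdiff_ext => u; ring.
have bB : ballbdd (fun u => z - u).
  have := ballbddD (ballbdd_cst z) (ballbddM (ballbdd_cst (-1)) ballbdd_id).
  by congr ballbdd; apply/funext => u; ring.
elim: N => [|N [dN bN]].
  split; first by apply: qdiff_ext (qdiff_cst 1) => u; rewrite ?expr0 ?mul0r ?oppr0.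
  by have := ballbdd_cst 1; congr ballbdd; apply/funext => u; rewrite expr0.
split; last first.
  by have := ballbddM bB bN; congr ballbdd; apply/funext => u; rewrite exprS.
have b' : ballbdd (fun u => - (N%:R * (z - u) ^+ N.-1)).
  case: (N) bN => [|m].
    by move=> _; have := ballbdd_cst 0; congr ballbdd; apply/funext => u; rewrite mul0r oppr0.
  move=> bN.
  have bm : ballbdd (fun u => (z - u) ^+ m).
    elim: m {bN} => [|m IH].
      by have := ballbdd_cst 1; congr ballbdd; apply/funext => u; rewrite expr0.
    by have := ballbddM bB IH; congr ballbdd; apply/funext => u; rewrite exprS.
  by have := ballbddM (ballbdd_cst (- m.+1%:R)) bm; congr ballbdd; apply/funext => u; rewrite mulNr.
have := qdiffM dB dN bB (ballbdd_cst _) bN b'.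
apply: qdiff_ext => u; first by rewrite exprS.
case: N {dN bN b'} => [|N]; first by rewrite /= !expr0; ring.
by rewrite /= exprS -[in RHS]natr1; ring.
Qed.

(** The derivative of u -> sum_(j <= N) G_j(u) (z - u)^j / j! telescopes to G_(N+1)(u) (z - u)^N /
    N!, so the mean value inequality from [z0] to [z] bounds the remainder. *)
Lemma expder_taylor_ball (G : nat -> C -> C) (rho : R) : expder G ->
  exists a b : R, [/\ 0 <= a, 0 <= b & forall z0 z N, cn z0 + cn (z - z0) <= rho ->
  cn (G 0%N z - \sum_(j < N.+1) G j z0 * (z - z0) ^+ j / j`!%:R) <=
   a * b ^+ N.+1 * (cn (z - z0)) ^+ N.+1 / N`!%:R].
Proof.
move=> dG; have [dG1 bG] := dG.
have [a [b [a0 b0 Gab]]] := bG rho; exists a, b; split=> // z0 z N zrho.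
pose psi M u := \sum_(j < M) G j u * (z - u) ^+ j / j`!%:R.
have dpsi M : qdiff (psi M.+1) (fun u => G M.+1 u * (z - u) ^+ M / M`!%:R).
  elim: M => [|M IH].
    apply: qdiff_ext (dG1 0%N) => u; last by rewrite expr0 fact0 divr1 mulr1.
    by rewrite /psi big_ord1 expr0 fact0 divr1 mulr1.
  have [dX bX] := qdiff_bsubX z M.+1.
  have [_ bX'] := qdiff_bsubX z M.
  have b' : ballbdd (fun u => - (M.+1%:R * (z - u) ^+ M.+1.-1)).
    by have := ballbddM (ballbdd_cst (- M.+1%:R)) bX'; congr ballbdd; apply/funext => u; rewrite mulNr.
  have d1 := qdiffM (dG1 M.+1) dX (ballbdd_expder _ dG) (ballbdd_expder _ dG) bX b'.
  have bM : ballbdd (fun u => G M.+1 u * (z - u) ^+ M.+1).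
    exact: ballbddM (ballbdd_expder _ dG) bX.
  have bM' := ballbddD (ballbddM (ballbdd_expder M.+2 dG) bX)
    (ballbddM (ballbdd_expder M.+1 dG) b').
  have := qdiffD IH (qdiffM d1 (qdiff_cst (M.+1`!%:R^-1)) bM bM' (ballbdd_cst _) (ballbdd_cst _)).
  apply: qdiff_ext => u; first by rewrite /psi [in RHS]big_ord_recr.
  rewrite mulr0 addr0 /= factS natrM.
  have : M.+1%:R != 0 :> C by rewrite pnatr_eq0.
  have : M`!%:R != 0 :> C by rewrite pnatr_eq0 -lt0n fact_gt0.
  by move: (M.+1%:R : C) (M`!%:R : C) => c d d0 c0; field; rewrite c0 d0.
have -> : \sum_(j < N.+1) G j z0 * (z - z0) ^+ j / j`!%:R = psi N.+1 z0 by [].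
have <- : psi N.+1 z = G 0%N z.
  rewrite /psi big_ord_recl big1 ?addr0 => [|i _].
    by rewrite expr0 fact0 divr1 mulr1.
  by rewrite subrr lift0 exprS mul0r mulr0 mul0r.
have {1}-> : z = z0 + (z - z0) by rewrite addrC subrK.
have -> : a * b ^+ N.+1 * cn (z - z0) ^+ N.+1 / N`!%:R =
  (a * b ^+ N.+1 * cn (z - z0) ^+ N / N`!%:R) * cn (z - z0).
  by rewrite [cn _ ^+ N.+1]exprSr; ring.
apply: (qdiff_mv (dpsi N)) => s /andP[s0 s1].
have sh : cn (s%:C * (z - z0)) <= cn (z - z0).
  by rewrite cnM cn_real ger0_norm// ler_piMl ?cn_ge0.
rewrite 2!cnM cnV cn_nat ler_wpM2r ?invr_ge0 ?ler0n//.
rewrite ler_pM ?cn_ge0//.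
  by apply: Gab; apply: le_trans zrho; apply: (le_trans (cnD _ _)); rewrite lerD2l.
rewrite cnX lerXn2r ?nnegrE ?cn_ge0//.
have -> : z - (z0 + s%:C * (z - z0)) = (1 - s)%:C * (z - z0).
  by rewrite rmorphB rmorph1; ring.
by rewrite cnM cn_real ger0_norm ?subr_ge0// ler_piMl ?cn_ge0// lerBlDr lerDl.
Qed.

Lemma expder_taylor (G : nat -> C -> C) z0 z : expder G -> exists a b : R, forall N,
  cn (G 0%N z - \sum_(j < N.+1) G j z0 * (z - z0) ^+ j / j`!%:R) <=
   a * b ^+ N.+1 * (cn (z - z0)) ^+ N.+1 / N`!%:R.
Proof.
move=> /(@expder_taylor_ball _ (cn z0 + cn (z - z0)))[a [b [_ _ H]]].
by exists a, b => N; apply: H.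
Qed.

Lemma fact_small (a x e : R) : 0 < e -> exists N0, forall N, (N0 <= N)%N ->
  a * x ^+ N.+1 / N`!%:R <= e.
Proof.
move=> e0.
have /cvgrPdist_le : (fun N => a * x * exp_coeff x N) @ \oo --> (a * x * 0 : R).
  by apply: cvgMr; exact: cvg_exp_coeff.
move=> /(_ _ e0)[N0 _ H]; exists N0 => N NN.
have := H N NN; rewrite mulr0 sub0r normrN => /(le_trans (ler_norm _)).
by rewrite /exp_coeff/= exprS !mulrA.
Qed.

(** The two functions may be evaluated at different points, as long as the Taylor terms agree;
    [expect_tr_mul] relies on this freedom. *)
Lemma expder_taylor_eq (G H : nat -> C -> C) z0 z w0 w : expder G -> expder H ->
  (forall j, G j z0 * (z - z0) ^+ j = H j w0 * (w - w0) ^+ j) -> G 0%N z = H 0%N w.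
Proof.
move=> dG dH E; have [a [b Ga]] := expder_taylor z0 z dG.
have [c [d Hc]] := expder_taylor w0 w dH.
apply/eqP; rewrite -subr_eq0 -cn_eq0; apply/eqP/le_anti; rewrite cn_ge0 andbT.
apply/ler_addgt0Pl => e e0; rewrite addr0.
have e2 : 0 < e / 2 by rewrite divr_gt0.
have [N1 H1] := fact_small a (b * cn (z - z0)) e2.
have [N2 H2] := fact_small c (d * cn (w - w0)) e2.
pose N := maxn N1 N2.
have {}Ga := le_trans (Ga N) _; have {}Hc := le_trans (Hc N) _.
set S := \sum_(j < N.+1) _ in Ga; set T := \sum_(j < N.+1) _ in Hc.
have ST : S = T by apply: eq_bigr => j _; rewrite E.
have -> : G 0%N z - H 0%N w = (G 0%N z - S) - (H 0%N w - T) by rewrite ST; ring.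
apply: (le_trans (cnB _ _)); rewrite [leRHS](splitr e) lerD//.
  by apply: Ga; rewrite -[a * _ * _]mulrA -exprMn H1// leq_maxl.
by apply: Hc; rewrite -[c * _ * _]mulrA -exprMn H2// leq_maxr.
Qed.

Lemma expder_zero : expder (fun (_ : nat) (_ : C) => 0 : C).
Proof.
split=> [j|rho]; first exact: qdiff_cst.
by exists 0, 0; split=> // j z _; rewrite cn0 mul0r.
Qed.

Lemma exptype_cst (c : C) : exptype (fun=> c).
Proof.
exists (fun j => if j is 0%N then fun=> c else fun=> 0) => //; split.
  by case=> [|j]; exact: qdiff_cst.
move=> rho; exists (cn c), 1; split=> [||j z _]; [exact: cn_ge0|by []|].
by rewrite expr1n mulr1; case: j => [|j] //=; rewrite cn0 cn_ge0.
Qed.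

Lemma exptype_id : exptype id.
Proof.
exists (fun j => match j with 0%N => id | 1%N => fun=> 1 | _ => fun=> 0 end) => //; split.
  by case=> [|[|j]]; [exact: qdiff_id|exact: qdiff_cst|exact: qdiff_cst].
move=> rho; exists (`|rho| + 1), 1; split=> [||j z zr]; [by rewrite addr_ge0|by []|].
rewrite expr1n mulr1; case: j => [|[|j]] //=; rewrite ?cn0 ?cn1 ?lerDr ?addr_ge0//.
by apply: (le_trans zr); rewrite -[leLHS]addr0 lerD// ler_norm.
Qed.

Lemma expderD (F G : nat -> C -> C) : expder F -> expder G ->
  expder (fun j z => F j z + G j z).
Proof.
move=> [dF bF] [dG bG]; split => [j|rho]; first exact: qdiffD.
have [a [b [a0 b0 Fab]]] := bF rho; have [c [d [c0 d0 Gcd]]] := bG rho.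
exists (a + c), (b + d); split; rewrite ?addr_ge0// => j z zr.
apply: (le_trans (cnD _ _)); rewrite mulrDl lerD//.
  apply: (le_trans (Fab _ _ zr)); rewrite ler_wpM2l// lerXn2r ?nnegrE ?addr_ge0//.
  by rewrite lerDl.
apply: (le_trans (Gcd _ _ zr)); rewrite ler_wpM2l// lerXn2r ?nnegrE ?addr_ge0//.
by rewrite lerDr.
Qed.

Lemma exptypeD F G : exptype F -> exptype G -> exptype (fun z => F z + G z).
Proof.
move=> [F' <- dF] [G' <- dG].
by exists (fun j z => F' j z + G' j z) => //; exact: expderD.
Qed.

(* The iterated derivatives of a product, arranged so that Leibniz' formula    *)
(* needs no binomial coefficients.                                             *)
Fixpoint leibniz (F G : nat -> C -> C) (j : nat) : C -> C :=
  if j is j'.+1 then fun z => leibniz (F \o S) G j' z + leibniz F (G \o S) j' z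
  else fun z => F 0%N z * G 0%N z.

Lemma expder_shift (F : nat -> C -> C) : expder F -> expder (F \o S).
Proof.
move=> [dF bF]; split => [j|rho]; first exact: dF.
have [a [b [a0 b0 Fab]]] := bF rho.
exists (a * b), b; split; rewrite ?mulr_ge0// => j z zr.
by rewrite -mulrA -exprS; exact: Fab.
Qed.

Lemma expderM (F G : nat -> C -> C) : expder F -> expder G -> expder (leibniz F G).
Proof.
move=> dF dG; split => [j|rho].
  elim: j F G dF dG => [|j IH] F G dF dG; last first.
    by apply: qdiffD; apply: IH => //; exact: expder_shift.
  exact: qdiffM (dF.1 0%N) (dG.1 0%N) (ballbdd_expder _ dF) (ballbdd_expder _ dF)
    (ballbdd_expder _ dG) (ballbdd_expder _ dG).
have [a [b [a0 b0 Fab]]] := dF.2 rho; have [c [d [c0 d0 Gcd]]] := dG.2 rho.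
exists (a * c), (b + d); split; rewrite ?mulr_ge0 ?addr_ge0// => j.
elim: j F G {dF dG} a c a0 c0 Fab Gcd => [|j IH] F G a c a0 c0 Fab Gcd z zr /=.
  rewrite cnM expr0 mulr1 ler_pM ?cn_ge0//.
    by have := Fab 0%N z zr; rewrite expr0 mulr1.
  by have := Gcd 0%N z zr; rewrite expr0 mulr1.
apply: (le_trans (cnD _ _)).
have -> : a * c * (b + d) ^+ j.+1 = a * b * c * (b + d) ^+ j + a * (c * d) * (b + d) ^+ j.
  by rewrite exprS; ring.
rewrite lerD// IH// ?mulr_ge0// => i u ur.
  by rewrite -mulrA -exprS; exact: Fab.
by rewrite -mulrA -exprS; exact: Gcd.
Qed.

Lemma exptypeM F G : exptype F -> exptype G -> exptype (fun z => F z * G z).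
Proof.
by move=> [F' <- dF] [G' <- dG]; exists (leibniz F' G') => //; exact: expderM.
Qed.

Lemma exptype_ext F G : F =1 G -> exptype F -> exptype G.
Proof. by move=> /funext ->. Qed.

Lemma exptypeN F : exptype F -> exptype (fun z => - F z).
Proof.
move=> eF; apply: exptype_ext (exptypeM (exptype_cst (-1)) eF) => z.
by rewrite mulN1r.
Qed.

Lemma exptypeB F G : exptype F -> exptype G -> exptype (fun z => F z - G z).
Proof. by move=> eF eG; apply: exptypeD => //; exact: exptypeN. Qed.

Lemma exptype_sum I (r : seq I) (P : pred I) (F : I -> C -> C) :
  (forall i, P i -> exptype (F i)) -> exptype (fun z => \sum_(i <- r | P i) F i z).
Proof.
move=> eF; elim: r => [|i r IH].
  by apply: exptype_ext (exptype_cst 0) => z; rewrite big_nil.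
case Pi: (P i); last by apply: exptype_ext IH => z; rewrite big_cons Pi.
by apply: exptype_ext (exptypeD (eF _ Pi) IH) => z; rewrite big_cons Pi.
Qed.

Lemma exptype_prod I (r : seq I) (P : pred I) (F : I -> C -> C) :
  (forall i, P i -> exptype (F i)) -> exptype (fun z => \prod_(i <- r | P i) F i z).
Proof.
move=> eF; elim: r => [|i r IH].
  by apply: exptype_ext (exptype_cst 1) => z; rewrite big_nil.
case Pi: (P i); last by apply: exptype_ext IH => z; rewrite big_cons Pi.
by apply: exptype_ext (exptypeM (eF _ Pi) IH) => z; rewrite big_cons Pi.
Qed.

Lemma exptype_det n (A : C -> 'M[C]_n) : (forall i j, exptype (fun z => A z i j)) ->
  exptype (fun z => \det (A z)).
Proof.
move=> eA; rewrite /determinant; apply: exptype_sum => s _.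
by apply: exptypeM; [exact: exptype_cst|apply: exptype_prod].
Qed.

Lemma exptype_adj n (A : C -> 'M[C]_n) : (forall i j, exptype (fun z => A z i j)) ->
  forall i j, exptype (fun z => (\adj (A z)) i j).
Proof.
move=> eA i j.
apply: (@exptype_ext (fun z => (-1) ^+ (j + i) * \det (row' j (col' i (A z))))).
  by move=> z; rewrite mxE.
apply: exptypeM; first exact: exptype_cst.
by apply: exptype_det => k l; apply: exptype_ext (eA (lift j k) (lift i l)) => z; rewrite !mxE.
Qed.

Lemma exptype_qdiff F : exptype F -> exists2 F', exptype F' & qdiff F F'.
Proof.
move=> [G <- dG]; exists (G 1%N); last exact: dG.1.
by exists (G \o S) => //; exact: expder_shift.
Qed.

(** If m is the order of the first derivative that does not vanish at [z0], the Taylor term in |z -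
    z0|^m beats the remainder in |z - z0|^(m+1). If there is no such m, Taylor's formula gives 0
    everywhere. *)
Lemma exptype_isolated F z0 : exptype F ->
  (forall z, F z = 0) \/ exists2 d : R, 0 < d & forall z, 0 < cn (z - z0) < d -> F z != 0.
Proof.
move=> [G <- dG]; have [H|H] := pselect (forall j, G j z0 = 0).
  left=> z.
  have e0 : expder (fun _ => fun=> (0 : C)).
    split=> [j|rho]; first exact: qdiff_cst.
    by exists 0, 0; split=> // j z' _; rewrite cn0 mul0r.
  by apply: (expder_taylor_eq (z0 := z0) (z := z) (w0 := z0) (w := z) dG e0) => j; rewrite H.
right; move/existsNP: H => [j0 /eqP j0P].
have [m mP mmin] := ex_minnP (ex_intro (fun j => G j z0 != 0) j0 j0P).
have [a [b [a0 b0 H]]] := expder_taylor_ball (cn z0 + 1) dG.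
pose g := cn (G m z0) / m`!%:R; pose K := a * b ^+ m.+1 / m`!%:R.
have f0 : 0 < m`!%:R :> R by rewrite ltr0n fact_gt0.
have g0 : 0 < g by rewrite divr_gt0// lt_def cn_eq0 mP cn_ge0.
have K0 : 0 <= K by rewrite divr_ge0 ?mulr_ge0 ?exprn_ge0.
exists (Num.min 1 (g / (K + 1))) => [|z].
  by rewrite lt_min ltr01 divr_gt0// ltr_wpDl.
rewrite lt_min => /andP[x0 /andP[x1 xK]].
set x := cn (z - z0) in x0 x1 xK.
apply/negP => /eqP Gz0.
have := H z0 z m; rewrite lerD2l ltW// => /(_ isT).
rewrite Gz0 big_ord_recr big1 /= => [|j _]; last first.
  have [//|jm] := eqVneq (G j z0) 0; first by move=> ->; rewrite !mul0r.
  by have := mmin j jm; rewrite leqNgt ltn_ord.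
rewrite !add0r cnN 2!cnM cnX cnV cn_nat -/x.
have -> : cn (G m z0) * x ^+ m / m`!%:R = g * x ^+ m by rewrite /g; ring.
have -> : a * b ^+ m.+1 * x ^+ m.+1 / m`!%:R = (K * x) * x ^+ m.
  by rewrite /K [x ^+ m.+1]exprS; ring.
rewrite ler_pM2r ?exprn_gt0//; apply/negP; rewrite -ltNge.
move: xK; rewrite ltr_pdivlMr ?ltr_wpDl// => /(le_lt_trans _); apply.
by rewrite mulrC ler_wpM2l ?(ltW x0)// lerDl.
Qed.

(** Radii of balls in [Cplx R] are elements of [Cplx R]; a positive one is real, so neighbourhoods
    can be described by the real modulus [cn]. *)
Lemma near_dnbhs_cn (z0 : C) (P : C -> Prop) :
  (\forall z \near z0^', P z) <-> exists2 d : R, 0 < d & forall z, 0 < cn (z - z0) < d -> P z.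
Proof.
split=> [|[d d0 H]].
  move=> [e /= e0 H]; have /complex_realP[d dE] : e \is Num.real by exact: gtr0_real.
  exists d => [|z /andP[z0' zd]]; first by rewrite -ltcR -dE.
  apply: H => /=; last by rewrite -subr_eq0 -cn_eq0 gt_eqF.
  by rewrite distrC normr_cn dE ltcR.
exists (d%:C : C) => /=; first by rewrite ltcR.
move=> z /=; rewrite distrC normr_cn ltcR => zd zn; apply: H.
by rewrite zd andbT lt_def cn_ge0 andbT cn_eq0 subr_eq0.
Qed.

Lemma near_nbhs_cn (z0 : C) (P : C -> Prop) :
  (\forall z \near z0, P z) <-> exists2 d : R, 0 < d & forall z, cn (z - z0) < d -> P z.
Proof.
split=> [|[d d0 H]].
  move=> [e /= e0 H]; have /complex_realP[d dE] : e \is Num.real by exact: gtr0_real.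
  exists d => [|z zd]; first by rewrite -ltcR -dE.
  by apply: H => /=; rewrite distrC normr_cn dE ltcR.
exists (d%:C : C) => /=; first by rewrite ltcR.
by move=> z /=; rewrite distrC normr_cn ltcR => zd; apply: H.
Qed.

Lemma exptype_near F z0 z1 : exptype F -> F z1 != 0 -> \forall z \near z0^', F z != 0.
Proof.
move=> eF Fz1; apply/near_dnbhs_cn.
by case: (exptype_isolated z0 eF) => // F0; rewrite F0 eqxx in Fz1.
Qed.

Lemma exptype_near0 F z0 : exptype F -> (\forall z \near z0^', F z = 0) ->
  forall z, F z = 0.
Proof.
move=> eF Fz0; case: (exptype_isolated z0 eF) => // /near_dnbhs_cn Fn.
have : \forall z \near z0^', False.
  by apply: filterS2 Fz0 Fn => z ->; rewrite eqxx.
by move=> /filter_ex[].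
Qed.

Lemma qdiff_is_derive F F' z : qdiff F F' -> is_derive z 1 F (F' z).
Proof.
move=> dF; have [K K0 HK] := dF (cn z + 1).
have cvF : (fun h => h^-1 *: (F (h *: 1 + z) - F z)) @ (0 : C)^' --> F' z.
  apply/cvgrPdist_le => e e0.
  have /complex_realP[d dE] : e \is Num.real by exact: gtr0_real.
  have d0 : 0 < d by rewrite -ltcR -dE.
  apply/near_dnbhs_cn; exists (Num.min 1 (d / (K + 1))).
    by rewrite lt_min ltr01 divr_gt0// ltr_wpDl.
  move=> h; rewrite subr0 lt_min => /andP[h0 /andP[h1 hd]].
  have hn0 : h != 0 by rewrite -cn_eq0 gt_eqF.
  rewrite normr_cn dE lecR.
  have -> : F' z - h^-1 *: (F (h *: 1 + z) - F z) =
    - (h^-1 * (F (z + h) - F z - h * F' z)).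
    rewrite [h *: 1]mulr1 [h + z]addrC; rewrite /GRing.scale /=; field; exact: hn0.
  rewrite cnN cnM cnV ler_pdivrMl//.
  apply: (@le_trans _ _ (K * cn h ^+ 2)).
    apply: HK; first by rewrite lerDl.
    by apply: (le_trans (cnD _ _)); rewrite lerD2l ltW.
  rewrite expr2 mulrCA ler_pM2l//.
  move: hd; rewrite ltr_pdivlMr ?ltr_wpDl// => /ltW /(le_trans _); apply.
  by rewrite mulrC ler_wpM2l ?(ltW h0)// lerDl.
split; first by apply/cvg_ex; exists (F' z).
exact: (cvg_lim (@norm_hausdorff _ _) cvF).
Qed.

End ExpType.

(** * Bounded complex integrals and the Fourier coefficients *)

Section Cexp.
Variable R : realType.
Local Notation C := (Cplx R).
Local Notation Re := complex.Re.
Local Notation Im := complex.Im.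
Implicit Types z w : C.

Lemma Re_cexp z : Re (cexp z) = expR (Re z) * cos (Im z).
Proof. by rewrite cReM /= mul0r subr0. Qed.

Lemma Im_cexp z : Im (cexp z) = expR (Re z) * sin (Im z).
Proof. by rewrite cImM /= mul0r addr0. Qed.

Lemma cexpD z w : cexp (z + w) = cexp z * cexp w.
Proof.
apply: cplx_ext.
  by rewrite cReM !Re_cexp !Im_cexp cReD cImD expRD cosD; ring.
by rewrite cImM !Re_cexp !Im_cexp cReD cImD expRD sinD; ring.
Qed.

Lemma cexp0 : cexp (0 : C) = 1.
Proof.
apply: cplx_ext; first by rewrite Re_cexp /= expR0 cos0 mulr1.
by rewrite Im_cexp /= sin0 mulr0.
Qed.

Lemma cn_cexp z : cn (cexp z) = expR (Re z).
Proof.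
rewrite cnE Re_cexp Im_cexp.
have -> : (expR (Re z) * cos (Im z)) ^+ 2 + (expR (Re z) * sin (Im z)) ^+ 2 =
  expR (Re z) ^+ 2 * (cos (Im z) ^+ 2 + sin (Im z) ^+ 2) by ring.
by rewrite cos2Dsin2 mulr1 sqrtr_sqr ger0_norm ?expR_ge0.
Qed.

Lemma cn_cexp_le z : cn (cexp z) <= expR (cn z).
Proof. by rewrite cn_cexp ler_expR (le_trans (ler_norm _)) ?Re_le_cn. Qed.

Lemma cexp_neq0 z : cexp z != 0.
Proof. by rewrite -cn_eq0 cn_cexp gt_eqF ?expR_gt0. Qed.

Lemma cexpN z : cexp (- z) = (cexp z)^-1.
Proof.
by apply: (mulfI (cexp_neq0 z)); rewrite mulfV ?cexp_neq0// -cexpD subrr cexp0.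
Qed.

Lemma cexp_real (x : R) : cexp (x%:C : C) = (expR x)%:C.
Proof.
apply: cplx_ext; first by rewrite Re_cexp /= cos0 mulr1.
by rewrite Im_cexp /= sin0 mulr0.
Qed.

Lemma mvt_bound (f df : R -> R) (x M : R) : (forall y : R, is_derive y 1 f (df y)) ->
  (forall y, `|y| <= `|x| -> `|df y| <= M) -> `|f x - f 0| <= M * `|x|.
Proof.
move=> fd dM.
have cf (a b : R) : {within `[a, b], continuous f}.
  apply: continuous_subspaceT => y; apply: differentiable_continuous.
  by apply/derivable1_diffP; have [] := fd y.
have [x0|x0] := leP 0 x.
  have [c cx E] := MVT_segment x0 (fun y _ => fd y) (cf _ _).
  rewrite E subr0 normrM ler_wpM2r// dM//.
  by move: cx; rewrite in_itv /= => /andP[c0 cx]; rewrite !ger0_norm.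
have [c cx E] := MVT_segment (ltW x0) (fun y _ => fd y) (cf _ _).
rewrite distrC E sub0r normrM normrN ler_wpM2r// dM//.
move: cx; rewrite in_itv /= => /andP[c0 cx].
by rewrite !ler0_norm ?(ltW x0)// lerN2.
Qed.

Lemma abs_sin_le (x : R) : `|sin x| <= `|x|.
Proof.
have := @mvt_bound sin cos x 1 (fun y => is_derive_sin y) (fun y _ => cos_max y).
by rewrite sin0 subr0 mul1r.
Qed.

Lemma abs_cosB1_le (x : R) : `|cos x - 1| <= x ^+ 2.
Proof.
rewrite -real_normK ?num_real// expr2.
have := @mvt_bound cos (fun y => - sin y) x `|x| (fun y => is_derive_cos y).
rewrite cos0; apply => y yx.
by rewrite normrN; apply: (le_trans (abs_sin_le _)).
Qed.

Lemma abs_sinB_le (x : R) : `|x| <= 1 -> `|sin x - x| <= x ^+ 2.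
Proof.
move=> x1; rewrite -real_normK ?num_real// expr2.
have dsx (y : R) : is_derive y 1 (fun y : R => sin y - y) (cos y - 1).
  exact: is_deriveB.
have := @mvt_bound (fun y => sin y - y) _ x `|x| dsx.
rewrite sin0 subr0 subr0; apply => y yx.
apply: (le_trans (abs_cosB1_le _)); rewrite -real_normK ?num_real//.
have := normr_ge0 y; nra.
Qed.

Lemma abs_expRB_le (x : R) : `|x| <= 1 / 2 -> `|expR x - 1 - x| <= 2 * x ^+ 2.
Proof.
move=> /ler_normlP[x1 x2]; have := expR_ge1Dx x; have := expR_ge1Dx (- x).
have := expR_gt0 x; have := expRxMexpNx_1 x.
move: (expR x) (expR (- x)) => a b ab a0 Hb Ha.
rewrite ger0_norm; first by nra.
by lra.
Qed.

Lemma cn_cexpB_small w : cn w <= 1 / 2 -> cn (cexp w - 1 - w) <= 8 * cn w ^+ 2.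
Proof.
move=> w2; apply: (le_trans (cn_le_ReIm _)).
have aw := Re_le_cn w; have bw := Im_le_cn w.
rewrite !(cReD, cImD, cReN, cImN) Re_cexp Im_cexp /=.
move: (Re w) (Im w) aw bw => a b aw bw; rewrite oppr0 addr0.
have := @abs_expRB_le a (le_trans aw w2).
have := abs_cosB1_le b.
have := @abs_sinB_le b (le_trans bw (le_trans w2 _)).
move: w2 aw bw (expR_gt0 a).
move: (cn w) (expR a) (cos b) (sin b) => r e c s r2 /ler_normlP[a1 a2] /ler_normlP[b1 b2] e0.
move=> /(_ _)/ler_normlP[]; first by lra.
move=> s1 s2 /ler_normlP[c1 c2] /ler_normlP[e1 e2].
have r0 : 0 <= r by lra.
have a2r : a ^+ 2 <= r ^+ 2 by nra.
have b2r : b ^+ 2 <= r ^+ 2 by nra.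
have e3 : e <= 2 by nra.
have -> : e * c - 1 - a = (e - 1 - a) + e * (c - 1) by ring.
have -> : e * s - b = e * (s - b) + (e - 1) * b by ring.
have H1 : `|e - 1 - a + e * (c - 1)| <= 4 * r ^+ 2.
  apply: (le_trans (ler_normD _ _)); rewrite normrM gtr0_norm//.
  have : `|c - 1| <= r ^+ 2 by apply/ler_normlP; split; lra.
  have : `|e - 1 - a| <= 2 * r ^+ 2 by apply/ler_normlP; split; lra.
  move=> A1 A2; have := ler_pM (ltW e0) (normr_ge0 (c - 1)) e3 A2.
  by lra.
have H2 : `|e * (s - b) + (e - 1) * b| <= 4 * r ^+ 2.
  have E : `|e - 1| <= 2 * r by apply/ler_normlP; split; nra.
  apply: (le_trans (ler_normD _ _)); rewrite !normrM.
  have : `|e| <= 2 by rewrite gtr0_norm.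
  have : `|s - b| <= r ^+ 2 by apply/ler_normlP; split; lra.
  have : `|b| <= r by apply/ler_normlP; split; lra.
  move=> B1 B2 B3.
  have := ler_pM (normr_ge0 e) (normr_ge0 (s - b)) B3 B2.
  have := ler_pM (normr_ge0 (e - 1)) (normr_ge0 b) E B1.
  have -> : 2 * r * r = 2 * r ^+ 2 by ring.
  by lra.
by lra.
Qed.

(** Second-order estimates matter only for small w; beyond |w| = 1/2 the factor |w|^2 is at least
    1/4 and absorbs the trivial bound. *)
Lemma cn_cexpB (L : R) : exists2 K, 0 <= K & forall w, cn w <= L ->
  cn (cexp w - 1 - w) <= K * cn w ^+ 2.
Proof.
pose M := expR L + 1 + `|L|.
have M0 : 0 <= M by rewrite !addr_ge0 ?expR_ge0.
exists (8 + 4 * M) => [|w wL]; first by lra.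
have [w2|w2] := leP (cn w) (1 / 2).
  apply: (le_trans (cn_cexpB_small w2)); rewrite ler_wpM2r ?exprn_ge0 ?cn_ge0//.
  by lra.
have q : 1 / 4 <= cn w ^+ 2 by move: w2; clear; nra.
have M8 : 0 <= 8 + 4 * M by lra.
apply: (@le_trans _ _ M); last by have := ler_wpM2l M8 q; lra.
apply: (le_trans (cnB _ _)); apply: lerD; last by rewrite (le_trans wL) ?ler_norm.
apply: (le_trans (cnB _ _)); rewrite cn1 lerD2r (le_trans (cn_cexp_le _))//.
by rewrite ler_expR.
Qed.

End Cexp.

(** * Integrals of bounded measurable functions over a set of finite measure *)

Section BoundedIntegral.
Context d (T : measurableType d) (R : realType) (mu : {measure set T -> \bar R}).
Variable D : set T.
Hypothesis mD : measurable D.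
Hypothesis Dfin : (mu D < +oo)%E.
Local Notation C := (Cplx R).
Local Notation Re := (@complex.Re R).
Local Notation Im := (@complex.Im R).
Implicit Types F G : T -> C.

Definition bmeas F := [/\ measurable_fun D (Re \o F), measurable_fun D (Im \o F) &
  exists K : R, forall x, D x -> cn (F x) <= K].

Lemma bmeas_cst (c : C) : bmeas (fun=> c).
Proof. by split; [exact: measurable_cst|exact: measurable_cst|exists (cn c)]. Qed.

Lemma bmeasD F G : bmeas F -> bmeas G -> bmeas (fun x => F x + G x).
Proof.
move=> [F1 F2 [K FK]] [G1 G2 [L GL]]; split.
- rewrite (_ : _ \o _ = (Re \o F) \+ (Re \o G)); first exact: measurable_funD.
  by apply/funext => x /=; rewrite cReD.
- rewrite (_ : _ \o _ = (Im \o F) \+ (Im \o G)); first exact: measurable_funD.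
  by apply/funext => x /=; rewrite cImD.
- by exists (K + L) => x Dx; apply: (le_trans (cnD _ _)); rewrite lerD ?FK ?GL.
Qed.

Lemma bmeasM F G : bmeas F -> bmeas G -> bmeas (fun x => F x * G x).
Proof.
move=> [F1 F2 [K FK]] [G1 G2 [L GL]]; split.
- rewrite (_ : _ \o _ = ((Re \o F) \* (Re \o G)) \- ((Im \o F) \* (Im \o G))).
    by apply: measurable_funB; exact: measurable_funM.
  by apply/funext => x /=; rewrite cReM.
- rewrite (_ : _ \o _ = ((Re \o F) \* (Im \o G)) \+ ((Im \o F) \* (Re \o G))).
    by apply: measurable_funD; exact: measurable_funM.
  by apply/funext => x /=; rewrite cImM.
- by exists (K * L) => x Dx; rewrite cnM ler_pM ?cn_ge0 ?FK ?GL.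
Qed.

Lemma bmeasN F : bmeas F -> bmeas (fun x => - F x).
Proof.
move=> /(bmeasM (bmeas_cst (-1))); congr bmeas.
by apply/funext => x; rewrite mulN1r.
Qed.

Lemma bmeasB F G : bmeas F -> bmeas G -> bmeas (fun x => F x - G x).
Proof. by move=> bF bG; apply: bmeasD => //; exact: bmeasN. Qed.

Lemma bmeasX F n : bmeas F -> bmeas (fun x => F x ^+ n).
Proof.
move=> bF; elim: n => [|n IH].
  by have := bmeas_cst 1; congr bmeas; apply/funext => x; rewrite expr0.
by have := bmeasM bF IH; congr bmeas; apply/funext => x; rewrite exprS.
Qed.

Lemma bmeas_sum I (r : seq I) (P : pred I) (F : I -> T -> C) :
  (forall i, P i -> bmeas (F i)) -> bmeas (fun x => \sum_(i <- r | P i) F i x).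
Proof.
move=> bF; elim: r => [|i r IH].
  by have := bmeas_cst 0; congr bmeas; apply/funext => x; rewrite big_nil.
case Pi: (P i).
  by have := bmeasD (bF _ Pi) IH; congr bmeas; apply/funext => x; rewrite big_cons Pi.
by move: IH; congr bmeas; apply/funext => x; rewrite big_cons Pi.
Qed.

Lemma bmeas_prod I (r : seq I) (P : pred I) (F : I -> T -> C) :
  (forall i, P i -> bmeas (F i)) -> bmeas (fun x => \prod_(i <- r | P i) F i x).
Proof.
move=> bF; elim: r => [|i r IH].
  by have := bmeas_cst 1; congr bmeas; apply/funext => x; rewrite big_nil.
case Pi: (P i).
  by have := bmeasM (bF _ Pi) IH; congr bmeas; apply/funext => x; rewrite big_cons Pi.
by move: IH; congr bmeas; apply/funext => x; rewrite big_cons Pi.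
Qed.

Lemma bmeas_cexp F : bmeas F -> bmeas (fun x => cexp (F x)).
Proof.
move=> [F1 F2 [K FK]].
have mE : measurable_fun D (expR \o (Re \o F)).
  by apply: measurableT_comp => //; exact: measurable_expR.
split.
- rewrite (_ : _ \o _ = (expR \o (Re \o F)) \* (cos \o (Im \o F))).
    apply: measurable_funM => //; apply: measurableT_comp => //.
    by apply: continuous_measurable_fun; exact: continuous_cos.
  by apply/funext => x; exact: Re_cexp.
- rewrite (_ : _ \o _ = (expR \o (Re \o F)) \* (sin \o (Im \o F))).
    apply: measurable_funM => //; apply: measurableT_comp => //.
    by apply: continuous_measurable_fun; exact: continuous_sin.
  by apply/funext => x; exact: Im_cexp.
- exists (expR K) => x Dx; apply: (le_trans (cn_cexp_le _)).
  by rewrite ler_expR FK.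
Qed.

Lemma bmeas_conj F : bmeas F -> bmeas (fun x => (F x)^*).
Proof.
move=> [F1 F2 [K FK]]; split.
- by rewrite (_ : _ \o _ = Re \o F)//; apply/funext => x /=; case: (F x).
- rewrite (_ : _ \o _ = \- (Im \o F)); first exact: measurable_funN.
  by apply/funext => x /=; case: (F x).
- by exists K => x Dx; rewrite cn_conj FK.
Qed.

Lemma bmeas_integrable F : bmeas F -> cintegrable mu D F.
Proof.
move=> [F1 F2 [K FK]].
split; apply: measurable_bounded_integrable => //;
  exists K; split; rewrite ?num_real// => x Kx y Dy /=; apply: (le_trans _ (ltW Kx)).
  by apply: (le_trans (Re_le_cn _)); exact: FK.
by apply: (le_trans (Im_le_cn _)); exact: FK.
Qed.

Lemma eq_cintegral F G : (forall x, D x -> F x = G x) ->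
  cintegral mu D F = cintegral mu D G.
Proof.
move=> FG; rewrite /cintegral; congr (_ +i* _); apply: eq_Rintegral => x;
  by rewrite inE => /FG ->.
Qed.

Lemma cintegralD F G : bmeas F -> bmeas G ->
  cintegral mu D (fun x => F x + G x) = cintegral mu D F + cintegral mu D G.
Proof.
move=> /bmeas_integrable[F1 F2] /bmeas_integrable[G1 G2].
rewrite /cintegral; apply: cplx_ext; rewrite ?cReD ?cImD /=.
  rewrite -RintegralD//; apply: eq_Rintegral => x _; exact: cReD.
rewrite -RintegralD//; apply: eq_Rintegral => x _; exact: cImD.
Qed.

Lemma integrable_ZlB (a b : R) (f g : T -> R) : mu.-integrable D (EFin \o f) ->
  mu.-integrable D (EFin \o g) ->
  Rintegral mu D (fun x => a * f x + b * g x) = a * Rintegral mu D f + b * Rintegral mu D g.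
Proof.
move=> fi gi; rewrite RintegralD//.
- by rewrite !RintegralZl.
- have := integrableZl mD a fi; congr (integrable _ _ _).
- have := integrableZl mD b gi; congr (integrable _ _ _).
Qed.

Lemma cintegralZ (c : C) F : bmeas F ->
  cintegral mu D (fun x => c * F x) = c * cintegral mu D F.
Proof.
move=> /bmeas_integrable[F1 F2].
rewrite /cintegral; apply: cplx_ext; rewrite ?cReM ?cImM /=.
  rewrite -mulNr -integrable_ZlB//; apply: eq_Rintegral => x _.
  by rewrite cReM mulNr.
rewrite -integrable_ZlB//; apply: eq_Rintegral => x _; exact: cImM.
Qed.

Lemma cintegralB F G : bmeas F -> bmeas G ->
  cintegral mu D (fun x => F x - G x) = cintegral mu D F - cintegral mu D G.
Proof.
move=> bF bG; rewrite cintegralD//; last exact: bmeasN.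
congr (_ + _); rewrite -[RHS]mulN1r -cintegralZ//.
by apply: eq_cintegral => x _; rewrite mulN1r.
Qed.

Lemma cintegral_cst (c : C) : cintegral mu D (fun=> c) = c * (fine (mu D))%:C.
Proof.
rewrite /cintegral; apply: cplx_ext; rewrite ?cReM ?cImM /= ?mulr0 ?subr0 ?addr0 ?add0r.
  by rewrite Rintegral_cst.
by rewrite Rintegral_cst// mulrC.
Qed.

Lemma cintegral_sum I (r : seq I) (P : pred I) (F : I -> T -> C) :
  (forall i, P i -> bmeas (F i)) ->
  cintegral mu D (fun x => \sum_(i <- r | P i) F i x) =
  \sum_(i <- r | P i) cintegral mu D (F i).
Proof.
move=> bF; elim: r => [|i r IH].
  rewrite big_nil -[RHS](mul0r ((fine (mu D))%:C : C)) -cintegral_cst.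
  by apply: eq_cintegral => x _; rewrite big_nil.
rewrite big_cons; case Pi: (P i).
  rewrite -IH -cintegralD; [|exact: bF|exact: bmeas_sum].
  by apply: eq_cintegral => x _; rewrite big_cons Pi.
by rewrite -IH; apply: eq_cintegral => x _; rewrite big_cons Pi.
Qed.

(** The factor 2 comes from bounding real and imaginary parts separately. *)
Lemma cn_cintegral_le F (K : R) : bmeas F -> (forall x, D x -> cn (F x) <= K) ->
  cn (cintegral mu D F) <= 2 * K * fine (mu D).
Proof.
move=> /bmeas_integrable[F1 F2] FK.
have E f : mu.-integrable D (EFin \o f) -> (forall x, D x -> `|f x| <= K) ->
    `|Rintegral mu D f| <= K * fine (mu D).
  move=> fi fK; apply: (le_trans (le_normr_Rintegral mD fi)).
  rewrite -Rintegral_cst//; apply: le_Rintegral => //.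
    by have := integrable_abse fi; congr (integrable _ _ _).
  have [_ _ _] := bmeas_cst K%:C.
  by have [] := bmeas_integrable (bmeas_cst K%:C).
apply: (le_trans (cn_le_ReIm _)); rewrite -mulrA mulr_natl mulr2n.
apply: lerD; apply: E => // x Dx.
  by apply: (le_trans (Re_le_cn _)); exact: FK.
by apply: (le_trans (Im_le_cn _)); exact: FK.
Qed.

(** Differentiation under the integral sign: exp(h phi) - 1 - h phi is quadratic in h uniformly in
    x, because [phi] is bounded. Fourier coefficients and group averages are both of this form. *)
Lemma expder_cintegral (phi psi : T -> C) : bmeas phi -> bmeas psi ->
  expder (fun j z => cintegral mu D (fun x => psi x * phi x ^+ j * cexp (z * phi x))).
Proof.
move=> bphi bpsi.
have bE z j : bmeas (fun x => psi x * phi x ^+ j * cexp (z * phi x)).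
  apply: bmeasM; first by apply: bmeasM => //; exact: bmeasX.
  by apply: bmeas_cexp; apply: bmeasM => //; exact: bmeas_cst.
have [_ _ [B0 phiB0]] := bphi; have [_ _ [A0 psiA0]] := bpsi.
pose A := `|A0|; pose B := `|B0|.
have psiA x : D x -> cn (psi x) <= A.
  by move=> Dx; apply: (le_trans (psiA0 _ Dx)); exact: ler_norm.
have phiB x : D x -> cn (phi x) <= B.
  by move=> Dx; apply: (le_trans (phiB0 _ Dx)); exact: ler_norm.
have A_ge0 : 0 <= A by exact: normr_ge0.
have B_ge0 : 0 <= B by exact: normr_ge0.
have eB (rho : R) z x : D x -> cn z <= rho -> cn (cexp (z * phi x)) <= expR (rho * B).
  move=> Dx zr; apply: (le_trans (cn_cexp_le _)); rewrite ler_expR cnM.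
  by rewrite ler_pM ?cn_ge0 ?phiB.
split=> [j rho|rho].
  have [K K0 HK] := cn_cexpB (2 * rho * B).
  exists (2 * (A * B ^+ j * expR (rho * B) * (K * B ^+ 2)) * fine (mu D)).
    rewrite !mulr_ge0 ?exprn_ge0 ?expR_ge0 ?fine_ge0//.
  move=> z h zr hr.
  rewrite -cintegralB//.
  have -> : h * cintegral mu D (fun x => psi x * phi x ^+ j.+1 * cexp (z * phi x)) =
      cintegral mu D (fun x => h * (psi x * phi x ^+ j.+1 * cexp (z * phi x))).
    by rewrite cintegralZ.
  have bh : bmeas (fun x => h * (psi x * phi x ^+ j.+1 * cexp (z * phi x))).
    by apply: bmeasM => //; exact: bmeas_cst.
  rewrite -cintegralB//; last exact: bmeasB.
  have -> : 2 * (A * B ^+ j * expR (rho * B) * (K * B ^+ 2)) * fine (mu D) * cn h ^+ 2 =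
    2 * (A * B ^+ j * expR (rho * B) * (K * B ^+ 2) * cn h ^+ 2) * fine (mu D) by ring.
  apply: cn_cintegral_le; first by apply: bmeasB => //; exact: bmeasB.
  move=> x Dx.
  have -> : psi x * phi x ^+ j * cexp ((z + h) * phi x) -
      psi x * phi x ^+ j * cexp (z * phi x) -
      h * (psi x * phi x ^+ j.+1 * cexp (z * phi x)) =
    psi x * phi x ^+ j * cexp (z * phi x) * (cexp (h * phi x) - 1 - h * phi x).
    by rewrite mulrDl cexpD exprS; ring.
  have hphi : cn (h * phi x) <= cn h * B by rewrite cnM ler_wpM2l ?cn_ge0 ?phiB.
  have HV : cn (cexp (h * phi x) - 1 - h * phi x) <= K * (B ^+ 2 * cn h ^+ 2).
    apply: (le_trans (HK _ _)).
      apply: (le_trans hphi); rewrite ler_wpM2r//; exact: cn_le2 zr hr.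
    rewrite ler_wpM2l// -exprMn lerXn2r ?nnegrE ?cn_ge0 ?mulr_ge0 ?cn_ge0//.
    by rewrite (mulrC B).
  have HE := eB rho z x Dx zr.
  move: HE HV; move: (cexp (z * phi x)) (cexp (h * phi x) - 1 - h * phi x) => E V HE HV.
  have -> : A * B ^+ j * expR (rho * B) * (K * B ^+ 2) * cn h ^+ 2 =
    A * B ^+ j * expR (rho * B) * (K * (B ^+ 2 * cn h ^+ 2)) by ring.
  rewrite 3!cnM cnX.
  rewrite ler_pM ?mulr_ge0 ?exprn_ge0 ?cn_ge0//.
  rewrite ler_pM ?mulr_ge0 ?exprn_ge0 ?cn_ge0//.
  by rewrite ler_pM ?exprn_ge0 ?cn_ge0 ?psiA// lerXn2r ?nnegrE ?cn_ge0 ?phiB.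
exists (2 * (A * expR (rho * B)) * fine (mu D)), B; split=> //.
  by rewrite !mulr_ge0 ?expR_ge0 ?fine_ge0.
move=> j z zr.
have -> : 2 * (A * expR (rho * B)) * fine (mu D) * B ^+ j =
  2 * (A * B ^+ j * expR (rho * B)) * fine (mu D) by ring.
apply: cn_cintegral_le => // x Dx.
have HE := eB rho z x Dx zr; move: HE; move: (cexp (z * phi x)) => E HE.
rewrite 2!cnM cnX ler_pM ?mulr_ge0 ?exprn_ge0 ?cn_ge0//.
by rewrite ler_pM ?exprn_ge0 ?cn_ge0 ?psiA// lerXn2r ?nnegrE ?cn_ge0 ?phiB.
Qed.

End BoundedIntegral.

(** * The Fourier coefficients of the symbol as functions of t *)

Section Fourier.
Variable R : realType.
Local Notation C := (Cplx R).
Local Notation leb := (@lebesgue_measure R).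
Local Notation circle := (`[0, 2 * pi]%classic : set R).
Implicit Types (t z : C) (k : int) (th : R).

Lemma two_pi_gt0 : 0 < 2 * pi :> R.
Proof. by rewrite mulr_gt0// pi_gt0. Qed.

Lemma leb_circle : leb circle = (2 * pi)%:E.
Proof. by rewrite lebesgue_measure_itv /= lte_fin two_pi_gt0 -EFinD subr0. Qed.

Let mcircle : measurable circle.
Proof. exact: measurable_itv. Qed.

Let fincircle : (leb circle < +oo)%E.
Proof. by rewrite leb_circle ltry. Qed.

Lemma bmeas_ith : bmeas circle (fun th => 'i * (th%:C : C)).
Proof.
split.
- rewrite (_ : _ \o _ = cst 0); first exact: measurable_cst.
  by apply/funext => th; rewrite /= mul0r mulr0 subrr.
- rewrite (_ : _ \o _ = id); first exact: measurable_id.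
  by apply/funext => th; rewrite /= mul0r mul1r add0r.
exists (2 * pi) => th; rewrite /= in_itv /= => /andP[th0 th1].
by rewrite cnM cn_real ger0_norm// cnE /= expr0n expr1n add0r sqrtr1 mul1r.
Qed.

Definition circ th : C := cexp ('i * th%:C).
Definition twocos th : C := circ th + (circ th)^-1.
Definition mode k th : C := cexp (- ('i * k%:~R * th%:C)).

Lemma bmeas_twocos : bmeas circle twocos.
Proof.
apply: bmeasD; first by apply: bmeas_cexp => //; exact: bmeas_ith.
rewrite (_ : (fun x => (circ x)^-1) = (fun x => cexp (- ('i * (x%:C : C))))).
  by apply: bmeas_cexp; apply: bmeasN; exact: bmeas_ith.
by apply/funext => x; rewrite cexpN.
Qed.

Lemma bmeas_mode k : bmeas circle (mode k).
Proof.
apply: bmeas_cexp; apply: bmeasN.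
have := bmeasM (bmeas_cst circle (k%:~R : C)) bmeas_ith.
by congr bmeas; apply/funext => th; ring.
Qed.

Lemma mode_twocos k th : mode k th * twocos th = mode (k - 1) th + mode (k + 1) th.
Proof.
rewrite /twocos /circ -cexpN mulrDr -!cexpD; congr (cexp _ + cexp _).
  by rewrite rmorphB /=; ring.
by rewrite rmorphD /=; ring.
Qed.

Definition fcoef k t : C := fourier (symbol t) k.

Lemma fcoefE k t : fcoef k t = ((2 * pi)^-1)%:C *
  cintegral leb circle (fun th => mode k th * twocos th ^+ 0 * cexp (t * twocos th)).
Proof.
rewrite /fcoef /fourier; congr (_ * _); apply: eq_cintegral => th _.
by rewrite expr0 mulr1 mulrC.
Qed.

Lemma exptype_fcoef k : exptype (fcoef k).
Proof.
have H : exptype (fun t => ((2 * pi)^-1)%:C *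
  cintegral leb circle (fun th => mode k th * twocos th ^+ 0 * cexp (t * twocos th))).
  apply: exptypeM; first exact: exptype_cst.
  have := @expder_cintegral _ _ R (@lebesgue_measure R) circle mcircle fincircle _ _ bmeas_twocos (bmeas_mode k).
  set G := (fun (j : nat) (z : C) => _) => dG; by exists G.
by apply: exptype_ext H => t; rewrite fcoefE.
Qed.

Lemma qdiff_fcoef k : qdiff (fcoef k) (fun t => fcoef (k - 1) t + fcoef (k + 1) t).
Proof.
have [dG bG] := @expder_cintegral _ _ R (@lebesgue_measure R) circle mcircle fincircle _ _ bmeas_twocos (bmeas_mode k).
have := qdiffM (qdiff_cst ((2 * pi)^-1)%:C) (dG 0%N) (ballbdd_cst _) (ballbdd_cst _)
  (ballbdd_expder 0%N (conj dG bG)) (ballbdd_expder 1%N (conj dG bG)).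
apply: qdiff_ext => t /=; first by rewrite fcoefE.
rewrite mul0r add0r !fcoefE -mulrDr; congr (_ * _).
have bme k' : bmeas circle (fun th => mode k' th * twocos th ^+ 0 * cexp (t * twocos th)).
  apply: bmeasM; first by apply: bmeasM; [exact: bmeas_mode|apply: bmeasX; exact: bmeas_twocos].
  by apply: bmeas_cexp; apply: bmeasM; [exact: bmeas_cst|exact: bmeas_twocos].
rewrite -(@cintegralD _ _ R (@lebesgue_measure R) circle mcircle fincircle);
  [|exact: bme|exact: bme]; apply: eq_cintegral => th _.
by rewrite expr1 mode_twocos expr0 !mulr1 mulrDl.
Qed.

(** Every derivative at 0 is a sum of values of the [g k] at 0, so all Taylor coefficients vanish.
    This replaces a change of variable in [fcoefN] and an integration by parts in [fcoef_rec]. *)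
Lemma ladder_eq0 (g : int -> C -> C) : (forall k, exptype (g k)) ->
  (forall k, qdiff (g k) (fun t => g (k - 1) t + g (k + 1) t)) ->
  (forall k, g k 0 = 0) -> forall k t, g k t = 0.
Proof.
move=> eg dg g0.
have [G GP] : {G : int -> nat -> C -> C & forall k, G k 0%N = g k /\ expder (G k)}.
  apply: (@boolp.choice _ _ (fun k (H : nat -> C -> C) => H 0%N = g k /\ expder H)) => k.
  have [H H0 dH] := eg k; by exists H.
have step j k z : G k j.+1 z = G (k - 1) j z + G (k + 1) j z.
  elim: j k z => [|j IH] k z.
    have dgk : qdiff (G k 0%N) (fun z => G (k - 1) 0%N z + G (k + 1) 0%N z).
      by rewrite (GP k).1 (GP (k - 1)).1 (GP (k + 1)).1; exact: dg.
    exact: (qdiff_unique ((GP k).2.1 0%N) dgk z).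
  have dgk : qdiff (G k j.+1) (fun z => G (k - 1) j.+1 z + G (k + 1) j.+1 z).
    have := qdiffD ((GP (k - 1)).2.1 j) ((GP (k + 1)).2.1 j).
    by apply: qdiff_ext => // u; rewrite IH.
  exact: (qdiff_unique ((GP k).2.1 j.+1) dgk z).
have G0 j k : G k j 0 = 0.
  by elim: j k => [|j IH] k; [rewrite (GP k).1|rewrite step !IH addr0].
move=> k t; rewrite -(GP k).1.
by apply: (expder_taylor_eq (z0 := 0) (z := t) (w0 := 0) (w := t) (GP k).2 (expder_zero R)) => j; rewrite G0.
Qed.

Lemma Rintegral_FTC (f F : R -> R) (a b : R) : a < b -> continuous f ->
  (forall x : R, is_derive x 1 F (f x)) -> Rintegral leb `[a, b] f = F b - F a.
Proof.
move=> ab cf dF; rewrite /Rintegral (@continuous_FTC2 _ _ F)//.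
- exact: continuous_subspaceT.
- have cF : continuous F.
    move=> x; apply: differentiable_continuous; apply/derivable1_diffP; by have [] := dF x.
  split=> [x _||].
  + by have [] := dF x.
  + by apply: cvg_at_right_filter; exact: cF.
  + by apply: cvg_at_left_filter; exact: cF.
- by move=> x _; rewrite derive1E; exact: derive_val.
Qed.

Lemma cos_int2pi (m : nat) : cos (m%:R * (2 * pi)) = 1 :> R /\ sin (m%:R * (2 * pi)) = 0 :> R.
Proof.
have -> : m%:R * (2 * pi) = 0 + (pi *+ 2) *+ m :> R by rewrite add0r -[pi *+ 2]mulr_natl -[RHS]mulr_natl.
have := periodicn (@cosD2pi R) m 0; have := periodicn (@sinD2pi R) m 0.
by rewrite cos0 sin0.
Qed.

Lemma mode_int k : cintegral leb circle (mode k) = (2 * pi * (k == 0)%:R)%:C.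
Proof.
have [->|k0] := eqVneq k 0.
  rewrite mulr1 (_ : mode 0 = fun=> 1).
    transitivity (1 * (fine (leb circle))%:C : C); first exact: cintegral_cst.
    by rewrite leb_circle /= mul1r.
  by apply/funext => th; rewrite /mode mulr0 mul0r oppr0 cexp0.
have ReE th : complex.Re (mode k th) = cos (k%:~R * th).
  rewrite Re_cexp.
  have -> : - ('i * k%:~R * th%:C) = 0 +i* (- (k%:~R * th)) :> C.
    have -> : k%:~R = (k%:~R : R)%:C :> C by rewrite rmorph_int.
    by apply: cplx_ext; rewrite !(cReN, cImN, cReM, cImM) /=; ring.
  by rewrite /= expR0 mul1r cosN.
have ImE th : complex.Im (mode k th) = - sin (k%:~R * th).
  rewrite Im_cexp.
  have -> : - ('i * k%:~R * th%:C) = 0 +i* (- (k%:~R * th)) :> C.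
    have -> : k%:~R = (k%:~R : R)%:C :> C by rewrite rmorph_int.
    by apply: cplx_ext; rewrite !(cReN, cImN, cReM, cImM) /=; ring.
  by rewrite /= expR0 mul1r sinN.
have kR : k%:~R != 0 :> R by rewrite intr_eq0.
have dk (x : R) : is_derive x 1 (fun x : R => k%:~R * x) (k%:~R : R).
  apply: is_derive_eq; by rewrite /GRing.scale /= mulr1.
have ck : continuous (fun x : R => k%:~R * x : R).
  by move=> x; apply: differentiable_continuous; apply/derivable1_diffP; have [] := dk x.
have ends : cos (k%:~R * (2 * pi)) = 1 :> R /\ sin (k%:~R * (2 * pi)) = 0 :> R.
  case: (k) => m; first exact: cos_int2pi.
  rewrite NegzE mulrNz mulNr cosN sinN; have [-> ->] := cos_int2pi m.+1.
  by rewrite oppr0.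
have dS (x : R) : is_derive x 1 (fun x : R => (k%:~R)^-1 * sin (k%:~R * x)) (cos (k%:~R * x)).
  have H := @is_derive1_comp _ sin (fun x : R => k%:~R * x) x _ _ (is_derive_sin _) (dk x).
  apply: (is_derive_eq (is_deriveZ (k%:~R)^-1 H)).
  by rewrite /GRing.scale /=; field.
have dC (x : R) : is_derive x 1 (fun x : R => (k%:~R)^-1 * cos (k%:~R * x)) (- sin (k%:~R * x)).
  have H := @is_derive1_comp _ cos (fun x : R => k%:~R * x) x _ _ (is_derive_cos _) (dk x).
  apply: (is_derive_eq (is_deriveZ (k%:~R)^-1 H)).
  by rewrite /GRing.scale /=; field.
have cS : continuous (fun x : R => - sin (k%:~R * x)).
  by move=> x; apply: continuousN; apply: continuous_comp; [exact: ck|exact: continuous_sin].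
have cC : continuous (fun x : R => cos (k%:~R * x)).
  by move=> x; apply: continuous_comp; [exact: ck|exact: continuous_cos].
rewrite mulr0 rmorph0; apply: cplx_ext => /=.
  rewrite (_ : (fun x => _) = fun th => cos (k%:~R * th)); last exact/funext.
  by rewrite (Rintegral_FTC two_pi_gt0 cC dS) ends.2 !mulr0 sin0 mulr0 subrr.
rewrite (_ : (fun x => _) = fun th => - sin (k%:~R * th)); last exact/funext.
by rewrite (Rintegral_FTC two_pi_gt0 cS dC) ends.1 mulr0 cos0 subrr.
Qed.

Lemma fcoef0 k : fcoef k 0 = (k == 0)%:R.
Proof.
rewrite fcoefE (_ : (fun th => _) = mode k); last first.
  by apply/funext => th; rewrite expr0 mulr1 mul0r cexp0 mulr1.
have p0 : 2 * pi != 0 :> R by rewrite gt_eqF ?two_pi_gt0.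
by rewrite mode_int -rmorphM mulKf// rmorph_nat.
Qed.

Lemma fcoefN k t : fcoef (- k) t = fcoef k t.
Proof.
apply/eqP; rewrite -subr_eq0; apply/eqP; move: k t.
apply: (ladder_eq0 (g := fun k t => fcoef (- k) t - fcoef k t)) => k.
- by apply: exptypeB; exact: exptype_fcoef.
- have dN := qdiffM (qdiff_cst (-1)) (qdiff_fcoef k) (ballbdd_cst _) (ballbdd_cst _)
    _ (_ : ballbdd _).
  have bf k' : ballbdd (fcoef k').
    by have [G <- dG] := exptype_fcoef k'; exact: ballbdd_expder.
  have {}dN := dN (bf k) (ballbddD (bf _) (bf _)).
  have := qdiffD (qdiff_fcoef (- k)) dN.
  apply: qdiff_ext => u; first by ring.
  have -> : - (k - 1) = - k + 1 by ring.
  have -> : - (k + 1) = - k - 1 by ring.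
  move: (fcoef _ _) (fcoef _ _) (fcoef _ _) (fcoef _ _) (fcoef _ _) => a b c d e.
  by ring.
- by rewrite !fcoef0 oppr_eq0 subrr.
Qed.

(** The difference of the two sides satisfies the ladder equation, and at t = 0 it is k times the
    Kronecker symbol at k = 0, that is 0. *)
Lemma fcoef_rec k t : k%:~R * fcoef k t = t * (fcoef (k - 1) t - fcoef (k + 1) t).
Proof.
apply/eqP; rewrite -subr_eq0; apply/eqP; move: k t.
have bf k' : ballbdd (fcoef k').
  by have [G <- dG] := exptype_fcoef k'; exact: ballbdd_expder.
have bN F : ballbdd F -> ballbdd (fun u : C => (-1) * F u).
  by move=> bF; exact: ballbddM (ballbdd_cst _) bF.
have dN F F' : ballbdd F -> ballbdd F' -> qdiff F F' ->
    qdiff (fun u : C => (-1) * F u) (fun u => 0 * F u + (-1) * F' u).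
  by move=> bF bF' dF; exact: qdiffM (qdiff_cst _) dF (ballbdd_cst _) (ballbdd_cst _) bF bF'.
apply: (ladder_eq0 (g := fun k t => k%:~R * fcoef k t -
  t * (fcoef (k - 1) t - fcoef (k + 1) t))) => k.
- apply: exptypeB; apply: exptypeM.
  + exact: exptype_cst.
  + exact: exptype_fcoef.
  + exact: exptype_id.
  + by apply: exptypeB; exact: exptype_fcoef.
- have bd k' := ballbddD (bf (k' - 1)) (bf (k' + 1)).
  have d1 := qdiffM (qdiff_cst (k%:~R : C)) (qdiff_fcoef k) (ballbdd_cst _) (ballbdd_cst _)
    (bf k) (bd k).
  have d2 := qdiffD (qdiff_fcoef (k - 1)) (dN _ _ (bf (k + 1)) (bd _) (qdiff_fcoef (k + 1))).
  have d3 := qdiffM (@qdiff_id R) d2 (@ballbdd_id R) (ballbdd_cst 1)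
    (ballbddD (bf (k - 1)) (bN _ (bf (k + 1))))
    (ballbddD (bd (k - 1)) (ballbddD (ballbddM (ballbdd_cst 0) (bf _)) (bN _ (bd (k + 1))))).
  have d4 := qdiffD d1 (dN _ _ _ _ d3).
  have := d4 _ _; move=> d5.
  have b3 : ballbdd (fun u : C => u * (fcoef (k - 1) u + -1 * fcoef (k + 1) u)).
    exact: ballbddM (@ballbdd_id R) (ballbddD (bf (k - 1)) (bN _ (bf (k + 1)))).
  have {}d5 := d5 b3 (ballbddD (ballbddM (ballbdd_cst 1) (ballbddD (bf (k - 1)) (bN _ (bf (k + 1)))))
    (ballbddM (@ballbdd_id R)
    (ballbddD (bd (k - 1)) (ballbddD (ballbddM (ballbdd_cst 0) (bf _)) (bN _ (bd (k + 1))))))).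
  apply: qdiff_ext d5 => u /=.
    by move: (fcoef _ _) (fcoef _ _) (fcoef _ _) => a b c; ring.
  have -> : k - 1 + 1 = k by ring.
  have -> : k + 1 - 1 = k by ring.
  rewrite rmorphB rmorphD /= rmorph1.
  move: (fcoef k u) (fcoef (k - 1) u) (fcoef (k + 1) u) (fcoef (k - 1 - 1) u).
  move: (fcoef (k + 1 + 1) u) (k%:~R : C) => a b c d e f. by ring.
- by rewrite mul0r subr0 fcoef0; case: eqP => [->|_]; rewrite ?mul0r ?mulr0.
Qed.

End Fourier.

(** * Orthogonal polynomials on the unit circle *)

Section Szego.
Variables (K : fieldType) (f : int -> K).
Implicit Types (p q : {poly K}) (n : nat) (j : int).

Definition toep n : 'M[K]_n := \matrix_(j < n, k < n) f (j%:Z - k%:Z).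

(* The coefficient of z^j in p(z) f(z). *)
Definition pair p j : K := \sum_(k < size p) p`_k * f (j - k%:Z).

Lemma pairE m p j : (size p <= m)%N -> pair p j = \sum_(k < m) p`_k * f (j - k%:Z).
Proof.
move=> pm; rewrite /pair (big_ord_widen m (fun k => p`_k * f (j - k%:Z)))//.
rewrite big_mkcond; apply: eq_bigr => k _; case: ltnP => // sk.
by rewrite nth_default// mul0r.
Qed.

Lemma pairD p q j : pair (p + q) j = pair p j + pair q j.
Proof.
pose m := maxn (size p) (size q).
rewrite (@pairE m (p + q)) ?size_polyD// (@pairE m p) ?leq_maxl// (@pairE m q) ?leq_maxr//.
by rewrite -big_split; apply: eq_bigr => k _; rewrite coefD mulrDl.
Qed.

Lemma pairZ (c : K) p j : pair (c *: p) j = c * pair p j.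
Proof.
rewrite (@pairE (size p) (c *: p)) ?size_scale_leq// /pair big_distrr /=.
by apply: eq_bigr => k _; rewrite coefZ mulrA.
Qed.

Lemma pairN p j : pair (- p) j = - pair p j.
Proof. by rewrite -scaleN1r pairZ mulN1r. Qed.

Lemma pairB p q j : pair (p - q) j = pair p j - pair q j.
Proof. by rewrite pairD pairN. Qed.

Lemma pair_mulX p j : pair ('X * p) j = pair p (j - 1).
Proof.
rewrite (@pairE (size p).+1); last first.
  by rewrite -commr_polyX; apply: (leq_trans (size_polyMleq _ _)); rewrite size_polyX addn2.
rewrite big_ord_recl coefXM eqxx mul0r add0r; apply: eq_bigr => k _.
rewrite coefXM lift0 /=; congr (_ * f _); lia.
Qed.

Definition rev n p : {poly K} := \poly_(i < n.+1) p`_(n - i).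

Lemma size_rev n p : (size (rev n p) <= n.+1)%N.
Proof. exact: size_poly. Qed.

Lemma coef_rev n p i : (rev n p)`_i = if (i <= n)%N then p`_(n - i) else 0.
Proof. by rewrite coef_poly ltnS. Qed.

Lemma toep_mul_poly n p (i : 'I_n) : (size p <= n)%N ->
  (toep n *m (poly_rV p : 'rV_n)^T) i 0 = pair p i%:Z.
Proof.
move=> pn; rewrite (@pairE n)// mxE; apply: eq_bigr => k _.
by rewrite !mxE mulrC.
Qed.

Lemma pair_eq0 n p : \det (toep n) != 0 -> (size p <= n)%N ->
  (forall i : nat, (i < n)%N -> pair p i%:Z = 0) -> p = 0.
Proof.
move=> D pn H.
have T : toep n *m (poly_rV p : 'rV_n)^T = 0.
  by apply/colP => i; rewrite toep_mul_poly// H// mxE.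
have : (poly_rV p : 'rV_n)^T = 0.
  rewrite -[LHS](@mulKmx _ _ _ (toep n)) ?unitmxE ?unitfE//.
  by rewrite T mulmx0.
move=> /(congr1 trmx); rewrite trmxK trmx0 => p0.
by rewrite -(@poly_rV_K _ n p)// p0 linear0.
Qed.

(** The lower coefficients solve the Toeplitz system expressing orthogonality to 1, ..., z^(n-1).
    The polynomial is monic in every case; its orthogonality requires [toep n] to be invertible. *)
Definition opuc n : {poly K} :=
  'X^n - rVpoly (invmx (toep n) *m \col_(j < n) f (j%:Z - n%:Z))^T.

Lemma size_opuc_sub n : (size ('X^n - opuc n)%R <= n)%N.
Proof. by rewrite opprB addrC subrK; exact: size_poly. Qed.

Lemma coef_opuc_lead n : (opuc n)`_n = 1.
Proof.
have := size_opuc_sub n => /(nth_default 0) /eqP.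
by rewrite coefB coefXn eqxx subr_eq0 => /eqP <-.
Qed.

Lemma size_opuc n : size (opuc n) = n.+1.
Proof.
rewrite -[opuc n](subKr 'X^n) size_polyDl size_polyXn// size_polyN ltnS.
exact: size_opuc_sub.
Qed.

Lemma pair_opuc_lt n (i : nat) : \det (toep n) != 0 -> (i < n)%N ->
  pair (opuc n) i%:Z = 0.
Proof.
move=> D ni; rewrite pairB.
set v := invmx _ *m _.
have -> : pair (rVpoly v^T) i%:Z = f (i%:Z - n%:Z).
  rewrite -[ i ]/(nat_of_ord (Ordinal ni)) -toep_mul_poly ?size_poly// rVpolyK trmxK.
  by rewrite mulKVmx ?unitmxE ?unitfE// mxE.
rewrite (@pairE n.+1) ?size_polyXn// big_ord_recr /= coefXn eqxx mul1r big1 ?add0r ?subrr//.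
by move=> k _; rewrite coefXn ltn_eqF// mul0r.
Qed.

(** The squared norm of p_n, equal to D_(n+1) / D_n by [det_toepS]. *)
Definition kappa n := pair (opuc n) n%:Z.
Definition verb n := (opuc n)`_0.
Definition opucr n := rev n (opuc n).
(** The coefficient of z^(n-1) in p_n; the factor ['X] gives it the value 0 when n = 0. *)
Definition ell n := ('X * opuc n)`_n.

Lemma size_opucr n : (size (opucr n) <= n.+1)%N.
Proof. exact: size_poly. Qed.

Lemma opuc0 : opuc 0 = 1.
Proof.
have s := size_opuc 0; apply/polyP => -[|i].
  by rewrite coef_opuc_lead coef1.
by rewrite nth_default ?s// coef1.
Qed.

Lemma verb0 : verb 0 = 1.
Proof. by rewrite /verb opuc0 coef1. Qed.

Lemma coef_opucr0 n : (opucr n)`_0 = 1.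
Proof. by rewrite coef_rev leq0n subn0 coef_opuc_lead. Qed.

Lemma coef_opucr_lead n : (opucr n)`_n = verb n.
Proof. by rewrite coef_rev leqnn subnn. Qed.

Lemma ell0 : ell 0 = 0.
Proof. by rewrite /ell coefXM. Qed.

Lemma pair_opuc n (i : nat) : \det (toep n) != 0 -> (i <= n)%N ->
  pair (opuc n) i%:Z = kappa n * (i == n)%:R.
Proof.
move=> D; rewrite leq_eqVlt => /predU1P[->|ni]; first by rewrite eqxx mulr1.
by rewrite pair_opuc_lt// ltn_eqF// mulr0.
Qed.

Lemma kappa_neq0 n : \det (toep n) != 0 -> \det (toep n.+1) != 0 -> kappa n != 0.
Proof.
move=> D D1; apply/eqP => k0.
have : opuc n = 0.
  apply: pair_eq0 D1 _ _; first by rewrite size_opuc.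
  by move=> i; rewrite ltnS => /(pair_opuc D) ->; rewrite k0 mul0r.
by move=> /(congr1 (fun p : {poly K} => p`_n)); rewrite coef_opuc_lead coef0 => /eqP; rewrite oner_eq0.
Qed.

(** A unitriangular matrix with the coefficients of p_n in its last column turns the last column of
    the Toeplitz matrix into (0, ..., 0, kappa_n). *)
Lemma det_toepS n : \det (toep n) != 0 -> \det (toep n.+1) = kappa n * \det (toep n).
Proof.
move=> D.
pose M : 'M[K]_n.+1 := \matrix_(i, j) if j == ord_max then (opuc n)`_i else (i == j)%:R.
have detM : \det M = 1.
  rewrite -det_tr det_trig.
    rewrite big_ord_recr /= big1 ?mul1r => [|i _].
      by rewrite !mxE eqxx coef_opuc_lead.
    rewrite !mxE eqxx ifF//; apply/eqP => /(congr1 val) /=.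
    by move=> E; have := ltn_ord i; rewrite E ltnn.
  apply/is_trig_mxP => i j ij; rewrite !mxE.
  case: eqP => [iE|_]; last first.
    by case: eqP => // E; rewrite E ltnn in ij.
  by move: ij; rewrite iE /= ltnNge -ltnS ltn_ord.
rewrite -[LHS]mulr1 -detM -det_mulmx (expand_det_col _ ord_max) (bigD1 ord_max)//=.
have ent i : (toep n.+1 *m M) i ord_max = pair (opuc n) i%:Z.
  rewrite (@pairE n.+1) ?size_opuc// mxE; apply: eq_bigr => k _.
  by rewrite !mxE eqxx mulrC.
rewrite big1 ?addr0 => [|i iN]; last first.
  have ni : (i < n)%N.
    by rewrite ltn_neqAle -[(i <= n)%N]ltnS ltn_ord andbT; apply: contra iN => /eqP E; apply/eqP/val_inj.
  by rewrite ent pair_opuc_lt// mul0r.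
rewrite ent; congr (_ * _); rewrite /cofactor addnn -signr_odd odd_double mul1r.
have lm (k : 'I_n) : lift ord_max k = widen_ord (leqnSn n) k.
  by apply/val_inj; exact: lift_max.
have wm (k : 'I_n) : (widen_ord (leqnSn n) k == ord_max) = false.
  by rewrite -lm; apply/negbTE; rewrite eq_sym neq_lift.
congr (\det _); apply/matrixP => i j; rewrite !mxE !lm.
rewrite (bigD1 (widen_ord (leqnSn n) j))//= !mxE wm eqxx mulr1.
rewrite big1 ?addr0// => k kj.
by rewrite !mxE wm (negbTE kj) mulr0.
Qed.

(** * Even weights: reversal and Szego's recurrence *)

Section Even.
Hypothesis f_even : forall j, f (- j) = f j.

Lemma pair_rev n p j : (size p <= n.+1)%N -> pair (rev n p) j = pair p (n%:Z - j).
Proof.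
move=> pn; rewrite (@pairE n.+1) ?size_rev// (@pairE n.+1 p)//.
rewrite (reindex_inj rev_ord_inj); apply: eq_bigr => k _ /=.
have kn : (k <= n)%N by rewrite -ltnS.
rewrite coef_rev subSS leq_subr subKn// -[f (n%:Z - j - _)]f_even.
by congr (_ * f _); lia.
Qed.

Lemma pair_opucr n (i : nat) : \det (toep n) != 0 -> (i <= n)%N ->
  pair (opucr n) i%:Z = kappa n * (i == 0%N)%:R.
Proof.
move=> D ni; rewrite pair_rev ?size_opuc// subzn// pair_opuc ?leq_subr//.
by congr (_ * _%:R); lia.
Qed.

(** Among 1, ..., z^n, p_n pairs only with z^n and its reversal only with 1, so both sides have the
    same pairings. Szego's recurrence, the relations for z-derivatives and the flow in t are all
    instances. Adding two indicators covers n = 0, where the two positions coincide. *)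
Lemma opuc_span n (al be : K) q : \det (toep n) != 0 -> \det (toep n.+1) != 0 ->
  (size q <= n.+1)%N ->
  (forall i : nat, (i <= n)%N ->
     pair q i%:Z = al * (kappa n * (i == n)%:R) + be * (kappa n * (i == 0%N)%:R)) ->
  q = al *: opuc n + be *: opucr n.
Proof.
move=> D D1 qn H; apply/eqP; rewrite -subr_eq0; apply/eqP.
apply: pair_eq0 D1 _ _.
  rewrite (leq_trans (size_polyD _ _))// geq_max qn size_polyN.
  rewrite (leq_trans (size_polyD _ _))// geq_max.
  by rewrite !(leq_trans (size_scale_leq _ _)) ?size_opuc ?size_opucr.
move=> i ni; rewrite pairB pairD !pairZ H// pair_opuc// pair_opucr//.
by rewrite subrr.
Qed.

Lemma szego_aux n : \det (toep n) != 0 -> \det (toep n.+1) != 0 ->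
  opuc n.+1 = 'X * opuc n + verb n.+1 *: opucr n /\
  pair (opuc n) (-1) = - verb n.+1 * kappa n.
Proof.
move=> D D1; have k0 := kappa_neq0 D D1.
(* Among 1, ..., z^n, only 1 can pair nontrivially with p_(n+1) - z p_n; comparing constant terms
   then identifies [be] with p_(n+1)(0). *)
pose be := - pair (opuc n) (-1) / kappa n.
have E : opuc n.+1 - 'X * opuc n = 0 *: opuc n + be *: opucr n.
  apply: opuc_span => //.
    apply/leq_sizeP => k; rewrite leq_eqVlt => /predU1P[<-|nk].
      by rewrite coefB coef_opuc_lead coefXM /= coef_opuc_lead subrr.
    rewrite nth_default// (leq_trans (size_polyD _ _))// geq_max size_opuc nk size_polyN.
    by rewrite -commr_polyX size_mulX ?size_opuc// -size_poly_eq0 size_opuc.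
  move=> i ni; rewrite pairB pair_mulX pair_opuc_lt// sub0r mul0r add0r.
  case: i ni => [|i] ni; first by rewrite sub0r mulr1 divfK.
  have -> : i.+1%:Z - 1 = i%:Z by lia.
  by rewrite pair_opuc_lt// !mulr0 oppr0.
have b : be = verb n.+1.
  have := congr1 (fun p : {poly K} => p`_0) E.
  by rewrite scale0r add0r coefB coefXM /= subr0 coefZ coef_opucr0 mulr1.
split; first by rewrite -b -[be *: _]add0r -{1}(scale0r (opuc n)) -E addrC subrK.
by rewrite -b /be mulNr divfK// opprK.
Qed.

Lemma szego n : \det (toep n) != 0 -> \det (toep n.+1) != 0 ->
  opuc n.+1 = 'X * opuc n + verb n.+1 *: opucr n.
Proof. by move=> D D1; have [] := szego_aux D D1. Qed.

Lemma pair_opuc_m1 n : \det (toep n) != 0 -> \det (toep n.+1) != 0 ->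
  pair (opuc n) (-1) = - verb n.+1 * kappa n.
Proof. by move=> D D1; have [] := szego_aux D D1. Qed.

Lemma szego_rev n : \det (toep n) != 0 -> \det (toep n.+1) != 0 ->
  opucr n.+1 = opucr n + verb n.+1 *: ('X * opuc n).
Proof.
move=> D D1; apply/polyP => i.
rewrite [opucr n.+1]/opucr (szego D D1) coefD coefZ !coef_rev coefD coefZ !coefXM coef_rev.
have [i_le|i_gt] := leqP i n.+1; last first.
  rewrite leqNgt (ltnW i_gt) /= add0r; case: i i_gt => [|i]//= i_gt.
  by rewrite nth_default ?mulr0// size_opuc.
case: i i_le => [|i] i_le; first by rewrite !subn0 /= ltnn !mulr0.
rewrite subSS leq_subr subKn// subn_eq0 subnS /=.
by case: ltnP.
Qed.

Lemma kappaS n : \det (toep n) != 0 -> \det (toep n.+1) != 0 ->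
  kappa n.+1 = (1 - verb n.+1 ^+ 2) * kappa n.
Proof.
move=> D D1; rewrite {1}/kappa szego// pairD pairZ pair_mulX.
have -> : n.+1%:Z - 1 = n%:Z by lia.
rewrite pair_rev ?size_opuc//; have -> : n%:Z - n.+1%:Z = -1 by lia.
by rewrite pair_opuc_m1// /kappa; ring.
Qed.

Lemma ellS n : \det (toep n) != 0 -> \det (toep n.+1) != 0 ->
  ell n.+1 = ell n + verb n.+1 * verb n.
Proof.
move=> D D1; rewrite {1}/ell coefXM /= szego// coefD coefZ.
by rewrite coef_opucr_lead.
Qed.

Lemma verb_sqr_neq1 n : \det (toep n) != 0 -> \det (toep n.+1) != 0 ->
  \det (toep n.+2) != 0 -> 1 - verb n.+1 ^+ 2 != 0.
Proof.
move=> D D1 D2; have := kappa_neq0 D1 D2; rewrite kappaS//.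
by apply: contra => /eqP ->; rewrite mul0r.
Qed.

(** Write the reversal of p_(n+1) as 1 + z w. Its orthogonality to z, ..., z^(n+1) says that the
    Toeplitz matrix sends the coefficients of w to - f^+, and the last of these coefficients is
    p_(n+1)(0). *)
Lemma toep_fplus n : \det (toep n.+1) != 0 ->
  (invmx (toep n.+1) *m (\col_(j < n.+1) f j.+1%:Z)) ord_max 0 = - verb n.+1.
Proof.
move=> D.
pose w : {poly K} := \poly_(i < n.+1) (opucr n.+1)`_i.+1.
have wE : opucr n.+1 = 1 + 'X * w.
  apply/polyP => -[|i]; rewrite coefD coef1 coefXM; first by rewrite coef_opucr0 addr0.
  rewrite [RHS]/= add0r [w`_i]coef_poly; case: ltnP => ni; first by [].
  by rewrite (nth_default 0 (s := opucr n.+1))//; exact: leq_trans (size_opucr _) _.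
have ws : (size w <= n.+1)%N by exact: size_poly.
have -> : \col_(j < n.+1) f j.+1%:Z = toep n.+1 *m (- (poly_rV w : 'rV_n.+1)^T).
  apply/colP => i; rewrite mulmxN !mxE.
  have := toep_mul_poly i ws; rewrite mxE => ->.
  have : pair (opucr n.+1) i.+1%:Z = 0 by rewrite pair_opucr// ?mulr0.
  rewrite wE pairD pair_mulX; have -> : i.+1%:Z - 1 = i%:Z by lia.
  rewrite (@pairE 1 1) ?size_poly1// big_ord1 coef1 mul1r subr0 => /eqP.
  by rewrite addr_eq0 => /eqP.
rewrite mulKmx ?unitmxE ?unitfE// !mxE coef_poly ltnSn.
by rewrite coef_opucr_lead.
Qed.

(** * Relations in z and in t *)

Section Flow.
Variable t : K.
Hypothesis f_rec : forall j, j%:~R * f j = t * (f (j - 1) - f (j + 1)).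

(** With theta = z d/dz, this is the coefficient of z^j in theta(p f) = theta(p) f + p theta(f); the
    hypothesis [f_rec] reads theta(f) = t (z - 1/z) f. *)
Lemma pair_theta p j :
  pair ('X * p^`()) j = j%:~R * pair p j - t * (pair p (j - 1) - pair p (j + 1)).
Proof.
have sX : (size ('X * p^`())%R <= size p)%N.
  apply/leq_sizeP => k pk; rewrite coefXM; case: k pk => [|k] pk //=.
  by rewrite coef_deriv nth_default ?mul0rn.
rewrite (@pairE (size p))// /pair big_distrr /= -sumrB big_distrr -sumrB.
apply: eq_bigr => k _.
have -> : ('X * p^`())`_k = k%:R * p`_k.
  rewrite coefXM; case: (k : nat) => [|m] /=; first by rewrite mul0r.
  by rewrite coef_deriv mulr_natl.
have /= := f_rec (j - k%:Z).
have -> : j - k%:Z - 1 = j - 1 - k%:Z by ring.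
have -> : j - k%:Z + 1 = j + 1 - k%:Z by ring.
rewrite rmorphB /= => E.
rewrite -pmulrn in E.
rewrite (_ : t * _ = p`_k * (t * (f (j - 1 - k%:Z) - f (j + 1 - k%:Z)))); last by ring.
by rewrite -E; ring.
Qed.

Section Step.
Variable n : nat.
Hypotheses (D : \det (toep n) != 0) (D1 : \det (toep n.+1) != 0)
  (D2 : \det (toep n.+2) != 0).
Local Notation a := (verb n.+1).
Local Notation a' := (verb n.+2).
Local Notation phi := (1 - a ^+ 2).

Lemma pair_opuc_pm (i : nat) : (i <= n)%N ->
  pair (opuc n.+1) (i%:Z - 1) = - a' * kappa n.+1 * (i == 0%N)%:R /\
  pair (opuc n.+1) (i%:Z + 1) = kappa n.+1 * (i == n)%:R.
Proof.
move=> ni; split; last first.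
  have -> : i%:Z + 1 = i.+1%:Z by lia.
  by rewrite pair_opuc.
case: i ni => [|i] ni; first by rewrite sub0r pair_opuc_m1// mulr1.
have -> : i.+1%:Z - 1 = i%:Z by lia.
by rewrite pair_opuc_lt ?mulr0// ltnW.
Qed.

(** The leading terms on the left cancel, and by [pair_theta] the remaining pairings involve only
    the shifted values found in [pair_opuc_pm]. *)
Lemma opuc_theta : 'X * (opuc n.+1)^`() - n.+1%:R *: opuc n.+1 =
  (t * phi) *: (opuc n + a' *: opucr n).
Proof.
have k0 := kappa_neq0 D D1.
rewrite [(t * phi) *: _]scalerDr scalerA; apply: opuc_span => //.
  apply/leq_sizeP => k; rewrite leq_eqVlt => /predU1P[<-|nk].
    by rewrite coefB coefXM /= coef_deriv coefZ coef_opuc_lead mulr1 subrr.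
  rewrite coefB coefXM coefZ (nth_default 0 (s := opuc n.+1)) ?size_opuc// mulr0 subr0.
  case: k nk => [|k] nk //=; rewrite coef_deriv nth_default ?mul0rn// size_opuc//.
move=> i ni; rewrite pairB pairZ pair_theta pair_opuc_lt//.
have [-> ->] := pair_opuc_pm ni.
by rewrite kappaS//; ring.
Qed.

(** Here [q] stands for dp_(n+1)/dt; the hypothesis on its pairings is the derivative of the
    orthogonality relations ([pair_dopuc]). *)
Lemma opuc_flow q : (size q <= n.+1)%N -> (forall i : nat, (i <= n)%N ->
    pair q i%:Z = - (pair (opuc n.+1) (i%:Z - 1) + pair (opuc n.+1) (i%:Z + 1))) ->
  q = phi *: (a' *: opucr n - opuc n).
Proof.
move=> qn H; rewrite [a' *: _ - _]addrC -scaleN1r [phi *: _]scalerDr !scalerA.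
apply: opuc_span => // i ni; rewrite H//.
have [-> ->] := pair_opuc_pm ni.
by rewrite kappaS//; ring.
Qed.

(** Constant terms of [opuc_theta]: the discrete Painleve II equation. *)
Lemma dPII : - (n.+1%:R * a) = t * phi * (verb n + a').
Proof.
have := congr1 (fun p : {poly K} => p`_0) opuc_theta.
rewrite coefB coefXM /= sub0r !coefZ coefD coefZ coef_opucr0 mulr1.
by [].
Qed.

Lemma ell_closed : - ell n.+1 = t * phi * (1 + a' * verb n).
Proof.
have := congr1 (fun p : {poly K} => p`_n) opuc_theta.
rewrite !coefB !coefXM !coefZ coefD coefZ coef_opucr_lead coef_opuc_lead => <-.
rewrite /ell coefXM /=; case: (n) => [|m] /=; first by rewrite mul1r sub0r.
by rewrite coef_deriv -[_ *+ _]mulr_natl -natr1; ring.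
Qed.

Lemma opuc_phi : phi *: ('X * opuc n) = opuc n.+1 - a *: opucr n.+1 /\
  phi *: opucr n = opucr n.+1 - a *: opuc n.+1.
Proof.
rewrite szego_rev// szego//; split.
  rewrite scalerDr scalerA -expr2 scalerBl scale1r.
  by rewrite opprD addrA addrK.
rewrite scalerDr scalerA -expr2 scalerBl scale1r.
by rewrite opprD addrA addrK.
Qed.

Lemma opucr_deriv : (opucr n.+1)^`() = - (t * phi) *: (opucr n + a' *: opuc n).
Proof.
rewrite [- (t * phi) *: _]scalerDr addrC scalerA; apply: opuc_span => //.
  apply/leq_sizeP => k nk; rewrite coef_deriv nth_default ?mul0rn//.
  by apply: leq_trans (size_opucr _) _.
move=> i ni.
have -> : pair (opucr n.+1)^`() i%:Z = pair ('X * (opucr n.+1)^`()) (i%:Z + 1).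
  by rewrite pair_mulX addrK.
rewrite pair_theta addrK.
have -> : i%:Z + 1 = i.+1%:Z by lia.
rewrite pair_opucr// mulr0 mulr0 sub0r.
have -> : pair (opucr n.+1) i%:Z = kappa n.+1 * (i == 0%N)%:R.
  by rewrite pair_opucr// leqW.
have -> : pair (opucr n.+1) (i.+1%:Z + 1) = - a' * kappa n.+1 * (i == n)%:R.
  rewrite pair_rev ?size_opuc//.
  have -> : n.+1%:Z - (i.+1%:Z + 1) = (n - i)%:Z - 1 by lia.
  have [-> _] := pair_opuc_pm (leq_subr i n); congr (_ * _%:R); lia.
by rewrite kappaS//; ring.
Qed.

(* The linear system solved by [D_n p_n], for the logarithmic derivative      *)
(* [- 2 ell] of [D_n] and the time derivative [q] of [p_n].                   *)
Lemma opuc_system q : q = phi *: (a' *: opucr n - opuc n) ->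
  let P := opuc n.+1 in let N : K := n.+1%:R in
  t *: q - (2 * t * ell n.+1) *: P =
   (N *: P - 'X * P^`()) - 2 *: (N *: P + (N - 2) *: ('X * P^`()) - 'X ^+ 2 * P^`()^`())
   - (2 * t) *: ('X * (N *: P - 'X * P^`())) - (2 * t) *: P^`().
Proof.
move=> qE P N; have := opuc_theta; have := opucr_deriv; have [e1 e2] := opuc_phi.
have := dPII; have := ell_closed.
rewrite {}qE -/P -/N; rewrite -/P in e1 e2.
move: (opucr n.+1) (opuc n) (opucr n) (verb n) (ell n.+1) e1 e2 => Q u v a0 l.
move: P N => P N e1 e2 el dP eQ eP.
pose x : {poly K} := 'X.
(* After multiplication by x^2, both P' and x^2 P'' can be expressed through P and its reversal Q
   alone (X2 and X4 below), and the claim becomes a polynomial identity. *)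
have x0 : x ^+ 2 != 0 by rewrite expf_neq0// polyX_eq0.
rewrite -!mul_polyC !(polyCM, polyCD, polyCN, polyCB, polyC_exp, polyC1, mulNr) in e1 e2 eQ eP *.
(* [ell_closed] still contains p_n(0); [dPII] eliminates it in favour of a and a'. *)
have E0 : t%:P * l%:P = - t%:P ^+ 2 * (1 - a%:P ^+ 2) + a'%:P * (N%:P * t%:P * a%:P +
    t%:P ^+ 2 * (1 - a%:P ^+ 2) * a'%:P).
  rewrite -!(polyC1, polyC_exp, polyCM, polyCB, polyCN, polyCD); congr polyC.
  have -> : t * l = - t * - l by ring.
  rewrite el; have -> : N * t * a = - t * - (N * a) by ring.
  by rewrite dP; ring.
have dT : (t%:P)^`() = 0 by rewrite derivC.
have dA : (a%:P)^`() = 0 by rewrite derivC.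
have dB : (a'%:P)^`() = 0 by rewrite derivC.
have dM : (N%:P)^`() = 0 by rewrite derivC.
move: t%:P l%:P a%:P a'%:P N%:P E0 e1 e2 eQ eP dT dA dB dM =>
  T L A B M E0 e1 e2 eQ eP dT dA dB dM.
have X1 : x * P^`() = M * P + T * ((1 - A ^+ 2) * u) + T * B * ((1 - A ^+ 2) * v).
  by rewrite -[LHS](subrK (M * P)) eP; ring.
have X2 : x ^+ 2 * P^`() = M * x * P + T * (P - A * Q) + T * B * x * (Q - A * P).
  by rewrite -e1 -e2 expr2 -mulrA X1 /x; ring.
have XQ : x * Q^`() = - T * (x * (Q - A * P) + B * (P - A * Q)).
  by rewrite eQ -e1 -e2 /x; ring.
have X3 : x ^+ 2 * P^`()^`() = M * P + M * x * P^`() + T * (P^`() - A * Q^`()) +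
    T * B * (Q - A * P) + T * B * x * (Q^`() - A * P^`()) - 2 * x * P^`().
  have := congr1 (@deriv K) X2.
  rewrite /x !(derivD, derivN, derivM, derivXn, derivX, dT, dA, dB, dM) /= => E.
  rewrite -[LHS](addrK (2 * 'X * P^`())).
  rewrite (_ : _ * P^`()^`() + _ = ('X *+ 2) * P^`() + 'X ^+ 2 * P^`()^`()); last by ring.
  by rewrite E; ring.
have X4 : x ^+ 2 * (x ^+ 2 * P^`()^`()) = x ^+ 2 * (M * P + T * B * (Q - A * P)) +
    M * x * (x ^+ 2 * P^`()) + T * (x ^+ 2 * P^`()) - T * A * x * (x * Q^`()) +
    T * B * x ^+ 2 * (x * Q^`()) - T * B * A * x * (x ^+ 2 * P^`()) - 2 * x * (x ^+ 2 * P^`()).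
  by rewrite X3; ring.
apply: (mulfI x0).
pose q0 := B * x * ((1 - A ^+ 2) * v) - (1 - A ^+ 2) * (x * u).
transitivity (T * x * q0 - 2 * (T * L) * x ^+ 2 * P); first by rewrite /q0 /x; ring.
transitivity (x ^+ 2 * M * P - x * (x ^+ 2 * P^`()) -
  2 * (M * P * x ^+ 2 + (M - 2) * x * (x ^+ 2 * P^`()) - x ^+ 2 * (x ^+ 2 * P^`()^`()))
  - 2 * T * x * (x ^+ 2 * M * P - x * (x ^+ 2 * P^`())) - 2 * T * (x ^+ 2 * P^`())); last first.
  by rewrite /x; ring.
rewrite X4 X2 XQ E0 /q0 e1 e2.
by ring.
Qed.

End Step.
End Flow.
End Even.
End Szego.

(** * The flow in t *)

Section Analytic.
Variable R : realType.
Local Notation C := (Cplx R).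
Implicit Types (t z : C) (n : nat).

Definition fc t : int -> C := fun k => fcoef k t.

Lemma fc_even t k : fc t (- k) = fc t k.
Proof. exact: fcoefN. Qed.

Lemma fc_rec t k : k%:~R * fc t k = t * (fc t (k - 1) - fc t (k + 1)).
Proof. exact: fcoef_rec. Qed.

Lemma toeplitzE n t : toeplitz n (symbol t) = toep (fc t) n.
Proof. by apply/matrixP => i j; rewrite !mxE. Qed.

Lemma DnE n t : Dn n t = \det (toep (fc t) n).
Proof. by rewrite /Dn toeplitzE. Qed.

Lemma exptype_Dn n : exptype (@Dn R n).
Proof.
apply: (@exptype_ext _ (fun t => \det (toep (fc t) n))); first by move=> t; rewrite DnE.
apply: exptype_det => i j.
by apply: exptype_ext (exptype_fcoef R (i%:Z - j%:Z)) => t; rewrite mxE.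
Qed.

Lemma Dn0 n : Dn n (0 : C) = 1.
Proof.
rewrite DnE (_ : toep _ _ = 1%:M) ?det1//; apply/matrixP => i j.
by rewrite !mxE /fc fcoef0 subr_eq0.
Qed.

(* [D_n] times the coefficient of [z^k] in the monic orthogonal polynomial     *)
(* [p_n]; an entire function of [t], whereas [p_n] has poles.                  *)
Definition Dopuc n k t : C :=
  if k == n then Dn n t else
  if insub k is Some i then
    - (\adj (toep (fc t) n) *m \col_(j < n) fc t (j%:Z - n%:Z)) i 0
  else 0.

Lemma exptype_Dopuc n k : exptype (@Dopuc n k).
Proof.
rewrite /Dopuc; case: eqP => _; first exact: exptype_Dn.
case: insubP => [i _ _|_]; last exact: exptype_cst.
apply: exptypeN.
apply: (@exptype_ext _ (fun t => \sum_(j < n) (\adj (toep (fc t) n)) i j * fcoef (j%:Z - n%:Z) t)).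
  by move=> t; rewrite mxE; apply: eq_bigr => j _; rewrite !mxE.
apply: exptype_sum => j _; apply: exptypeM; last exact: exptype_fcoef.
apply: exptype_adj => k1 k2.
by apply: exptype_ext (exptype_fcoef R (k1%:Z - k2%:Z)) => t; rewrite mxE.
Qed.

Lemma DopucE n k t : Dn n t != 0 -> Dn n t * (opuc (fc t) n)`_k = Dopuc n k t.
Proof.
move=> D; rewrite /Dopuc; have [->|kn] := eqVneq k n; first by rewrite coef_opuc_lead mulr1.
rewrite coefB coefXn (negbTE kn) sub0r coef_rVpoly.
case: insubP => [i _ _|_]; last by rewrite oppr0 mulr0.
rewrite mxE /invmx unitmxE unitfE -DnE D -scalemxAl mxE mulrN; congr (- _).
by rewrite mulVKf.
Qed.

(** Where this holds, p_0, ..., p_n are genuinely orthogonal and division by the D_j is allowed. By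
    [near_good] the exceptions form a discrete set. *)
Definition good n t := forall j, (j <= n)%N -> Dn j t != 0.

Lemma goodW n m t : (m <= n)%N -> good n t -> good m t.
Proof. by move=> mn g j jm; apply: g; exact: leq_trans mn. Qed.

Lemma good_det n t j : good n t -> (j <= n)%N -> \det (toep (fc t) j) != 0.
Proof. by move=> g jn; rewrite -DnE g. Qed.

Lemma near_good n (z0 : C) : \forall t \near z0^', good n t.
Proof.
elim: n => [|n IH].
  have : \forall t \near z0^', Dn 0 t != 0.
    by apply: (@exptype_near _ _ _ 0); [exact: exptype_Dn|rewrite Dn0 oner_neq0].
  by apply: filterS => t D j; rewrite leqn0 => /eqP ->.
have : \forall t \near z0^', Dn n.+1 t != 0.
  by apply: (@exptype_near _ _ _ 0); [exact: exptype_Dn|rewrite Dn0 oner_neq0].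
apply: filterS2 IH => t g D j; rewrite leq_eqVlt => /predU1P[->//|].
by rewrite ltnS; exact: g.
Qed.

Lemma exptype_continuous (F : C -> C) : exptype F -> continuous F.
Proof.
move=> /exptype_qdiff[F' _ dF] z; apply: differentiable_continuous.
by apply/derivable1_diffP; have [] := qdiff_is_derive z dF.
Qed.

Lemma near_neq0 (F : C -> C) z : exptype F -> F z != 0 -> \forall t \near z, F t != 0.
Proof.
move=> eF Fz.
have := exptype_continuous eF (x := z).
by move=> /cvgr_neq0; apply.
Qed.

Lemma near_good_nbhs n z : good n z -> \forall t \near z, good n t.
Proof.
elim: n => [|n IH] g.
  have := near_neq0 (exptype_Dn 0) (g 0%N isT).
  by apply: filterS => t D j; rewrite leqn0 => /eqP ->.
have := near_neq0 (exptype_Dn n.+1) (g n.+1 (leqnn _)).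
apply: filterS2 (IH (goodW (leqnSn _) g)) => t g' D j; rewrite leq_eqVlt => /predU1P[->//|].
by rewrite ltnS; exact: g'.
Qed.

Lemma is_derive_fc k t : is_derive t 1 (fcoef k) (fcoef (k - 1) t + fcoef (k + 1) t).
Proof. exact: qdiff_is_derive t (qdiff_fcoef k). Qed.

Lemma is_derive_unique (F G : C -> C) t (a b : C) : {near t, F =1 G} ->
  is_derive t 1 F a -> is_derive t 1 G b -> a = b.
Proof.
move=> FG dF dG.
have [_ <-] := near_eq_is_derive FG dF.
by have [_ ->] := dG.
Qed.

Lemma derivable_coef n k t : Dn n t != 0 ->
  derivable (fun t => (opuc (fc t) n)`_k) t 1.
Proof.
move=> D.
have [F' _ dF] := exptype_qdiff (exptype_Dopuc n k).
have [G' _ dG] := exptype_qdiff (exptype_Dn n).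
have dq : derivable (fun t => Dopuc n k t * (Dn n t)^-1) t 1.
  apply: derivableM; first by have [] := qdiff_is_derive t dF.
  by apply: derivableV => //; have [] := qdiff_is_derive t dG.
apply: near_eq_derivable dq.
have := near_neq0 (exptype_Dn n) D; apply: filterS => s Ds.
by rewrite -DopucE// mulrAC mulfV// mul1r.
Qed.

Definition dopuc n t : {poly C} :=
  \poly_(k < n) 'D_1 (fun t => (opuc (fc t) n)`_k) t.

Lemma is_derive_opuc n k t : Dn n t != 0 ->
  is_derive t 1 (fun t => (opuc (fc t) n)`_k) (dopuc n t)`_k.
Proof.
move=> D; rewrite coef_poly; case: ltnP => [_|].
  exact/derivableP/derivable_coef.
rewrite leq_eqVlt => /predU1P[<-|nk].
  rewrite (_ : (fun t => _) = cst 1); first exact: is_derive_cst.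
  by apply/funext => s; rewrite coef_opuc_lead.
rewrite (_ : (fun t => _) = cst 0); first exact: is_derive_cst.
by apply/funext => s; rewrite nth_default// size_opuc.
Qed.

(** The orthogonality relation holds on a neighbourhood of [t], so its derivative is 0; f_k' =
    f_(k-1) + f_(k+1) produces the right-hand side. *)
Lemma pair_dopuc n t (i : nat) : Dn n t != 0 -> (i < n)%N ->
  pair (fc t) (dopuc n t) i%:Z =
  - (pair (fc t) (opuc (fc t) n) (i%:Z - 1) + pair (fc t) (opuc (fc t) n) (i%:Z + 1)).
Proof.
move=> D ni.
pose F (k : 'I_n.+1) (s : C) := (opuc (fc s) n)`_k * fcoef (i%:Z - k%:Z) s.
have dF (k : 'I_n.+1) := is_deriveM (is_derive_opuc k D) (is_derive_fc (i%:Z - k%:Z) t).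
have dS := is_derive_sum dF.
have near0 : {near t, (\sum_(k < n.+1) (fun s => F k s)) =1 cst 0}.
  have := near_neq0 (exptype_Dn n) D; apply: filterS => s Ds.
  rewrite fct_sumE; transitivity (pair (fc s) (opuc (fc s) n) i%:Z).
    by rewrite (@pairE _ _ n.+1) ?size_opuc.
  by rewrite pair_opuc_lt// -DnE.
have := @is_derive_unique _ _ t _ 0 near0 dS (is_derive_cst (0 : C) t 1).
rewrite (@pairE _ _ n.+1 (dopuc n t)); last exact: leq_trans (size_poly _ _) (leqnSn n).
rewrite (@pairE _ _ n.+1 (opuc (fc t) n) (i%:Z - 1)) ?size_opuc//.
rewrite (@pairE _ _ n.+1 (opuc (fc t) n) (i%:Z + 1)) ?size_opuc// -big_split /= => E.
apply/eqP; rewrite -addr_eq0 -big_split /= -[eqbRHS]E; apply/eqP.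
apply: eq_bigr => k _.
rewrite /GRing.scale /= /fc.
have -> : i%:Z - 1 - k%:Z = i%:Z - k%:Z - 1 by ring.
have -> : i%:Z + 1 - k%:Z = i%:Z - k%:Z + 1 by ring.
by rewrite -mulrDr addrC; congr (_ + _); rewrite mulrC.
Qed.

Lemma dopuc_flow n t : good n.+2 t ->
  dopuc n.+1 t = (1 - verb (fc t) n.+1 ^+ 2) *:
    (verb (fc t) n.+2 *: opucr (fc t) n - opuc (fc t) n).
Proof.
move=> g; apply: (opuc_flow (fc_even t)); try by apply: good_det g _; lia.
  exact: size_poly.
by move=> i ni; rewrite pair_dopuc//; exact: g.
Qed.

Lemma cderM (K : numFieldType) (F G : K -> K) (t a b : K) : is_derive t 1 F a -> is_derive t 1 G b ->
  is_derive t 1 (fun s => F s * G s) (a * G t + F t * b).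
Proof.
move=> dF dG; apply: (is_derive_eq (is_deriveM dF dG)).
by rewrite /GRing.scale /= addrC mulrC.
Qed.

Lemma cderD (K : numFieldType) (F G : K -> K) (t a b : K) : is_derive t 1 F a -> is_derive t 1 G b ->
  is_derive t 1 (fun s => F s + G s) (a + b).
Proof. by move=> dF dG; exact: is_deriveD. Qed.

Lemma cderC (K : numFieldType) (c t : K) : is_derive t 1 (fun=> c) 0.
Proof. exact: is_derive_cst. Qed.

Lemma cder_id (K : numFieldType) (t : K) : is_derive t 1 (fun s : K => s) 1.
Proof. exact: is_derive_id. Qed.

Lemma cderV (K : numFieldType) (F : K -> K) (t a : K) : F t != 0 -> is_derive t 1 F a ->
  is_derive t 1 (fun s => (F s)^-1) (- a / F t ^+ 2).
Proof.
move=> F0 [dF <-]; apply: DeriveDef; first exact: derivableV.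
by rewrite deriveV// /GRing.scale /= mulrC mulrN mulNr -exprVn.
Qed.

Lemma cder_near (K : numFieldType) (F G : K -> K) (t a b : K) : (\near t, F t = G t) -> is_derive t 1 F a ->
  a = b -> is_derive t 1 G b.
Proof. by move=> FG dF <-; exact: near_eq_is_derive FG dF. Qed.

Local Notation a_ n t := (verb (fc t) n).

Lemma verb_flow n t : good n.+2 t ->
  is_derive t 1 (fun s => a_ n.+1 s) ((1 - a_ n.+1 t ^+ 2) * (a_ n.+2 t - a_ n t)).
Proof.
move=> g; apply: (is_derive_eq (is_derive_opuc 0 (g n.+1 _))); first by lia.
by rewrite dopuc_flow// coefZ coefB coefZ coef_opucr0 mulr1.
Qed.

Lemma verb_dPII n t : good n.+2 t ->
  - (n.+1%:R * a_ n.+1 t) = t * (1 - a_ n.+1 t ^+ 2) * (a_ n t + a_ n.+2 t).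
Proof.
by move=> g; apply: (dPII (fc_even t) (fc_rec t)); apply: good_det g _; lia.
Qed.

(** Discrete Painleve II removes the upper neighbour a_(n+2) from the flow; in [verb_raise] it
    removes the lower one. The two equations then close on the pair (a_n, a_(n+1)). *)
Lemma verb_lower n t : good n.+2 t -> t != 0 ->
  is_derive t 1 (fun s => a_ n.+1 s)
    (- (n.+1%:R * a_ n.+1 t) / t - 2 * (1 - a_ n.+1 t ^+ 2) * a_ n t).
Proof.
move=> g t0; apply: (is_derive_eq (verb_flow g)); rewrite verb_dPII//.
by field.
Qed.

Lemma verb_raise n t : good n.+1 t -> t != 0 ->
  is_derive t 1 (fun s => a_ n s)
    (n%:R * a_ n t / t + 2 * (1 - a_ n t ^+ 2) * a_ n.+1 t).
Proof.
case: n => [|n] g t0.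
  rewrite (_ : (fun s => _) = fun=> 1); last by apply/funext => s; rewrite verb0.
  by apply: (is_derive_eq (cderC _ _)); rewrite verb0; ring.
apply: (is_derive_eq (verb_flow g)).
rewrite -[n.+1%:R * _]opprK verb_dPII//.
by field.
Qed.

(** Induction through kappa_(n+1) = (1 - a_(n+1)^2) kappa_n: the terms in a_n coming from the two
    factors cancel. *)
Lemma kappa_flow n t : good n.+1 t ->
  is_derive t 1 (fun s => kappa (fc s) n) (- 2 * a_ n t * a_ n.+1 t * kappa (fc t) n).
Proof.
elim: n t => [|n IH] t g.
  have E s : kappa (fc s) 0 = fcoef 0 s.
    rewrite /kappa opuc0 (@pairE _ _ 1) ?size_poly1// big_ord1 coef1 mul1r.
    by rewrite /fc subr0.
  rewrite (_ : (fun s => _) = fcoef 0); last exact/funext.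
  apply: (is_derive_eq (is_derive_fc 0 t)).
  have := @pair_opuc_m1 _ (fc t) (fc_even t) 0 (good_det g (leq0n 1)) (good_det g (leqnn 1)).
  rewrite {1}opuc0 (@pairE _ _ 1) ?size_poly1// big_ord1 coef1 mul1r subr0 => H.
  rewrite verb0.
  have -> : - 2 * 1 * a_ 1 t * kappa (fc t) 0 = (- a_ 1 t * kappa (fc t) 0) *+ 2 by ring.
  by rewrite -H sub0r add0r mulr2n; congr (_ + _); rewrite -fc_even.
have g1 : good n.+1 t by exact: goodW g.
have dphi := cderD (cderC 1 t) (cderM (cderC (-1) t) (cderM (verb_flow g) (verb_flow g))).
apply: cder_near (cderM dphi (IH t g1)) _.
  have := near_good_nbhs g1; apply: filterS => s gs.
  by rewrite (kappaS (fc_even s)) ?(good_det gs)//; ring.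
rewrite (kappaS (fc_even t)) ?(good_det g1)//; ring.
Qed.

(** In the induction, D_(n+1) = kappa_n D_n matches l_(n+1) = l_n + a_(n+1) a_n term by term. *)
Lemma Dn_flow n t : good n t -> is_derive t 1 (@Dn R n) (- 2 * ell (fc t) n * Dn n t).
Proof.
elim: n t => [|n IH] t g.
  rewrite (_ : @Dn R 0 = fun=> 1); last by apply/funext => s; rewrite DnE det_mx00.
  by apply: (is_derive_eq (cderC _ _)); rewrite ell0; ring.
have g1 : good n t by exact: goodW g.
have DS s : good n s -> Dn n.+1 s = kappa (fc s) n * Dn n s.
  by move=> gs; rewrite !DnE det_toepS// -DnE gs.
apply: cder_near (cderM (kappa_flow g) (IH t g1)) _.
  by have := near_good_nbhs g1; apply: filterS => s gs; rewrite DS.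
rewrite (ellS (fc_even t)) ?(good_det g)// DS//; ring.
Qed.

(** With [Dn_flow] this is the Toda equation (t (log D_n)')' = 4 t (1 - a_n^2). Each induction step
    adds the derivative of t a_(n+1) a_n, given by [verb_lower] and [verb_raise]. *)
Lemma ell_flow n t : good n.+1 t -> t != 0 ->
  is_derive t 1 (fun s => s * ell (fc s) n) (- 2 * t * (1 - a_ n t ^+ 2)).
Proof.
elim: n t => [|n IH] t g t0.
  rewrite (_ : (fun s => _) = fun=> 0); last by apply/funext => s; rewrite ell0 mulr0.
  by apply: (is_derive_eq (cderC _ _)); rewrite verb0; ring.
have g1 : good n.+1 t by exact: goodW g.
have daa := cderM (verb_lower g t0) (verb_raise g1 t0).
apply: cder_near (cderD (IH t g1 t0) (cderM (cder_id t) daa)) _.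
  have := near_good_nbhs g1; apply: filterS => s gs.
  by rewrite (ellS (fc_even s)) ?(good_det gs)//; ring.
by field.
Qed.

Lemma UnE n t : Dn n.+1 t != 0 -> Un n.+1 t = - a_ n.+1 t.
Proof.
move=> D; rewrite /Un /bilin toeplitzE.
have -> : fplus n.+1 t = \col_(j < n.+1) fc t j.+1%:Z by [].
rewrite (bigD1 ord_max)//= big1 ?addr0 => [|i iN].
  by rewrite (toep_fplus (fc_even t)) -?DnE// mxE eqxx mulr1.
rewrite [deltaminus _ _ _ _]mxE (_ : _ == _ = false) ?mulr0//.
by apply/eqP => -[E]; move/eqP: iN; apply; exact/val_inj.
Qed.

Lemma PhiE n t : Dn n.+1 t != 0 -> Phi n.+1 t = 1 - a_ n.+1 t ^+ 2.
Proof. by move=> D; rewrite /Phi UnE// sqrrN. Qed.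

Lemma near_dnbhs_near (z0 : C) (P : C -> Prop) :
  (\forall t \near z0^', P t) -> \forall t \near z0^', \near t, P t.
Proof.
move=> /near_dnbhs_cn[d d0 Hd].
apply/near_dnbhs_cn; exists d => // t /andP[td1 td2].
apply/near_nbhs_cn; exists (Num.min (cn (t - z0)) (d - cn (t - z0))).
  by rewrite lt_min td1 subr_gt0.
move=> s; rewrite lt_min => /andP[s1 s2]; apply: Hd; apply/andP; split.
  rewrite lt_def cn_ge0 andbT cn_eq0; apply/eqP => s0.
  have : cn (t - z0) <= cn (s - t).
    have -> : t - z0 = - (s - t) + (s - z0) by ring.
    by rewrite s0 addr0 cnN.
  by rewrite leNgt s1.
have -> : s - z0 = (s - t) + (t - z0) by ring.
by apply: (le_lt_trans (cnD _ _)); rewrite -ltrBrDr.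
Qed.

(** If a_(n+1) vanishes near t, the flow gives a_(n+2) = a_n and discrete Painleve II gives a_(n+2)
    = - a_n, so a_n vanishes as well; the descent stops at a_0 = 1. *)
Lemma verb_not_zero n (z0 : C) : ~ (\forall t \near z0^', a_ n t = 0).
Proof.
elim: n => [|n IH] H.
  by have [t] := filter_ex H; rewrite verb0 => /eqP; rewrite oner_eq0.
apply: IH.
have t0 : \forall t \near z0^', t != 0 :> C.
  by apply: (@exptype_near _ _ _ 1); [exact: exptype_id|exact: oner_neq0].
have gt := near_good n.+2 z0.
have Hn := near_dnbhs_near H.
have : \forall t \near z0^', [/\ t != 0, good n.+2 t & \near t, a_ n.+1 t = 0].
  near=> t; split; [exact: (near t0 t)|exact: (near gt t)|exact: (near Hn t)].
apply: filterS => t [t1 g an].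
have at0 : a_ n.+1 t = 0 by exact: nbhs_singleton an.
have := is_derive_unique an (verb_flow g) (cderC 0 t).
have := verb_dPII g; rewrite at0 expr0n subr0 mulr0 oppr0 !mulr1 mul1r.
move=> /esym/eqP; rewrite mulf_eq0 (negbTE t1) /= => /eqP E1 /eqP; rewrite subr_eq0 => /eqP E2.
move: E1; rewrite E2 -mulr2n => /eqP; rewrite mulrn_eq0 /= => /eqP ->; ring.
Unshelve. all: by end_near. Qed.

(** Needed because the differential equation divides by Phi - 1 = - a^2. *)
Lemma verb_neq0 n (z0 : C) : \forall t \near z0^', a_ n t != 0.
Proof.
have [H0|] := exptype_isolated z0 (exptype_Dopuc n 0); last first.
  move=> /near_dnbhs_cn H.
  apply: filterS2 (near_good n z0) H => t g; apply: contra => /eqP a0.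
  by rewrite -DopucE ?g// [_`_0]a0 mulr0.
exfalso; apply: (@verb_not_zero n z0).
apply: filterS (near_good n z0) => t g.
have := DopucE 0 (g n (leqnn n)); rewrite H0 => /eqP.
by rewrite mulf_eq0 (negbTE (g n (leqnn n))) => /eqP.
Qed.

End Analytic.

(** * Painleve and Toda equations *)

Section Painleve.
Variable R : realType.
Local Notation C := (Cplx R).
Implicit Types (t z : C) (n : nat).
Local Notation a_ n t := (verb (fc t) n).

Lemma meromorphic_Phi n : meromorphic (@Phi R n.+1).
Proof.
move=> z0.
have e1 := exptypeM (exptype_Dn R n.+1) (exptype_Dn R n.+1).
have e2 := exptypeM (exptype_Dopuc R n.+1 0) (exptype_Dopuc R n.+1 0).
exists (fun t => Dn n.+1 t * Dn n.+1 t - Dopuc n.+1 0 t * Dopuc n.+1 0 t).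
exists (fun t => Dn n.+1 t * Dn n.+1 t); split.
  apply: filterE => z; split.
    by have [F _ /(qdiff_is_derive z)[]] := exptype_qdiff (exptypeB e1 e2).
  by have [F _ /(qdiff_is_derive z)[]] := exptype_qdiff e1.
apply: filterS (near_good n.+1 z0) => t g.
have D0 := g n.+1 (leqnn _); split; first by rewrite mulf_neq0.
by rewrite PhiE// -!DopucE// -/(a_ n.+1 t); field.
Qed.

Lemma Phi_is_derive n t : good n.+3 t -> t != 0 ->
  is_derive t 1 (@Phi R n.+1) (2 * a_ n.+1 t * (n.+1%:R * a_ n.+1 t / t +
    2 * (1 - a_ n.+1 t ^+ 2) * a_ n t)).
Proof.
move=> g t0; have g2 : good n.+2 t by apply: goodW g; lia.
have dv := verb_lower g2 t0.
apply: cder_near (cderD (cderC 1 t) (cderM (cderC (-1) t) (cderM dv dv))) _.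
  have := near_good_nbhs g; apply: filterS => s gs.
  by rewrite PhiE; [ring|apply: gs; lia].
by field.
Qed.

(** Phi and Phi' are rational in t, a_n and a_(n+1), and the derivatives of a_n and a_(n+1) are
    again rational in these, so the equation reduces to an identity of rational functions. *)
Lemma painleve_Phi n (z0 : C) : \forall t \near z0^',
  let F : C -> C := @Phi R n.+1 in
  let F' : C -> C := (F^`())%classic in
  let F'' : C -> C := (F^`(2))%classic in
  [/\ toeplitz n.+1 (symbol t) \in unitmx,
      t != 0 /\ F t != 0 /\ F t - 1 != 0,
      derivable F t 1,
      derivable F' t 1 &
      F'' t = 1 / 2 * (1 / (F t - 1) + 1 / F t) * F' t ^+ 2
                 - 1 / t * F' t
                 - 8 * F t * (F t - 1)
                 + 2 * n.+1%:R ^+ 2 / t ^+ 2 * ((F t - 1) / F t)].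
Proof.
have t0 : \forall t \near z0^', t != 0 :> C.
  by apply: (@exptype_near _ _ _ 1); [exact: exptype_id|exact: oner_neq0].
have H : \forall t \near z0^', t != 0 /\ good n.+3 t.
  by apply: filterS2 t0 (near_good n.+3 z0).
(* The formula for F' has to hold around t, and not only at t, since it is differentiated once
   more. *)
have Hn := near_dnbhs_near H; have an := verb_neq0 n.+1 z0.
apply: filterS2 Hn an => t Ht at0.
set F : C -> C := @Phi R n.+1; set F' : C -> C := (F^`())%classic.
set F'' : C -> C := (F^`(2))%classic.
have [tn0 g] := nbhs_singleton Ht.
have g2 : good n.+2 t by apply: goodW g; lia.
have g1 : good n.+1 t by apply: goodW g; lia.
have D0 : Dn n.+1 t != 0 by apply: g; lia.
have FE : F t = 1 - a_ n.+1 t ^+ 2 by exact: PhiE.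
have phi0 : 1 - a_ n.+1 t ^+ 2 != 0.
  by apply: (verb_sqr_neq1 (fc_even t)); apply: (good_det g); lia.
have dF := Phi_is_derive g tn0.
have F'E s : good n.+3 s -> s != 0 -> F' s = 2 * a_ n.+1 s * (n.+1%:R * a_ n.+1 s / s +
    2 * (1 - a_ n.+1 s ^+ 2) * a_ n s).
  by move=> gs s0; rewrite /F' derive1E; have [_ ->] := Phi_is_derive gs s0.
have da := verb_lower g2 tn0; have db := verb_raise g1 tn0.
have dG := cderM (cderM (cderC 2 t) da)
  (cderD (cderM (cderM (cderC n.+1%:R t) da) (cderV tn0 (cder_id t)))
    (cderM (cderM (cderC 2 t) (cderD (cderC 1 t) (cderM (cderC (-1) t) (cderM da da)))) db)).
pose G (s : C) : C := 2 * a_ n.+1 s * (n.+1%:R * a_ n.+1 s / s +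
  2 * (1 + -1 * (a_ n.+1 s * a_ n.+1 s)) * a_ n s).
have GF' : \near t, G t = F' t.
  by apply: filterS Ht => s [s0 gs]; rewrite F'E// /G expr2 mulN1r.
have dF' := near_eq_is_derive (f := G) GF' dG.
split.
- by rewrite unitmxE unitfE.
- by rewrite tn0 FE phi0 addrAC subrr sub0r oppr_eq0 expf_neq0.
- by have [] := dF.
- by have [] := dF'.
have -> : F'' t = 'D_1 F' t by rewrite /F'' derive1Sn derive1n1 derive1E.
have [_ ->] := dF'.
rewrite F'E// FE.
move: (a_ n.+1 t) (a_ n t) at0 phi0 => a b a0 p0.
have -> : 1 - a ^+ 2 - 1 = - a ^+ 2 by ring.
have : n.+1%:R = n%:R + 1 :> C by rewrite natr1.
move: (n.+1%:R : C) (n%:R : C) => N M NE.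
have -> : M = N - 1 by rewrite NE addrK.
by field; rewrite p0 a0 tn0.
Qed.

(** The Toda equation cleared of denominators: an identity of entire functions, hence valid also at
    t = 0 and at the zeros of D_n. *)
Lemma toda_Dn n (D1 D2 : C -> C) : qdiff (@Dn R n.+1) D1 -> qdiff D1 D2 ->
  exptype D1 -> exptype D2 ->
  forall t, Dn n.+1 t * (D1 t + t * D2 t) - t * D1 t ^+ 2 =
    4 * t * (Dn n.+1 t ^+ 2 - Dopuc n.+1 0 t ^+ 2).
Proof.
move=> d1 d2 e1 e2 t; apply/eqP; rewrite -subr_eq0; apply/eqP; move: t.
have eD := exptype_Dn R n.+1; have eN := exptype_Dopuc R n.+1 0.
have ei := @exptype_id R.
have sq (F : C -> C) : exptype F -> exptype (fun t => F t ^+ 2).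
  by move=> eF; apply: exptype_ext (exptypeM eF eF) => t; rewrite expr2.
apply: (@exptype_near0 _ _ 0).
  apply: exptypeB.
    apply: exptypeB; first by apply: exptypeM => //; apply: exptypeD => //; exact: exptypeM.
    by apply: exptypeM => //; exact: sq.
  apply: exptypeM; first by apply: exptypeM => //; exact: exptype_cst.
  by apply: exptypeB; exact: sq.
have t0 : \forall t \near (0 : C)^', t != 0 :> C.
  by apply: (@exptype_near _ _ _ 1); [exact: exptype_id|exact: oner_neq0].
apply: filterS2 t0 (near_good n.+2 0) => t tn0 g.
have g1 : good n.+1 t by apply: goodW g; lia.
have D1E s : good n.+1 s -> D1 s = - 2 * ell (fc s) n.+1 * Dn n.+1 s.
  move=> gs; apply: is_derive_unique (qdiff_is_derive s d1) (Dn_flow gs).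
  exact: filterE.
have dL := cderM (cder_id t) (qdiff_is_derive t d2).
have dR := cderM (cderM (cderC (-2) t) (ell_flow g tn0)) (Dn_flow g1).
have E := is_derive_unique _ dL dR.
have {}E := E _.
have Dn0 : Dn n.+1 t != 0 by apply: g; lia.
rewrite -(DopucE _ Dn0).
have {}E : 1 * D1 t + t * D2 t = (0 * (t * ell (fc t) n.+1) + -2 * (-2 * t * (1 - a_ n.+1 t ^+ 2))) * Dn n.+1 t + -2 * (t * ell (fc t) n.+1) * (-2 * ell (fc t) n.+1 * Dn n.+1 t).
  apply: E; have := near_good_nbhs g1; apply: filterS => s gs.
  by rewrite D1E//; ring.
rewrite mul1r in E; rewrite E D1E// -/(a_ n.+1 t); ring.
Qed.

End Painleve.

(** * The unitary group *)

Section BoundedMore.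
Context d (T : measurableType d) (R : realType).
Local Notation C := (Cplx R).

Lemma bmeas_ext (D : set T) (F G : T -> C) : (forall x, D x -> F x = G x) ->
  bmeas D F -> bmeas D G.
Proof.
move=> FG [F1 F2 [K FK]]; split.
- by apply: eq_measurable_fun F1 => x /set_mem Dx /=; rewrite FG.
- by apply: eq_measurable_fun F2 => x /set_mem Dx /=; rewrite FG.
- by exists K => x Dx; rewrite -FG ?FK.
Qed.

Lemma bmeasV (D : set T) (F : T -> C) : bmeas D F ->
  (exists K : R, forall x, D x -> cn (F x)^-1 <= K) -> bmeas D (fun x => (F x)^-1).
Proof.
move=> [F1 F2 [K FK]] FV.
pose N x := complex.Re (F x) ^+ 2 + complex.Im (F x) ^+ 2.
have mN : measurable_fun D N.
  by apply: measurable_funD; apply: measurable_funX.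
have mNV : measurable_fun D (fun x => (N x)^-1).
  rewrite (_ : (fun x => (N x)^-1) = (fun y : R => y `^ (-1)) \o N).
    by apply: measurableT_comp => //; exact: measurable_powR.
  by apply/funext => x /=; rewrite powR_inv1 ?addr_ge0 ?sqr_ge0.
split => //.
- rewrite (_ : _ \o _ = (@complex.Re R \o F) \* (fun x => (N x)^-1)).
    exact: measurable_funM.
  by apply/funext => x /=; rewrite /N; case: (F x).
- rewrite (_ : _ \o _ = (\- (@complex.Im R \o F)) \* (fun x => (N x)^-1)).
    by apply: measurable_funM => //; exact: measurable_funN.
  by apply/funext => x /=; rewrite /N; case: (F x) => a b /=; rewrite mulNr.
Qed.

End BoundedMore.

Section UnitaryGroup.
Variables (R : realType) (n : nat).
Local Notation C := (Cplx R).
Local Notation M := 'M[C]_n.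
Local Notation D := (@unitary_group R n).
Local Notation "A ^t*" := (map_mx Num.conj (A ^T)).
Implicit Types (U V : M).

Lemma conjCE (z : C) : Num.conj z = conjc z.
Proof. by []. Qed.

Lemma near_mx (U : M) (A : set M) :
  (\forall N \near U, A N) <-> exists2 e : R, 0 < e &
     forall N : M, (forall i j, cn (N i j - U i j) < e) -> A N.
Proof.
split=> [/nbhs_ballP[e /= e0 H]|[e e0 H]].
  have /complex_realP[x xE] : e \is Num.real by exact: gtr0_real.
  exists x => [|N UN]; first by rewrite -ltcR -xE.
  apply: H; split => // i j; rewrite -ball_normE /ball_ /=.
  by rewrite distrC normr_cn xE ltcR.
apply/nbhs_ballP; exists (e%:C : C) => /=; first by rewrite ltcR.
move=> N [_ UN]; apply: H => i j; have := UN i j.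
by rewrite -ball_normE /ball_ /= distrC normr_cn ltcR.
Qed.

Lemma measurable_cont (f : M -> R) :
  (forall (U : M) (e : R), 0 < e -> exists2 r : R, 0 < r & forall N : M,
    (forall i j, cn (N i j - U i j) < r) -> `|f N - f U| < e) ->
  measurable_fun [set: borelM R n] (f : borelM R n -> R).
Proof.
move=> cf; apply: (measurability _ (RGenOInfty.measurableE R)) => //.
move=> /= _ [_ [a ->] <-]; rewrite setTI; apply: sub_sigma_algebra.
rewrite openE => U /=; rewrite in_itv /= andbT => aU.
apply/near_mx; have [|r r0 H] := cf U (f U - a); first by rewrite subr_gt0.
exists r => // N /H; rewrite ltr_norml => /andP[+ _] /=.
by rewrite in_itv /= andbT => UN; lra.
Qed.

Lemma measurable_Re_entry i j :
  measurable_fun [set: borelM R n] (fun U : borelM R n => complex.Re ((U : M) i j)).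
Proof.
apply: measurable_cont => U e e0; exists e => // N UN.
apply: le_lt_trans (UN i j); rewrite -cReN -cReD; exact: Re_le_cn.
Qed.

Lemma measurable_Im_entry i j :
  measurable_fun [set: borelM R n] (fun U : borelM R n => complex.Im ((U : M) i j)).
Proof.
apply: measurable_cont => U e e0; exists e => // N UN.
apply: le_lt_trans (UN i j); rewrite -cImN -cImD; exact: Im_le_cn.
Qed.

(** U(n) is the zero set of a measurable function: the sum of the squares of the real and imaginary
    parts of the entries of [U *m U ^t*] minus the identity. *)
Lemma measurable_unitary : measurable D.
Proof.
pose re i j (U : borelM R n) := complex.Re ((U : M) i j).
pose im i j (U : borelM R n) := complex.Im ((U : M) i j).
pose p i j U := \sum_(k < n) (re i k U * re j k U + im i k U * im j k U) - (i == j)%:R.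
pose q i j U := \sum_(k < n) (im i k U * re j k U + - 1 * (re i k U * im j k U)).
pose N U := \sum_(i < n) \sum_(j < n) (p i j U ^+ 2 + q i j U ^+ 2).
have mN : measurable_fun [set: borelM R n] N.
  apply: measurable_sum => i; apply: measurable_sum => j.
  apply: measurable_funD; apply: measurable_funX.
    apply: measurable_funB => //; apply: measurable_sum => k.
    by apply: measurable_funD; apply: measurable_funM;
      solve [exact: measurable_Re_entry|exact: measurable_Im_entry].
  apply: measurable_sum => k; apply: measurable_funD.
    by apply: measurable_funM; solve [exact: measurable_Re_entry|exact: measurable_Im_entry].
  apply: measurable_funM => //.
  by apply: measurable_funM; solve [exact: measurable_Re_entry|exact: measurable_Im_entry].
have NE (U : M) i j : (U *m U ^t*) i j - (i == j)%:R = p i j U +i* q i j U.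
  have -> : (U *m U ^t*) i j = \sum_(k < n) U i k * conjc (U j k).
    by rewrite mxE; apply: eq_bigr => k _; rewrite !mxE.
  have cRe (F : 'I_n -> C) : complex.Re (\sum_(k < n) F k) = \sum_(k < n) complex.Re (F k).
    by apply: (big_morph _ (@cReD R)).
  have cIm (F : 'I_n -> C) : complex.Im (\sum_(k < n) F k) = \sum_(k < n) complex.Im (F k).
    by apply: (big_morph _ (@cImD R)).
  have -> : (i == j)%:R = ((i == j)%:R : R)%:C :> C by rewrite rmorph_nat.
  apply: cplx_ext; rewrite ?(cReD, cReN, cImD, cImN) /= ?cRe ?cIm.
    congr (_ - _); apply: eq_bigr => k _; rewrite cReM /re /im.
    by case: (U i k) => a b; case: (U j k) => c e /=; rewrite mulrN opprK.
  rewrite oppr0 addr0; apply: eq_bigr => k _; rewrite cImM /re /im.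
  by case: (U i k) => a b; case: (U j k) => c e /=; rewrite mulrN addrC mulN1r.
rewrite (_ : D = N @^-1` [set 0]).
  by rewrite -[X in measurable X]setTI; apply: mN => //; exact: measurable_set1.
apply/seteqP; split=> U /=.
  move=> /unitarymxP UU; rewrite /N big1// => i _; rewrite big1// => j _.
  have := NE U i j; rewrite UU mxE subrr => -[<- <-].
  by rewrite expr0n addr0.
move=> /eqP; rewrite psumr_eq0 => [/allP N0|i _]; last first.
  by apply: sumr_ge0 => j _; rewrite addr_ge0 ?sqr_ge0.
apply/unitarymxP/matrixP => i j; rewrite [RHS]mxE; apply/eqP; rewrite -subr_eq0 NE.
have := N0 i (mem_index_enum _); rewrite /= psumr_eq0 => [/allP/(_ j (mem_index_enum _))|k _]; last first.
  by rewrite addr_ge0 ?sqr_ge0.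
rewrite /= paddr_eq0 ?sqr_ge0// !sqrf_eq0 => /andP[/eqP -> /eqP ->].
by apply/eqP; apply: cplx_ext.
Qed.

Lemma unitary_entry_le U i j : D U -> cn (U i j) <= 1.
Proof.
move=> /unitarymxP /matrixP/(_ i i); rewrite !mxE eqxx => E.
have {}E : \sum_(k < n) cn (U i k) ^+ 2 = 1.
  have : \sum_(k < n) ((cn (U i k) ^+ 2)%:C : C) = 1.
    rewrite -[RHS]E; apply: eq_bigr => k _; rewrite !mxE rmorphXn /= -normr_cn.
    by rewrite normCK.
  by rewrite -rmorph_sum => /(congr1 (@complex.Re R)).
rewrite -(@ler_pXn2r _ 2)// ?nnegrE ?cn_ge0// expr1n -E (bigD1 j)//= lerDl.
by apply: sumr_ge0 => k _; rewrite exprn_ge0 ?cn_ge0.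
Qed.

Lemma bmeas_entry i j : bmeas D (fun U : borelM R n => (U : M) i j).
Proof.
split.
- by apply: measurable_funTS; exact: measurable_Re_entry.
- by apply: measurable_funTS; exact: measurable_Im_entry.
- by exists 1 => U DU; exact: unitary_entry_le.
Qed.

Lemma unitary_mulE V U : V \is unitarymx -> D (V *m U) <-> D U.
Proof.
move=> uV; split; rewrite /unitary_group /=; last exact: mul_unitarymx.
move=> VU.
have u1 : V ^t* \is unitarymx by rewrite trmxC_unitary.
have UE : U = V ^t* *m (V *m U).
  by rewrite mulmxA -(invmx_unitary uV) mulVmx ?mul1mx ?unitarymx_unit.
by rewrite UE; exact: (mul_unitarymx u1 VU).
Qed.

Lemma measurable_mulmx V : V \is unitarymx ->
  measurable_fun [set: borelM R n] (fun U : borelM R n => (V *m (U : M) : borelM R n)).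
Proof.
move=> uV; apply: (@measurability _ _ (borelM R n) (borelM R n) _ _ (@open M)) => //.
move=> _ [A oA <-]; rewrite setTI; apply: sub_sigma_algebra.
rewrite openE => U /= AU; apply/near_mx.
have /near_mx[e e0 H] : \forall N \near V *m U, A N.
  by move: oA; rewrite openE => /(_ _ AU).
exists (e / (n%:R + 1)) => [|N UN]; first by rewrite divr_gt0// ltr_wpDl.
apply: H => i j; rewrite !mxE -sumrB.
apply: (le_lt_trans (cn_sum _ _ _)).
apply: (@le_lt_trans _ _ (\sum_(k < n) (e / (n%:R + 1)))).
  apply: ler_sum => k _; rewrite -mulrBr cnM.
  apply: (le_trans (ler_piMl (cn_ge0 _) (unitary_entry_le i k uV))).
  exact: ltW (UN k j).
rewrite sumr_const card_ord -[_ *+ n]mulr_natl mulrCA -[ltRHS]mulr1 ltr_pM2l//.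
by rewrite ltr_pdivrMr ?ltr_wpDl// mul1r ltrDl.
Qed.

End UnitaryGroup.

(** * Haar expectations and their invariance *)

Section Haar.
Variables (R : realType) (n : nat) (P : probability (borelM R n) R).
Hypothesis hP : is_haar P.
Local Notation C := (Cplx R).
Local Notation M := 'M[C]_n.
Local Notation D := (@unitary_group R n).
Local Notation bm := (bmeas D).
Implicit Types (U V : M) (F G : borelM R n -> C).

Definition Ex F : C := cintegral P D F.

Let mD : measurable D := @measurable_unitary R n.
Let fD : (P D < +oo)%E.
Proof. by rewrite hP.1 ltry. Qed.

Lemma ExB F G : bm F -> bm G -> Ex (fun U => F U - G U) = Ex F - Ex G.
Proof. exact: (@cintegralB _ _ _ P D mD fD). Qed.

Lemma ExZ (c : C) F : bm F -> Ex (fun U => c * F U) = c * Ex F.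
Proof. exact: (@cintegralZ _ _ _ P D mD fD). Qed.

Lemma Ex_cst (c : C) : Ex (fun=> c) = c.
Proof.
have -> : Ex (fun=> c) = c * (fine (P D))%:C by exact: (@cintegral_cst _ _ _ P D mD).
by rewrite hP.1 /= rmorph1 mulr1.
Qed.

Lemma Ex_sum I (r : seq I) (Q : pred I) (F : I -> borelM R n -> C) :
  (forall i, Q i -> bm (F i)) ->
  Ex (fun U => \sum_(i <- r | Q i) F i U) = \sum_(i <- r | Q i) Ex (F i).
Proof. exact: (@cintegral_sum _ _ _ P D mD fD). Qed.

Lemma eq_Ex F G : (forall U, D U -> F U = G U) -> Ex F = Ex G.
Proof. exact: (@eq_cintegral _ _ _ P D F G). Qed.

Lemma cn_Ex_le F (K : R) : bm F -> (forall U, D U -> cn (F U) <= K) ->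
  cn (Ex F) <= 2 * K.
Proof.
move=> bF FK; have e : fine (P D) = 1 by rewrite hP.1.
have H : cn (Ex F) <= 2 * K * fine (P D) := @cn_cintegral_le _ _ _ P D mD fD F K bF FK.
by rewrite e mulr1 in H.
Qed.

Lemma restrict_mulmx V (f : borelM R n -> R) : V \is unitarymx ->
  (fun U : borelM R n => f (V *m (U : M))) \_ D =
  (f \_ D) \o (fun U : borelM R n => V *m (U : M) : borelM R n).
Proof.
move=> uV; apply/funext => U.
have resT (g : borelM R n -> R) (W : borelM R n) : D W -> (g \_ D) W = g W.
  by move=> DW; rewrite /patch mem_set.
have resF (g : borelM R n -> R) (W : borelM R n) : ~ D W -> (g \_ D) W = 0.
  by move=> DW; rewrite /patch memNset.
have [DU|nDU] := pselect (D U).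
  by rewrite (resT _ _ DU) [RHS](resT f (V *m U) ((unitary_mulE U uV).2 DU)).
rewrite (resF _ _ nDU); apply: esym; apply: (resF f (V *m U)) => H.
exact: nDU ((unitary_mulE U uV).1 H).
Qed.

(** Left translation pushes [P] forward to itself, and restriction to U(n) commutes with it
    ([restrict_mulmx]). *)
Lemma Rint_inv V (f : borelM R n -> R) (K : R) : V \is unitarymx ->
  measurable_fun D f -> (forall U, D U -> `|f U| <= K) ->
  Rintegral P D (fun U : borelM R n => f (V *m (U : M))) = Rintegral P D f.
Proof.
move=> uV mf fK; rewrite [LHS]Rintegral_mkcond [RHS]Rintegral_mkcond.
pose phi (U : borelM R n) : borelM R n := V *m (U : M).
have mphi : measurable_fun [set: borelM R n] phi by exact: measurable_mulmx.
transitivity (Rintegral P setT ((f \_ D) \o phi)).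
  exact: (congr1 (Rintegral P setT) (restrict_mulmx f uV)).
have mfD : measurable_fun [set: borelM R n] (f \_ D) := (measurable_restrictT f mD).1 mf.
have fDK U : `|(f \_ D) U| <= `|K|.
  rewrite /patch; case: ifPn => [|_]; last by rewrite normr0.
  by rewrite inE => /fK /le_trans; apply; exact: ler_norm.
rewrite /Rintegral; congr fine.
have mfp := measurableT_comp mfD mphi.
have PT : (P [set: borelM R n] < +oo)%E by rewrite probability_setT ltry.
have bd : [bounded ((f \_ D) \o phi) x | x in [set: borelM R n]].
  by exists `|K|; split; rewrite ?num_real// => x Kx y _; apply: le_trans (ltW Kx); exact: fDK.
have ifphi := measurable_bounded_integrable (mu := P) measurableT PT mfp bd.
have mE : measurable_fun [set: borelM R n] (EFin \o (f \_ D)) by exact/measurable_EFinP.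
have ifphi' : P.-integrable (phi @^-1` setT) ((EFin \o (f \_ D)) \o phi).
  by rewrite preimage_setT; exact: ifphi.
have := integral_pushforward mphi mE ifphi' measurableT.
rewrite preimage_setT => <-.
apply: eq_measure_integral => A mA _; rewrite /pushforward.
exact: (hP.2 V uV A mA).
Qed.

Lemma bmeas_mulmx V F : V \is unitarymx -> bm F -> bm (fun U => F (V *m (U : M))).
Proof.
move=> uV [F1 F2 [K FK]].
have key (f : borelM R n -> R) : measurable_fun D f ->
    measurable_fun D (fun U : borelM R n => f (V *m (U : M))).
  move=> mf; apply/(measurable_restrictT _ mD).
  have mf' : measurable_fun [set: borelM R n] (f \_ D) := (measurable_restrictT f mD).1 mf.
  have := measurableT_comp mf' (measurable_mulmx uV).
  by rewrite -restrict_mulmx.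
split; [exact: key F1|exact: key F2|].
by exists K => U DU; apply: FK; apply/(unitary_mulE _ uV).
Qed.

Lemma Ex_inv V F : V \is unitarymx -> bm F -> Ex (fun U => F (V *m (U : M))) = Ex F.
Proof.
move=> uV [F1 F2 [K FK]]; rewrite /Ex /cintegral; congr (_ +i* _).
  apply: (@Rint_inv V (@complex.Re R \o F) K) => // U DU.
  by apply: le_trans (FK U DU); exact: Re_le_cn.
apply: (@Rint_inv V (@complex.Im R \o F) K) => // U DU.
by apply: le_trans (FK U DU); exact: Im_le_cn.
Qed.

End Haar.

(** * Rank-one determinants and the characteristic polynomial *)

Section RankOne.
Variable K : comNzRingType.

(** Two block eliminations of one and the same bordered matrix. *)
Lemma det_rank1 n (c : 'cV[K]_n) (r : 'rV[K]_n) :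
  \det (1%:M + c *m r) = 1 + (r *m c) 0 0.
Proof.
pose A := block_mx (1%:M : 'M[K]_1) (- r) c 1%:M.
have E1 : block_mx (1%:M : 'M[K]_1) 0 (- c) 1%:M *m A = block_mx 1%:M (- r) 0 (1%:M + c *m r).
  rewrite mulmx_block !mul1mx !mul0mx !mulmx1 !addr0 mulNmx mulmxN opprK.
  by rewrite addNr addrC.
have E2 : block_mx (1%:M : 'M[K]_1) r 0 1%:M *m A = block_mx (1%:M + r *m c) 0 c 1%:M.
  by rewrite mulmx_block !mul1mx !mul0mx !mulmx1 !add0r addNr.
have := congr1 determinant E1; rewrite det_mulmx det_lblock !det1 !mul1r det_ublock det1 mul1r => <-.
have := congr1 determinant E2; rewrite det_mulmx det_ublock !det1 !mul1r det_lblock det1 mulr1 => ->.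
by rewrite [_ + _]mx11_scalar det_scalar1 !mxE.
Qed.

End RankOne.

Section LogDerivative.
Variable K : numClosedFieldType.

Lemma prod_XsubC_derivs (I : Type) (s : seq I) (l : I -> K) (z : K) :
  (forall i, z - l i != 0) ->
  let q := \prod_(i <- s) ('X - (l i)%:P) in
  q^`().[z] = q.[z] * (\sum_(i <- s) (z - l i)^-1) /\
  q^`()^`().[z] = q.[z] * ((\sum_(i <- s) (z - l i)^-1) ^+ 2 - \sum_(i <- s) (z - l i)^-1 ^+ 2).
Proof.
move=> zl; elim: s => [|i s [IH1 IH2]] /=.
  by rewrite !big_nil derivC deriv0 !horner0 mulr0 expr0n subrr mulr0.
rewrite !big_cons; set q := \prod_(i <- s) _ in IH1 IH2 *.
move: IH1 IH2; move: (\sum_(i <- s) _) (\sum_(i <- s) _) => S1 S2 IH1 IH2.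
have E1 (p : {poly K}) : (('X - (l i)%:P) * p)^`() = p + ('X - (l i)%:P) * p^`().
  by rewrite derivM derivXsubC mul1r.
rewrite E1 derivD E1 !hornerD !hornerM !hornerXsubC IH1 IH2.
have := zl i; move: (z - l i) (q.[z]) => y Q y0.
by split; field.
Qed.

Lemma char_poly_normal n (U : 'M[K]_n) : U \is normalmx ->
  exists (W : 'M[K]_n) (l : 'rV[K]_n), [/\ W \in unitmx,
    U = invmx W *m diag_mx l *m W & char_poly U = \prod_(i < n) ('X - (l 0 i)%:P)].
Proof.
move=> /orthomx_spectralP UE.
exists (spectralmx U), (spectral_diag U); split=> //; first exact: spectral_unit.
rewrite {1}UE; move: (spectral_diag U) (spectral_unit U); move: (spectralmx U) => W l uW.
rewrite /char_poly /char_poly_mx !map_mxM.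
have WW : map_mx polyC (invmx W) *m map_mx polyC W = 1%:M :> 'M[{poly K}]_n.
  by rewrite -map_mxM mulVmx// map_mx1.
have -> : 'X%:M - map_mx polyC (invmx W) *m map_mx polyC (diag_mx l) *m map_mx polyC W =
   map_mx polyC (invmx W) *m ('X%:M - map_mx polyC (diag_mx l)) *m map_mx polyC W.
  rewrite mulmxBr mulmxBl; congr (_ - _).
  by rewrite -mulmxA -scalar_mxC mulmxA WW mul1mx.
rewrite !det_mulmx mulrAC -det_mulmx WW det1 mul1r map_diag_mx.
rewrite det_trig; last first.
  apply/is_trig_mxP => i j ij; rewrite !mxE.
  have -> : (i == j) = false by apply/eqP => E; rewrite E ltnn in ij.
  by rewrite !mulr0n subrr.
by apply: eq_bigr => i _; rewrite !mxE eqxx !mulr1n.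
Qed.

(** By the spectral theorem U is diagonalizable with eigenvalues l_i, and the traces of B and B^2
    are the sums of (z - l_i)^-1 and (z - l_i)^-2. *)
Lemma char_poly_resolvent n (U : 'M[K]_n) (z : K) : U \is normalmx -> z%:M - U \in unitmx ->
  let q := char_poly U in let B := invmx (z%:M - U) in
  [/\ q.[z] = \det (z%:M - U), q^`().[z] = q.[z] * \tr B &
   q^`()^`().[z] = q.[z] * (\tr B ^+ 2 - \tr (B *m B))].
Proof.
move=> nU uz q B; have [W [l [uW UE qE]]] := char_poly_normal nU.
have zU : z%:M - U = invmx W *m diag_mx (\row_i (z - l 0 i)) *m W.
  rewrite {1}UE.
  have -> : diag_mx (\row_i (z - l 0 i)) = z%:M - diag_mx l.
    by apply/matrixP => i j; rewrite !mxE; case: eqP => _; rewrite ?mulr1n ?mulr0n ?subrr.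
  rewrite mulmxBr mulmxBl; congr (_ - _).
  by rewrite -mulmxA -scalar_mxC mulmxA mulVmx ?mul1mx.
have dE : \det (z%:M - U) = \prod_(i < n) (z - l 0 i).
  rewrite zU !det_mulmx mulrAC -det_mulmx mulVmx// det1 mul1r det_diag.
  by apply: eq_bigr => i _; rewrite mxE.
have zl i : z - l 0 i != 0.
  by move: uz; rewrite unitmxE unitfE dE => /prodf_neq0; exact.
have BE : B = invmx W *m diag_mx (\row_i (z - l 0 i)^-1) *m W.
  have H : invmx W *m diag_mx (\row_i (z - l 0 i)^-1) *m W *m (z%:M - U) = 1%:M.
    rewrite zU !mulmxA mulmxK// -[invmx W *m _ *m _]mulmxA mulmx_diag.
    have -> : \row_j ((\row_i (z - l 0 i)^-1) 0 j * (\row_i (z - l 0 i)) 0 j) = const_mx 1.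
      by apply/rowP => i; rewrite !mxE mulVf.
    by rewrite diag_const_mx mulmx1 mulVmx.
  by rewrite -[LHS]mul1mx -H mulmxK.
have trB : \tr B = \sum_(i < n) (z - l 0 i)^-1.
  rewrite BE mxtrace_mulC mulmxA mulmxV// mul1mx mxtrace_diag.
  by apply: eq_bigr => i _; rewrite mxE.
have trBB : \tr (B *m B) = \sum_(i < n) (z - l 0 i)^-1 ^+ 2.
  rewrite BE !mulmxA mulmxK// -[invmx W *m _ *m _]mulmxA mulmx_diag.
  rewrite mxtrace_mulC mulmxA mulmxV// mul1mx mxtrace_diag.
  by apply: eq_bigr => i _; rewrite !mxE expr2.
have [H1 H2] := prod_XsubC_derivs (index_enum 'I_n) zl.
rewrite /q qE trB trBB; split=> //.
rewrite dE horner_prod; apply: eq_bigr => i _.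
by rewrite !hornerE.
Qed.

Lemma unitary_projection n (Q : 'M[K]_n) (w : K) : Q *m Q = Q -> map_mx Num.conj Q^T = Q ->
  w * Num.conj w = 1 -> 1%:M + (w - 1) *: Q \is unitarymx.
Proof.
move=> QQ Qt w1; apply/unitarymxP.
have -> : map_mx Num.conj (1%:M + (w - 1) *: Q)^T = 1%:M + (Num.conj w - 1) *: Q.
  apply/matrixP => i j; rewrite -[in RHS]Qt !mxE.
  by rewrite rmorphD rmorph_nat rmorphM rmorphB rmorph1 eq_sym.
rewrite mulmxDl mul1mx mulmxDr mulmx1 -scalemxAl -scalemxAr scalerA QQ.
rewrite -addrA -[(w - 1) *: Q + _]scalerDl -scalerDl.
have -> : Num.conj w - 1 + (w - 1 + (w - 1) * (Num.conj w - 1)) = w * Num.conj w - 1 by ring.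
by rewrite w1 subrr scale0r addr0.
Qed.

End LogDerivative.

(** * First-order expansions along unitary rotations *)

Section Expansion.
Variables (R : realType) (n : nat).
Local Notation C := (Cplx R).
Local Notation M := 'M[C]_n.
Local Notation D := (@unitary_group R n).
Local Notation "A ^t*" := (map_mx Num.conj (A ^T)).
Implicit Types (U V Q : M) (w : C) (F G : M -> C).

(** For an orthogonal projector Q: multiplication by w on its range, identity on the orthogonal
    complement. *)
Definition rot Q w : M := 1%:M + (w - 1) *: Q.

Definition ubdd F := exists2 K : R, 0 <= K & forall U, D U -> cn (F U) <= K.

(* [DG] is the derivative of [G] along [U -> rot Q w *m U] at [w = 1].         *)
Definition sde Q G DG := [/\ ubdd G, ubdd DG & exists2 K : R, 0 <= K &
  forall U w, D U -> cn w = 1 ->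
    cn (G (rot Q w *m U) - G U - (w - 1) * DG U) <= K * cn (w - 1) ^+ 2].

Definition projector Q := Q *m Q = Q /\ Q ^t* = Q.

Lemma cn1_conj w : cn w = 1 -> w * Num.conj w = 1.
Proof. by move=> w1; rewrite -normCK normr_cn w1 expr1n. Qed.

Lemma rot_unitary Q w : projector Q -> cn w = 1 -> rot Q w \is unitarymx.
Proof.
by move=> [QQ Qt] w1; apply: unitary_projection => //; exact: cn1_conj.
Qed.

Lemma rot_stable Q w U : projector Q -> cn w = 1 -> D U -> D (rot Q w *m U).
Proof. by move=> pQ w1 DU; exact: (mul_unitarymx (rot_unitary pQ w1) DU). Qed.

Lemma cn_wB1 w : cn w = 1 -> cn (w - 1) <= 2.
Proof. by move=> w1; apply: (le_trans (cnB _ _)); rewrite w1 cn1. Qed.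

Lemma ubdd_cst c : ubdd (fun=> c).
Proof. by exists (cn c) => //; exact: cn_ge0. Qed.

Lemma ubddD F G : ubdd F -> ubdd G -> ubdd (fun U => F U + G U).
Proof.
move=> [K K0 FK] [L L0 GL]; exists (K + L) => [|U DU]; first exact: addr_ge0.
by apply: (le_trans (cnD _ _)); rewrite lerD ?FK ?GL.
Qed.

Lemma ubddM F G : ubdd F -> ubdd G -> ubdd (fun U => F U * G U).
Proof.
move=> [K K0 FK] [L L0 GL]; exists (K * L) => [|U DU]; first exact: mulr_ge0.
by rewrite cnM ler_pM ?cn_ge0 ?FK ?GL.
Qed.

Lemma ubdd_sum I (r : seq I) (p : pred I) (F : I -> M -> C) :
  (forall i, ubdd (F i)) -> ubdd (fun U => \sum_(i <- r | p i) F i U).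
Proof.
move=> bF; elim: r => [|i r IH].
  by have := ubdd_cst 0; congr ubdd; apply/funext => x; rewrite big_nil.
case pi: (p i).
  by have := ubddD (bF i) IH; congr ubdd; apply/funext => x; rewrite big_cons pi.
by move: IH; congr ubdd; apply/funext => x; rewrite big_cons pi.
Qed.

Lemma sde_ext Q G G' DG DG' : projector Q -> (forall U, D U -> G U = G' U) ->
  (forall U, D U -> DG U = DG' U) -> sde Q G DG -> sde Q G' DG'.
Proof.
move=> pQ GG DGG [[K K0 HK] [L L0 HL] [A A0 HA]]; split.
- by exists K => // U DU; rewrite -GG// HK.
- by exists L => // U DU; rewrite -DGG// HL.
- exists A => // U w DU w1; rewrite -DGG// -(GG U)// -GG; first exact: HA.
  exact: rot_stable.
Qed.

Lemma sde_cst Q c : sde Q (fun=> c) (fun=> 0).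
Proof.
split; [exact: ubdd_cst|exact: ubdd_cst|exists 0 => // U w _ _].
by rewrite subrr mulr0 subrr cn0 mul0r.
Qed.

Lemma sdeD Q F DF G DG : sde Q F DF -> sde Q G DG ->
  sde Q (fun U => F U + G U) (fun U => DF U + DG U).
Proof.
move=> [bF bDF [K K0 HK]] [bG bDG [L L0 HL]]; split; [exact: ubddD|exact: ubddD|].
exists (K + L) => [|U w DU w1]; first exact: addr_ge0.
have -> : F (rot Q w *m U) + G (rot Q w *m U) - (F U + G U) - (w - 1) * (DF U + DG U) =
  (F (rot Q w *m U) - F U - (w - 1) * DF U) + (G (rot Q w *m U) - G U - (w - 1) * DG U).
  by move: (F _) (G _) (F _) (G _) (DF _) (DG _) => a b c d e f; ring.
by apply: (le_trans (cnD _ _)); rewrite [leRHS]mulrDl lerD ?HK ?HL.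
Qed.

Lemma sdeM Q F DF G DG : projector Q -> sde Q F DF -> sde Q G DG ->
  sde Q (fun U => F U * G U) (fun U => DF U * G U + F U * DG U).
Proof.
move=> pQ [bF bDF [K K0 HK]] [bG bDG [L L0 HL]].
split; [exact: ubddM|by apply: ubddD; exact: ubddM|].
have [A A0 FA] := bF; have [A' A'0 FA'] := bDF.
have [B B0 GB] := bG; have [B' B'0 GB'] := bDG.
exists (K * B + A * L + A' * (B' + 2 * L)) => [|U w DU w1].
  by rewrite !(addr_ge0, mulr_ge0).
have DV := rot_stable pQ w1 DU.
have e2 := cn_wB1 w1; have e0 := cn_ge0 (w - 1).
have uK := HK U w DU w1; have vL := HL U w DU w1.
have gB := GB _ DV; have fA := FA _ DU; have fA' := FA' _ DU; have gB' := GB' _ DU.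
move: uK vL gB fA fA' gB' e2 e0.
set F1 := F (rot Q w *m U); set G1 := G (rot Q w *m U).
move: F1 G1 (F U) (G U) (DF U) (DG U) (w - 1) => F1 G1 f g df dg e uK vL gB fA fA' gB' e2 e0.
have -> : F1 * G1 - f * g - e * (df * g + f * dg) =
  (F1 - f - e * df) * G1 + f * (G1 - g - e * dg) + e * df * (e * dg + (G1 - g - e * dg)) by ring.
move: (F1 - f - e * df) (G1 - g - e * dg) uK vL => u v uK vL.
apply: (le_trans (cnD _ _)); rewrite [leRHS]mulrDl lerD//.
  apply: (le_trans (cnD _ _)); rewrite [leRHS]mulrDl lerD// cnM.
    by rewrite mulrAC ler_pM ?cn_ge0.
  by rewrite -mulrA ler_pM ?cn_ge0.
rewrite 2!cnM.
have H : cn (e * dg + v) <= cn e * (B' + 2 * L).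
  apply: (le_trans (cnD _ _)); rewrite [leRHS]mulrDr lerD//.
    by rewrite cnM ler_wpM2l.
  apply: (le_trans vL); rewrite expr2 mulrCA ler_wpM2l//.
  by rewrite mulrC ler_wpM2r.
have -> : A' * (B' + 2 * L) * cn e ^+ 2 = cn e * A' * (cn e * (B' + 2 * L)) by ring.
by rewrite ler_pM ?mulr_ge0 ?cn_ge0// ler_wpM2l.
Qed.

Lemma sde_sum Q I (r : seq I) (F DF : I -> M -> C) : (forall i, sde Q (F i) (DF i)) ->
  sde Q (fun U => \sum_(i <- r) F i U) (fun U => \sum_(i <- r) DF i U).
Proof.
move=> dF; elim: r => [|i r IH].
  have := sde_cst Q 0; congr sde; apply/funext => U; by rewrite big_nil.
have := sdeD (dF i) IH; congr sde; apply/funext => U; by rewrite big_cons.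
Qed.

Lemma sde_cexp Q G DG : projector Q -> sde Q G DG ->
  sde Q (fun U => cexp (G U)) (fun U => cexp (G U) * DG U).
Proof.
move=> pQ [bG bDG [K K0 HK]]; have [B B0 GB] := bG; have [B' B'0 GB'] := bDG.
have bE : ubdd (fun U => cexp (G U)).
  exists (expR B) => [|U DU]; first exact: expR_ge0.
  by apply: (le_trans (cn_cexp_le _)); rewrite ler_expR GB.
split; [exact: bE|exact: ubddM|].
have [L L0 HL] := @cn_cexpB R (2 * B).
exists (expR B * (L * (B' + 2 * K) ^+ 2 + K)) => [|U w DU w1].
  by rewrite mulr_ge0 ?expR_ge0// addr_ge0// mulr_ge0// exprn_ge0// addr_ge0// mulr_ge0.
have DV := rot_stable pQ w1 DU.
have uK := HK U w DU w1; have gB := GB _ DU; have gB1 := GB _ DV; have gB' := GB' _ DU.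
have e2 := cn_wB1 w1; have e0 := cn_ge0 (w - 1).
have eB : cn (cexp (G U)) <= expR B.
  by apply: (le_trans (cn_cexp_le _)); rewrite ler_expR GB.
set d := G (rot Q w *m U) - G U.
have dB : cn d <= 2 * B by apply: (le_trans (cnB _ _)); rewrite mulr_natl mulr2n lerD.
have -> : cexp (G (rot Q w *m U)) = cexp (G U) * cexp d.
  by rewrite -cexpD /d addrC subrK.
have dle : cn d <= cn (w - 1) * (B' + 2 * K).
  have -> : d = (w - 1) * DG U + (d - (w - 1) * DG U) by rewrite addrC subrK.
  apply: (le_trans (cnD _ _)); rewrite [leRHS]mulrDr lerD//.
    by rewrite cnM ler_wpM2l.
  apply: (le_trans uK); rewrite expr2 mulrCA ler_wpM2l//.
  by rewrite mulrC ler_wpM2r.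
have H := HL _ dB; rewrite -/d in uK.
move: eB H uK dle dB; move: (cexp (G U)) (cexp d) (DG U) (w - 1) e2 e0 => E X dg e e2 e0.
move: d => d eB H uK dle dB.
have -> : E * X - E - e * (E * dg) = E * ((X - 1 - d) + (d - e * dg)) by ring.
rewrite cnM -mulrA ler_pM ?cn_ge0//.
apply: (le_trans (cnD _ _)); rewrite [leRHS]mulrDl lerD//.
apply: (le_trans H); rewrite -mulrA ler_wpM2l// -exprMn lerXn2r ?nnegrE ?cn_ge0//.
  by rewrite mulr_ge0 ?addr_ge0 ?mulr_ge0.
by rewrite mulrC.
Qed.

Lemma ubdd_entry i j : ubdd (fun U => U i j).
Proof. by exists 1 => // U; exact: unitary_entry_le. Qed.

Lemma ubdd_mul_entry Q i j : ubdd (fun U => (Q *m U) i j).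
Proof.
have := @ubdd_sum _ (index_enum 'I_n) predT (fun k U => Q i k * U k j).
have -> : (fun U : M => \sum_k Q i k * U k j) = (fun U : M => (Q *m U) i j).
  by apply/funext => U; rewrite mxE.
by apply => k; apply: ubddM; [exact: ubdd_cst|exact: ubdd_entry].
Qed.

Lemma sde_entry Q i j : sde Q (fun U => U i j) (fun U => (Q *m U) i j).
Proof.
split; [exact: ubdd_entry|exact: ubdd_mul_entry|exists 0 => // U w _ _].
rewrite /rot mulmxDl mul1mx -scalemxAl !mxE.
by rewrite [U i j + _]addrC addrK subrr cn0 mul0r.
Qed.

(** For |w| = 1, conj(w) - 1 = - (w - 1) + (w - 1)^2 conj(w), hence the change of sign. *)
Lemma sde_conj Q G DG : sde Q G DG ->
  sde Q (fun U => conjc (G U)) (fun U => - conjc (DG U)).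
Proof.
move=> [[A A0 GA] [B B0 GB] [K K0 HK]]; split.
- by exists A => // U DU; rewrite cn_conj GA.
- by exists B => // U DU; rewrite cnN cn_conj GB.
exists (K + B) => [|U w DU w1]; first exact: addr_ge0.
have uK := HK U w DU w1; have gB := GB _ DU.
have ww := cn1_conj w1.
have -> : conjc (G (rot Q w *m U)) - conjc (G U) - (w - 1) * - conjc (DG U) =
  conjc (G (rot Q w *m U) - G U - (w - 1) * DG U) + ((w - 1) * (w - 1) * conjc w) * conjc (DG U).
  have -> : (w - 1) * (w - 1) * conjc w = (w - 1) * (w * Num.conj w) - (w * Num.conj w - Num.conj w).
    by rewrite conjCE; ring.
  rewrite ww -!conjCE !rmorphB rmorphM rmorphB rmorph1; ring.
apply: (le_trans (cnD _ _)); rewrite [leRHS]mulrDl cn_conj lerD//.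
by rewrite !cnM !cn_conj w1 mulr1 -expr2 mulrC ler_wpM2r ?exprn_ge0 ?cn_ge0.
Qed.

End Expansion.

(** * Resolvents and Schwinger-Dyson equations *)

Section HermitianForm.
Variable K : numClosedFieldType.

(** Polarization: the vectors e_a, e_a + e_b and e_a + i e_b determine every entry of [h]. *)
Lemma rank1_projectors_span n (h : 'M[K]_n) :
  (forall (c : 'cV[K]_n) (r : 'rV[K]_n), (r *m c) 0 0 = 1 ->
     map_mx Num.conj (c *m r)^T = c *m r -> \sum_k \sum_l (c *m r) k l * h k l = 0) ->
  h = 0.
Proof.
move=> H.
have Hv (v : 'cV[K]_n) : (map_mx Num.conj v^T *m v) 0 0 != 0 ->
    \sum_k \sum_l v k 0 * Num.conj (v l 0) * h k l = 0.
  move=> v0; pose N := (map_mx Num.conj v^T *m v) 0 0.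
  have NR : Num.conj N = N.
    rewrite /N mxE rmorph_sum; apply: eq_bigr => k _.
    by rewrite !mxE rmorphM /= conjCK mulrC.
  have := H v (N^-1 *: map_mx Num.conj v^T).
  rewrite -scalemxAl mxE mulVf// => /(_ erefl).
  have -> : map_mx Num.conj (v *m (N^-1 *: map_mx Num.conj v^T))^T = v *m (N^-1 *: map_mx Num.conj v^T).
    have NV : Num.conj N^-1 = N^-1 by rewrite fmorphV; congr (_^-1).
    apply/matrixP => i j; rewrite !mxE !big_ord1 !mxE !rmorphM /= conjCK [X in _ * (X * _)]NV.
    by move: (Num.conj _) (v i _) (N^-1) => x y p; ring.
  move=> /(_ erefl) E; apply: (mulfI (invr_neq0 v0)); rewrite mulr0 -/N -[RHS]E.
  rewrite big_distrr; apply: eq_bigr => k _; rewrite big_distrr; apply: eq_bigr => l _ /=.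
  rewrite mxE big_ord1 !mxE; ring.
have two (a b : 'I_n) (x y : K) : a != b ->
    let v := x *: delta_mx a 0 + y *: delta_mx b 0 : 'cV[K]_n in
    (map_mx Num.conj v^T *m v) 0 0 = x * Num.conj x + y * Num.conj y /\
    \sum_k \sum_l v k 0 * Num.conj (v l 0) * h k l =
      x * Num.conj x * h a a + x * Num.conj y * h a b +
      (y * Num.conj x * h b a + y * Num.conj y * h b b).
  move=> ab v.
  have va : v a 0 = x by rewrite !mxE !eqxx (negbTE ab) mulr1 mulr0 addr0.
  have vb : v b 0 = y by rewrite !mxE !eqxx eq_sym (negbTE ab) mulr1 mulr0 add0r.
  have vo k : k != a -> k != b -> v k 0 = 0.
    by move=> ka kb; rewrite !mxE (negbTE ka) (negbTE kb) !mulr0 addr0.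
  have S2 (F : 'I_n -> K) : (forall k, k != a -> k != b -> F k = 0) -> \sum_k F k = F a + F b.
    move=> F0; rewrite (bigD1 a)//= (bigD1 b) 1?eq_sym//= big1 ?addr0// => k /andP[ka kb].
    exact: F0.
  split.
    have e k : map_mx Num.conj v^T 0 k = Num.conj (v k 0) by rewrite mxE [X in Num.conj X]mxE.
    rewrite mxE S2 => [|k ka kb]; last by rewrite e vo// rmorph0 mul0r.
    by rewrite !e va vb; ring.
  rewrite S2 => [|k ka kb]; last first.
    by rewrite big1// => l _; rewrite vo// mul0r mul0r.
  by rewrite !S2 ?va ?vb// => k ka kb; rewrite (vo _ ka kb) rmorph0 mulr0 mul0r.
have diag a : h a a = 0.
  have va k : (delta_mx a 0 : 'cV[K]_n) k 0 = (k == a)%:R by rewrite mxE eqxx andbT.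
  have N1 : (map_mx Num.conj (delta_mx a 0 : 'cV[K]_n)^T *m (delta_mx a 0 : 'cV[K]_n)) 0 0 = 1.
    rewrite mxE (bigD1 a)//= big1 ?addr0 => [|k ka].
      by rewrite !mxE !eqxx /= rmorph1 mulr1.
    by rewrite !mxE (negbTE ka) /= mulr0.
  have := Hv (delta_mx a 0); rewrite N1 oner_eq0 => /(_ isT).
  rewrite (bigD1 a)//= [X in _ + X]big1 ?addr0 => [|k ka]; last first.
    by rewrite big1// => l _; rewrite va (negbTE ka) !mul0r.
  rewrite (bigD1 a)//= [X in _ + X]big1 ?addr0 => [|k ka]; last first.
    by rewrite !va (negbTE ka) rmorph0 mulr0 mul0r.
  by rewrite va eqxx /= conjC1 !mul1r.
apply/matrixP => a b; rewrite mxE; have [<-//|ab] := eqVneq a b.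
have [N1 E1] := two a b 1 1 ab; have [N2 E2] := two a b 1 ('i)%R ab.
have := Hv (1 *: delta_mx a 0 + 1 *: delta_mx b 0).
rewrite N1 E1 !conjC1 !mul1r !diag add0r addr0 => H1.
have := Hv (1 *: delta_mx a 0 + ('i)%R *: delta_mx b 0).
rewrite N2 E2 !conjC1 conjCi !mul1r mulrN -expr2 sqrCi opprK !diag mulr1 mulr0 add0r addr0.
have n2 : 1 + 1 != 0 :> K by rewrite -[1 + 1]/(2%:R) pnatr_eq0.
have {H1} := H1 n2; move=> H1 /(_ n2) H2.
have i0 := neq0Ci K.
have {}H2 : h b a = h a b.
  by apply: (mulfI i0); apply/eqP; rewrite -subr_eq0 -H2; apply/eqP; ring.
move: H1; rewrite H2 -mulr2n => /eqP; rewrite mulrn_eq0 /= => /eqP //.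
Qed.

End HermitianForm.

(** Inserting the hypothesis into its own right-hand side replaces B by A at first order and leaves
    a remainder carrying e^2. *)
Lemma second_difference (K : comNzRingType) n (A B Q : 'M[K]_n) (e : K) i j :
  B = A + e *: ((1%:M - B) *m Q *m A) ->
  B i j - A i j - e * ((1%:M - A) *m Q *m A) i j =
    (e * e) * - ((1%:M - B) *m Q *m A *m Q *m A) i j.
Proof.
move=> E.
have H (X Y Z : 'M[K]_n) : X = Y + Z -> 1%:M - Y = 1%:M - X + Z.
  by move=> ->; rewrite opprD addrA subrK.
rewrite (H _ _ _ E).
move: E; set X := (1%:M - B) *m Q *m A => E.
rewrite mulmxDl mulmxDl -/X -!scalemxAl {1}E.
rewrite [(A + _) i j]mxE [(e *: X) i j]mxE [(X + _) i j]mxE [(e *: (_ *m _)) i j]mxE.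
by move: ((X *m Q *m A) i j) (X i j) (A i j) => x y a; ring.
Qed.

(** * The resolvent of a unitary matrix *)

Section Resolvent.
Variables (R : realType) (n : nat).
Local Notation C := (Cplx R).
Local Notation M := 'M[C]_n.
Local Notation D := (@unitary_group R n).
Local Notation "A ^t*" := (map_mx Num.conj (A ^T)).
Implicit Types (U V Q : M) (w : C) (F G : M -> C).

Definition mle (K : R) (A : M) := forall i j, cn (A i j) <= K.

Lemma mle_mul (K L : R) (A B : M) : mle K A -> mle L B -> 0 <= K -> 0 <= L ->
  mle (n%:R * (K * L)) (A *m B).
Proof.
move=> AK BL K0 L0 i j; rewrite mxE; apply: (le_trans (cn_sum _ _ _)).
apply: (@le_trans _ _ (\sum_(k < n) (K * L))).
  by apply: ler_sum => k _; rewrite cnM ler_pM ?cn_ge0.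
by rewrite sumr_const card_ord -[_ *+ n]mulr_natl.
Qed.

Lemma mleD (K L : R) (A B : M) : mle K A -> mle L B -> mle (K + L) (A + B).
Proof. by move=> AK BL i j; rewrite mxE; apply: (le_trans (cnD _ _)); rewrite lerD. Qed.

Lemma mleN (K : R) (A : M) : mle K A -> mle K (- A).
Proof. by move=> AK i j; rewrite mxE cnN. Qed.

Lemma mle_exists (A : M) : exists2 K : R, 0 <= K & mle K A.
Proof.
exists (\sum_i \sum_j cn (A i j)).
  by apply: sumr_ge0 => i _; apply: sumr_ge0 => j _; exact: cn_ge0.
move=> i j; rewrite (bigD1 i)//= (bigD1 j)//= -addrA lerDl addr_ge0//.
  by apply: sumr_ge0 => k _; exact: cn_ge0.
by apply: sumr_ge0 => k _; apply: sumr_ge0 => l _; exact: cn_ge0.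
Qed.

(** The bound required of |z| below is far from sharp: it gives resolvent entries of modulus at most
    1 by an elementary estimate, and leaves enough points z to determine a polynomial. *)
Variable z : C.
Hypothesis zn : n%:R + 1 <= cn z.

(* If [z x_j = e_j + sum_k x_k U_kj] then the largest [|x_j|] is at most the   *)
(* largest [|e_j|], as [|z| >= n + 1].                                         *)
Lemma resolvent_row (x e : 'I_n -> C) U (c : R) : D U -> 0 <= c ->
  (forall j, cn (e j) <= c) ->
  (forall j, z * x j = e j + \sum_k x k * U k j) -> forall j, cn (x j) <= c.
Proof.
move=> DU c0 ec xE j.
pose j0 := [arg max_(i > j) cn (x i)]%O.
have jmax i : cn (x i) <= cn (x j0).
  by rewrite /j0; case: arg_maxP => // k _ kmax; exact: kmax.
apply: (le_trans (jmax j)); set m := cn (x j0).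
have H : cn z * m <= c + n%:R * m.
  rewrite -cnM xE; apply: (le_trans (cnD _ _)); rewrite lerD//.
  apply: (le_trans (cn_sum _ _ _)); apply: (@le_trans _ _ (\sum_(k < n) m)).
    apply: ler_sum => k _; rewrite cnM -[leRHS]mulr1 ler_pM ?cn_ge0//.
    exact: unitary_entry_le.
  by rewrite sumr_const card_ord -[_ *+ n]mulr_natl.
have m0 : 0 <= m by exact: cn_ge0.
have : (n%:R + 1) * m <= cn z * m by rewrite ler_wpM2r.
by move: H; lra.
Qed.

Lemma resolvent_unit U : D U -> z%:M - U \in unitmx.
Proof.
move=> DU; rewrite unitmxE unitfE; apply/negP => /det0P[v v0 vE].
move/eqP: v0; apply; apply/rowP => j; rewrite mxE; apply/eqP.
rewrite -cn_eq0; apply/eqP/le_anti; rewrite cn_ge0 andbT.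
apply: (@resolvent_row (fun j => v 0 j) (fun=> 0) U 0) => // [k|k]; first by rewrite cn0.
rewrite add0r.
have := congr1 (fun A : 'rV_n => A 0 k) vE; rewrite mulmxBr mul_mx_scalar !mxE => /eqP.
by rewrite subr_eq0 => /eqP.
Qed.

Definition res U : M := invmx (z%:M - U).
(** On U(n) this is - U (z - U)^-1, by [mul_res]; it governs the logarithmic derivative of det(z -
    U) under rotations of U ([zdet_rot]). *)
Definition Rz U : M := 1%:M - z *: res U.

Lemma res_entry_le U : D U -> mle 1 (res U).
Proof.
move=> DU i; apply: (@resolvent_row _ (fun j => (i == j)%:R) U 1) => // [j|j].
  by rewrite cn_nat; case: eqP.
have := congr1 (fun A : M => A i j) (mulVmx (resolvent_unit DU)).
rewrite mulmxBr mul_mx_scalar !mxE => /eqP; rewrite subr_eq => /eqP ->.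
by [].
Qed.

Lemma Rz_entry_le U : D U -> mle (1 + cn z) (Rz U).
Proof.
move=> DU i j; rewrite !mxE; apply: (le_trans (cnB _ _)); rewrite lerD//.
  by rewrite cn_nat; case: eqP.
by rewrite cnM ler_piMr ?cn_ge0// res_entry_le.
Qed.

Lemma mul_res U : D U -> U *m res U = - Rz U.
Proof.
move=> DU; rewrite /Rz opprB.
have := mulmxV (resolvent_unit DU); rewrite mulmxBl [z%:M *m _]mul_scalar_mx -/(res U) => <-.
by rewrite opprB addrC subrK.
Qed.

(** The resolvent identity, kept exact by leaving the rotated matrix on both sides;
    [second_difference] iterates it. *)
Lemma Rz_rot Q w U : projector Q -> cn w = 1 -> D U ->
  Rz (rot Q w *m U) = Rz U + (w - 1) *: ((1%:M - Rz (rot Q w *m U)) *m Q *m Rz U).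
Proof.
move=> pQ w1 DU; have DV := rot_stable pQ w1 DU.
set V := rot Q w *m U in DV *.
have uU := resolvent_unit DU; have uV := resolvent_unit DV.
have VE : V - U = (w - 1) *: (Q *m U).
  by rewrite /V /rot mulmxDl mul1mx -scalemxAl addrC addKr.
have BB : res V - res U = - ((w - 1) *: (res V *m Q *m Rz U)).
  have -> : res V - res U = res V *m (V - U) *m res U.
    have -> : V - U = (z%:M - U) - (z%:M - V) by rewrite opprB [RHS]addrC addrA subrK.
    by rewrite mulmxBr (mulVmx uV) mulmxBl mul1mx (mulmxK uU).
  by rewrite VE -scalemxAr -scalemxAl -!mulmxA mul_res// !mulmxN scalerN.
have -> : 1%:M - Rz V = z *: res V by rewrite /Rz opprB addrC subrK.
rewrite [RHS]addrC; apply/eqP; rewrite -subr_eq; apply/eqP.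
rewrite [LHS](_ : _ = - (z *: (res V - res U))); last first.
  rewrite /Rz; move: (z *: res V) (z *: res U) (scalerBr z (res V) (res U)) => a b ->.
  by rewrite !opprB [LHS]addrC addrA subrK.
by rewrite BB scalerN opprK !scalerA mulrC -!scalemxAl scalerA.
Qed.

Lemma sde_Rz Q i j : projector Q -> sde Q (fun U => Rz U i j)
  (fun U => ((1%:M - Rz U) *m Q *m Rz U) i j).
Proof.
move=> pQ; have [q q0 Qq] := mle_exists Q.
pose r := 1 + cn z; have r0 : 0 <= r by rewrite addr_ge0// cn_ge0.
have R1 U : D U -> mle (1 + r) (1%:M - Rz U).
  move=> DU; apply: mleD; last exact/mleN/Rz_entry_le.
  by move=> k l; rewrite mxE cn_nat; case: eqP.
have r1 : 0 <= 1 + r by rewrite addr_ge0.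
have nn (x : R) : 0 <= x -> 0 <= n%:R * x by move=> ?; rewrite mulr_ge0.
have bRQR U V : D U -> D V -> mle (n%:R * (n%:R * ((1 + r) * q) * r)) ((1%:M - Rz V) *m Q *m Rz U).
  move=> DU DV; apply: mle_mul => //; first by apply: mle_mul => //; exact: R1.
    exact: Rz_entry_le.
  by rewrite nn// mulr_ge0.
set b := n%:R * _ in bRQR.
have b0 : 0 <= b by rewrite nn// mulr_ge0// nn// mulr_ge0.
split.
- by exists r => // U DU; exact: Rz_entry_le.
- by exists b => // U DU; exact: bRQR.
exists (n%:R * (n%:R * (b * q) * r)) => [|U w DU w1].
  by rewrite nn// mulr_ge0// nn// mulr_ge0.
have DV := rot_stable pQ w1 DU.
have E := Rz_rot pQ w1 DU; set V := rot Q w *m U in DV E *.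
pose X := (1%:M - Rz V) *m Q *m Rz U.
rewrite (second_difference i j E) -/X.
rewrite cnM cnN cnM -expr2 mulrC ler_wpM2r ?exprn_ge0 ?cn_ge0//.
apply: mle_mul; [|exact: Rz_entry_le|by rewrite nn// mulr_ge0|by []].
by apply: mle_mul => //; exact: bRQR.
Qed.

Definition zdet U : C := \det (z%:M - U).

(** The rotated z - U is (z - U) times a rank-one perturbation of the identity, so the determinant
    is exactly affine in w. *)
Lemma zdet_rot (c : 'cV[C]_n) (r : 'rV[C]_n) w U : projector (c *m r) -> cn w = 1 -> D U ->
  zdet (rot (c *m r) w *m U) = zdet U * (1 + (w - 1) * \tr ((c *m r) *m Rz U)).
Proof.
move=> pQ w1 DU; have uU := resolvent_unit DU.
have -> : zdet (rot (c *m r) w *m U) = \det ((z%:M - U) *m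
   (1%:M + (- (w - 1) *: (res U *m c)) *m (r *m U))).
  rewrite /zdet; congr (\det _); rewrite mulmxDr mulmx1 -scalemxAl -scalemxAr.
  rewrite !mulmxA mulmxV// mul1mx scaleNr /rot mulmxDl mul1mx -scalemxAl.
  by rewrite opprD addrA.
rewrite det_mulmx det_rank1; congr (_ * (1 + _)).
rewrite -scalemxAr mxE mulNr -mulrN; congr (_ * _).
have -> : r *m U *m (res U *m c) = - (r *m Rz U *m c).
  by rewrite mulmxA -[r *m U *m _]mulmxA mul_res// mulmxN mulNmx.
rewrite mxE opprK [RHS]mxtrace_mulC mulmxA mxtrace_mulC mulmxA.
by rewrite /mxtrace big_ord1.
Qed.

Lemma det_bdd : exists K : R, forall A : M, mle 1 A -> cn (\det A) <= K.
Proof.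
exists (\sum_(s : {perm 'I_n}) 1) => A A1; apply: (le_trans (cn_sum _ _ _)).
apply: ler_sum => s _; rewrite cnM cnX cnN cn1 expr1n mul1r cn_prod.
by apply: prodr_ile1 => i _; rewrite cn_ge0 A1.
Qed.

Lemma sde_zdet (c : 'cV[C]_n) (r : 'rV[C]_n) : projector (c *m r) ->
  sde (c *m r) zdet (fun U => zdet U * \tr ((c *m r) *m Rz U)).
Proof.
move=> pQ.
have bdet : ubdd zdet.
  suff H (s : {perm 'I_n}) : ubdd (fun U : M => (-1) ^+ s * \prod_i (z%:M - U) i (s i)).
    exact: (ubdd_sum (index_enum _) predT H).
  apply: ubddM; first exact: ubdd_cst.
  exists ((cn z + 1) ^+ n) => [|U DU]; first by rewrite exprn_ge0// addr_ge0 ?cn_ge0.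
  rewrite cn_prod (_ : _ ^+ n = \prod_(i < n) (cn z + 1)); last by rewrite prodr_const card_ord.
  apply: ler_prod => i _; rewrite cn_ge0 !mxE /=; apply: (le_trans (cnB _ _)).
  rewrite lerD ?unitary_entry_le//; case: eqP => _; rewrite ?mulr1n// mulr0n cn0.
  exact: cn_ge0.
split; [exact: bdet| |exists 0 => // U w DU w1].
  apply: ubddM => //.
  suff H i : ubdd (fun U => ((c *m r) *m Rz U) i i) by exact: (ubdd_sum (index_enum _) predT H).
  have [q q0 Qq] := mle_exists (c *m r).
  exists (n%:R * (q * (1 + cn z))) => [|U DU].
    by rewrite mulr_ge0// mulr_ge0// addr_ge0// cn_ge0.
  by apply: mle_mul => //; [exact: Rz_entry_le|rewrite addr_ge0// cn_ge0].
rewrite zdet_rot//; move: (zdet U) (\tr _) => a b.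
by rewrite (_ : _ - _ = 0) ?cn0 ?mul0r//; ring.
Qed.

Local Notation bm := (bmeas D).

Lemma bmeas_det m (F : borelM R n -> 'M[C]_m) : (forall i j, bm (fun U => F U i j)) ->
  bm (fun U => \det (F U)).
Proof.
move=> bF; apply: (@bmeas_sum _ _ R D _ (index_enum _) predT) => s _.
have bp := @bmeas_prod _ _ R D _ (index_enum _) predT _ (fun i _ => bF i (s i)).
exact: bmeasM (bmeas_cst D ((-1) ^+ s)) bp.
Qed.

Lemma bmeas_zB i j : bm (fun U : borelM R n => (z%:M - (U : M)) i j).
Proof.
have := bmeasB (bmeas_cst D (z%:M i j : C)) (@bmeas_entry R n i j).
by apply: bmeas_ext => U _; rewrite !mxE.
Qed.

Lemma bmeas_zdet : bm zdet.
Proof. by apply: bmeas_det => i j; exact: bmeas_zB. Qed.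

(** Cramer's rule; 1 / det(z - U) is the determinant of the resolvent, whose entries have modulus at
    most 1, so it is bounded. *)
Lemma bmeas_res i j : bm (fun U : borelM R n => res U i j).
Proof.
have bV : bm (fun U => (zdet U)^-1).
  apply: bmeasV; first exact: bmeas_zdet.
  have [K HK] := det_bdd; exists K => U DU; rewrite /zdet -det_inv; apply: HK.
  exact: res_entry_le.
have bc : bm (fun U : borelM R n => \det (row' j (col' i (z%:M - (U : M))))).
  apply: bmeas_det => k l; have := bmeas_zB (lift j k) (lift i l).
  by apply: bmeas_ext => U _; rewrite [RHS]mxE [RHS]mxE.
have := bmeasM bV (bmeasM (bmeas_cst D ((-1) ^+ (j + i))) bc).
apply: bmeas_ext => U DU.
by rewrite /res /invmx (resolvent_unit DU) [RHS]mxE [X in _ = _ * X]mxE.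
Qed.

Lemma bmeas_Rz i j : bm (fun U : borelM R n => Rz U i j).
Proof.
have := bmeasB (bmeas_cst D (1%:M i j : C)) (bmeasM (bmeas_cst D z) (bmeas_res i j)).
by apply: bmeas_ext => U _; rewrite !mxE.
Qed.

End Resolvent.

(** * Schwinger-Dyson equations from Haar invariance *)

Section SchwingerDyson.
Variables (R : realType) (n : nat) (P : probability (borelM R n) R).
Hypothesis hP : is_haar P.
Local Notation C := (Cplx R).
Local Notation M := 'M[C]_n.
Local Notation D := (@unitary_group R n).
Local Notation bm := (bmeas D).

Lemma unit_near1 (e : R) : 0 < e -> exists2 w : C, cn w = 1 & 0 < cn (w - 1) <= 2 * e.
Proof.
(* The quotient u / conj(u) has modulus 1 and differs from 1 by 2 i e / conj(u). *)
move=> e0; pose u : C := 1 +i* e; pose v : C := conjc u.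
have uv : cn u = cn v := esym (cn_conj u).
have v1 : 1 <= cn v.
  rewrite -uv; apply: le_trans (Re_le_cn u); exact: ler_norm.
have v0 : v != 0 by rewrite -cn_eq0 gt_eqF// (lt_le_trans _ v1).
exists (u / v); first by rewrite cnM cnV uv divff// gt_eqF// (lt_le_trans _ v1).
have -> : u / v - 1 = (2 * 'i * e%:C) / v.
  rewrite -[X in _ - X](divff v0) -mulrBl; congr (_ / _).
  by apply: cplx_ext; rewrite ?(cReD, cReN, cImD, cImN, cReM, cImM) /=; ring.
have n2e : cn (2 * 'i * e%:C : C) = 2 * e.
  rewrite cnM cnM (_ : cn ('i : C) = 1) ?mulr1; last by rewrite /cn /= expr0n add0r expr1n sqrtr1.
  by rewrite cn_nat cn_real gtr0_norm.
rewrite cnM cnV n2e; have v1' := lt_le_trans ltr01 v1.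
by rewrite divr_gt0 ?mulr_gt0//= ler_pdivrMr// ler_peMr// mulr_ge0// ltW.
Qed.

(* Left translation by [rot Q w] preserves [Ex], and [w -> 1].                 *)
Lemma schwinger_dyson (G : M -> C) (H : 'I_n -> 'I_n -> M -> C) :
  bm G -> (forall k l, bm (H k l)) ->
  (forall (c : 'cV_n) (r : 'rV_n), projector (c *m r) ->
     sde (c *m r) G (fun U => \sum_k \sum_l (c *m r) k l * H k l U)) ->
  forall k l, Ex P (H k l) = 0.
Proof.
move=> bG bH GH k l.
suff /matrixP/(_ k l) : \matrix_(k, l) Ex P (H k l) = 0 by rewrite !mxE.
apply: rank1_projectors_span => c r rc crt; set Q := c *m r.
have pQ : projector Q.
  split=> //; rewrite /Q mulmxA -[c *m r *m c]mulmxA [r *m c]mx11_scalar rc.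
  by rewrite mulmx1.
have [_ _ [K K0 HK]] := GH _ _ pQ; rewrite -/Q in HK.
set DG := fun U : borelM R n => \sum_k \sum_l Q k l * H k l U in HK.
have bQH i j : bm (fun U => Q i j * H i j U) by apply: bmeasM => //; exact: bmeas_cst.
have bDG : bm DG by apply: bmeas_sum => i _; apply: bmeas_sum => j _.
have -> : \sum_i \sum_j Q i j * (\matrix_(k, l) Ex P (H k l)) i j = Ex P DG.
  rewrite (Ex_sum hP) => [|i _]; last by apply: bmeas_sum => j _.
  apply: eq_bigr => i _; rewrite (Ex_sum hP)//.
  by apply: eq_bigr => j _; rewrite (ExZ hP)// mxE.
apply/eqP; rewrite -cn_eq0; apply/eqP/le_anti; rewrite cn_ge0 andbT.
apply/ler_addgt0Pr => e e0; rewrite add0r.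
have e'0 : 0 < e / (4 * K + 1) by rewrite divr_gt0// ltr_wpDl// mulr_ge0.
have [w w1 /andP[w0 we]] := unit_near1 e'0.
have uw := rot_unitary pQ w1.
have bV := bmeas_mulmx uw bG.
have HE : cn ((w - 1) * Ex P DG) <= 2 * (K * cn (w - 1) ^+ 2).
  have -> : (w - 1) * Ex P DG = - Ex P (fun U : borelM R n => G (rot Q w *m (U : M)) - G U - (w - 1) * DG U).
    rewrite (ExB hP) ?(ExB hP) ?(ExZ hP)//; first by rewrite (Ex_inv hP uw bG) subrr sub0r opprK.
      exact: bmeasB.
    by apply: bmeasM => //; exact: bmeas_cst.
  rewrite cnN; apply: (cn_Ex_le hP).
    by apply: bmeasB; [exact: bmeasB|apply: bmeasM => //; exact: bmeas_cst].
  by move=> U DU; exact: HK.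
have : cn (Ex P DG) <= 2 * K * cn (w - 1).
  by rewrite -(ler_pM2l w0) -cnM; apply: (le_trans HE); rewrite expr2 le_eqVlt; apply/orP; left; apply/eqP; ring.
move=> /le_trans; apply; apply: (le_trans (ler_wpM2l _ we)); first by rewrite mulr_ge0.
rewrite mulrA (_ : 2 * K * 2 = 4 * K); last by ring.
by rewrite mulrCA ler_piMr ?(ltW e0)// ler_pdivrMr ?ltr_wpDl ?mulr_ge0// mul1r lerDl.
Qed.

End SchwingerDyson.

(** * The linear system *)

Section LinearSystem.

(** The right-hand side of [opuc_system] involves only neighbouring coefficients i - 1, i and i +
    1. *)
Lemma coef_system (K : comNzRingType) (P : {poly K}) (N t : K) (i : nat) :
  ((N *: P - 'X * P^`()) - 2 *: (N *: P + (N - 2) *: ('X * P^`()) - 'X ^+ 2 * P^`()^`())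
   - (2 * t) *: ('X * (N *: P - 'X * P^`())) - (2 * t) *: P^`())`_i =
  - ((N - i%:R) * (2 * i%:R + 1)) * P`_i
  - 2 * t * (N - i%:R + 1) * (if i is j.+1 then P`_j else 0)
  - 2 * t * (i%:R + 1) * P`_i.+1.
Proof.
have X1 (Q : {poly K}) j : ('X * Q^`())`_j = j%:R * Q`_j.
  by rewrite coefXM coef_deriv; case: j => [|j] /=; rewrite ?mul0r// mulr_natl.
have X2 : ('X ^+ 2 * P^`()^`())`_i = i%:R * (i%:R - 1) * P`_i.
  rewrite expr2 -mulrA coefXM; case: i => [|i] /=; first by rewrite !mul0r.
  by rewrite X1 coef_deriv -mulr_natl -natr1; ring.
have X3 : ('X * (N *: P - 'X * P^`()))`_i =
    (N - i%:R + 1) * (if i is j.+1 then P`_j else 0).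
  rewrite coefXM; case: i {X2} => [|i] /=; first by rewrite mulr0.
  by rewrite coefB coefZ X1 -natr1; ring.
rewrite !coefB !coefZ X3 coefB coefD !coefZ X2 !X1 coef_deriv -mulr_natl -natr1.
move: (if i is _.+1 then _ else _) => y; ring.
Qed.

Variable R : realType.
Local Notation C := (Cplx R).

Lemma qdiff_mul_id (F F' : C -> C) : qdiff F F' -> ballbdd F -> ballbdd F' ->
  qdiff (fun t => t * F t) (fun t => F t + t * F' t).
Proof.
move=> dF bF bF'; have := qdiffM (@qdiff_id R) dF (@ballbdd_id R) (ballbdd_cst 1) bF bF'.
by apply: qdiff_ext => // t; rewrite mul1r.
Qed.

Lemma qdiffZ (c : C) (F F' : C -> C) : qdiff F F' -> ballbdd F -> ballbdd F' ->
  qdiff (fun t => c * F t) (fun t => c * F' t).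
Proof.
move=> dF bF bF'; have := qdiffM (qdiff_cst c) dF (ballbdd_cst c) (ballbdd_cst 0) bF bF'.
by apply: qdiff_ext => // t; rewrite mul0r add0r.
Qed.

(* The system has a regular singular point at 0, whose indicial equation       *)
(* determines all Taylor coefficients at 0 from [F n 0].                       *)
Lemma linear_system_unique n (F F' : nat -> C -> C) :
  (forall i, exptype (F i)) -> (forall i, qdiff (F i) (F' i)) ->
  (forall i t, (i <= n)%N -> t * F' i t =
     - ((n%:R - i%:R) * (2 * i%:R + 1)) * F i t
     - 2 * t * (n%:R - i%:R + 1) * (if i is j.+1 then F j t else 0)
     - 2 * t * (i%:R + 1) * F i.+1 t) ->
  (forall t, F n.+1 t = 0) -> F n 0 = 0 -> forall i t, (i <= n)%N -> F i t = 0.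
Proof.
move=> eF dF FE Fn1 Fn0.
have /boolp.choice[G GP] : forall i, exists G : nat -> C -> C, G 0%N = F i /\ expder G.
  by move=> i; have [g g0 dg] := eF i; exists g.
have G0 i : G i 0%N = F i by have [] := GP i.
have dG i : expder (G i) by have [] := GP i.
have G1 i t : G i 1%N t = F' i t.
  by have := (dG i).1 0%N; rewrite G0 => H; exact: (qdiff_unique H (dF i)).
have bG i m : ballbdd (G i m) by exact: ballbdd_expder.
pose c i : C := (n%:R - i%:R) * (2 * i%:R + 1).
pose a i : C := 2 * (n%:R - i%:R + 1).
pose b i : C := 2 * (i%:R + 1).
pose L i m t : C := if i is j.+1 then G j m t else 0.
have dL i m : qdiff (L i m) (L i m.+1).
  by case: i => [|i]; [exact: qdiff_cst|exact: (dG i).1].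
have bL i m : ballbdd (L i m).
  by case: i => [|i]; [exact: ballbdd_cst|exact: bG].
(* The system differentiated m times. *)
have GE m i t : (i <= n)%N -> t * G i m.+1 t + m%:R * G i m t =
    (- c i * G i m t + - a i * (t * L i m t + m%:R * L i m.-1 t)) +
    - b i * (t * G i.+1 m t + m%:R * G i.+1 m.-1 t).
  elim: m i t => [|m IH] i t iN.
    rewrite !mul0r !addr0 G1 FE// !G0 /L /c /a /b.
    by case: i {iN} => [|i]; rewrite ?G0; ring.
  have dm (H : nat -> C -> C) : (forall k, qdiff (H k) (H k.+1)) -> (forall k, ballbdd (H k)) ->
      qdiff (fun t => t * H m t + m%:R * H m.-1 t) (fun t => (H m t + t * H m.+1 t) + m%:R * H m t).
    move=> dH bH; apply: qdiffD; first exact: qdiff_mul_id.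
    case: (m) => [|k]; last exact: qdiffZ.
    by apply: qdiff_ext (qdiff_cst 0) => s; rewrite mul0r.
  have b2 (H : nat -> C -> C) k l (e : C) : (forall k, ballbdd (H k)) ->
      ballbdd (fun t => t * H k t + e * H l t).
    move=> bH; apply: ballbddD; apply: ballbddM => //; [exact: ballbdd_id|exact: ballbdd_cst].
  have b3 (H : nat -> C -> C) k l j (e : C) : (forall k, ballbdd (H k)) ->
      ballbdd (fun t => (H k t + t * H l t) + e * H j t).
    move=> bH; apply: ballbddD; first apply: ballbddD => //; apply: ballbddM => //.
      exact: ballbdd_id.
    exact: ballbdd_cst.
  have dl : qdiff (fun t => t * G i m.+1 t + m%:R * G i m t)
      (fun t => (G i m.+1 t + t * G i m.+2 t) + m%:R * G i m.+1 t).
    apply: qdiffD; first by apply: qdiff_mul_id => //; exact: (dG i).1.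
    by apply: qdiffZ => //; exact: (dG i).1.
  have dr := qdiffD (qdiffD (qdiffZ (- c i) ((dG i).1 m) (bG i m) (bG i m.+1))
    (qdiffZ (- a i) (dm _ (dL i) (bL i)) (b2 _ m m.-1 m%:R (bL i)) (b3 _ m m.+1 m m%:R (bL i))))
    (qdiffZ (- b i) (dm _ (dG i.+1).1 (bG i.+1)) (b2 _ m m.-1 m%:R (bG i.+1))
       (b3 _ m m.+1 m m%:R (bG i.+1))).
  have {}dl := qdiff_ext (IH i ^~ iN) (fun=> erefl) dl.
  have := qdiff_unique dl dr t; rewrite -natr1 /=.
  move: (G i m.+1 t) (G i m.+2 t) (L i m t) (L i m.+1 t) (G i.+1 m t) (G i.+1 m.+1 t) => g1 g2 l0 l1 h0 h1.
  move: (c i) (a i) (b i) m%:R => ci ai bi M E.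
  have -> : t * g2 + (M + 1) * g1 = g1 + t * g2 + M * g1 by ring.
  by rewrite E; ring.
have Gn1 m t : G n.+1 m t = 0.
  elim: m t => [|m IH] t; first by rewrite G0.
  have := (dG n.+1).1 m => /(qdiff_ext IH (fun=> erefl)) H.
  exact: (qdiff_unique H (qdiff_cst 0)).
have G00 m i : (i <= n.+1)%N -> G i m 0 = 0.
  elim: m i => [|m IH] i; rewrite leq_eqVlt ltnS => /predU1P[->//|iN].
    have := GE 0%N i 0 iN; rewrite !(mul0r, addr0, mulr0) => /esym/eqP.
    rewrite mulNr oppr_eq0 mulf_eq0 => /orP[|/eqP//]; rewrite /c -natrB//.
    rewrite mulf_eq0 -natrM natr1 !pnatr_eq0 orbF subn_eq0 => nI.
    by rewrite G0 (_ : i = n)//; apply/eqP; rewrite eqn_leq iN.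
  have := GE m.+1 i 0 iN; rewrite !mul0r !add0r /= IH; last by rewrite ltnS.
  rewrite (_ : L i m 0 = 0); last by rewrite /L; case: i iN => // i iN; rewrite IH//; lia.
  rewrite !(mulr0, addr0) mulNr => /eqP; rewrite -subr_eq0 opprK -mulrDl mulf_eq0.
  rewrite /c -natrB// -natrM natr1 -natrM -natrD pnatr_eq0.
  by rewrite addSn /= => /eqP.
move=> i t iN; rewrite -G0.
apply: (@expder_taylor_eq R (G i) (fun _ _ => 0) 0 t 0 t (dG i) (expder_zero R)) => j.
by rewrite G00 ?mul0r//; lia.
Qed.

(** [opuc_system] multiplied by D_(n+1) where [good] holds, then extended to every t as an identity
    of entire functions. *)
Lemma Dopuc_system n i (W : C -> C) : qdiff (@Dopuc R n.+1 i) W -> forall t,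
  t * W t =
     - ((n.+1%:R - i%:R) * (2 * i%:R + 1)) * Dopuc n.+1 i t
     - 2 * t * (n.+1%:R - i%:R + 1) * (if i is j.+1 then Dopuc n.+1 j t else 0)
     - 2 * t * (i%:R + 1) * Dopuc n.+1 i.+1 t.
Proof.
move=> dW t; apply/eqP; rewrite -subr_eq0; apply/eqP; move: t.
have eW : exptype W.
  have [W' eW' dW'] := exptype_qdiff (@exptype_Dopuc R n.+1 i).
  by apply: exptype_ext eW'; exact: qdiff_unique dW' dW.
apply: (@exptype_near0 _ _ 0).
  have e2 : exptype (fun t : C => if i is j.+1 then Dopuc n.+1 j t else 0).
    by case: (i) => [|j]; [exact: exptype_cst|exact: exptype_Dopuc].
  have eD := @exptype_Dopuc R n.+1.
  repeat first [apply: exptypeB | apply: exptypeM | apply: exptypeN | exact: exptype_cst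
    | exact: exptype_id | done | exact: eD].
apply: filterS (near_good n.+2 0) => t g.
have Dt j : (j <= n.+2)%N -> Dn j t != 0 := g j.
have D1 := Dt n.+1 (leqnSn _).
pose P := opuc (fc t) n.+1.
have WE : W t = - 2 * ell (fc t) n.+1 * Dn n.+1 t * P`_i + Dn n.+1 t * (dopuc n.+1 t)`_i.
  have d1 := cderM (Dn_flow (goodW (leqnSn _) g)) (is_derive_opuc i D1).
  have d2 := qdiff_is_derive t dW.
  apply: (is_derive_unique _ d2 d1).
  have := near_neq0 (exptype_Dn R n.+1) D1.
  by apply: filterS => s Ds; rewrite DopucE.
have sys := congr1 (fun p : {poly C} => p`_i)
  (opuc_system (fc_even t) (fc_rec t) (good_det g (leq_trans (leqnSn _) (leqnSn _)))
    (good_det g (leqnSn _)) (good_det g (leqnn _)) (dopuc_flow g)).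
rewrite /= coef_system coefB !coefZ -/P in sys.
have DP k : Dopuc n.+1 k t = Dn n.+1 t * P`_k by rewrite DopucE.
have DP' : (if i is j.+1 then Dopuc n.+1 j t else 0) =
    Dn n.+1 t * (if i is j.+1 then P`_j else 0) by case: (i) => [|j]; rewrite ?mulr0.
rewrite WE !DP DP' {WE DP DP' dW eW}.
apply/eqP; rewrite subr_eq0; apply/eqP.
move: sys; move: (dopuc n.+1 t)`_i (if i is _.+1 then _ else _) (P`_i) (P`_i.+1) (ell _ _) (Dn _ _).
move=> q l p p' e D sys.
transitivity (D * (t * q - 2 * t * e * p)); first by ring.
by rewrite sys; ring.
Qed.

End LinearSystem.

(** * Haar averages of the characteristic polynomial *)

Section DoubleSums.
Variables (K : comNzRingType) (n : nat).
Implicit Types (f g : 'I_n -> 'I_n -> K).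

Lemma dsumD f g :
  \sum_k \sum_l f k l + \sum_k \sum_l g k l = \sum_k \sum_l (f k l + g k l).
Proof. by rewrite -big_split; apply: eq_bigr => k _; rewrite -big_split. Qed.

Lemma dsumZ c f : c * (\sum_k \sum_l f k l) = \sum_k \sum_l c * f k l.
Proof. by rewrite big_distrr; apply: eq_bigr => k _; rewrite big_distrr. Qed.

Lemma eq_dsum f g : (forall k l, f k l = g k l) ->
  \sum_k \sum_l f k l = \sum_k \sum_l g k l.
Proof. by move=> fg; apply: eq_bigr => k _; apply: eq_bigr. Qed.

Lemma mxtrace_mulE (A B : 'M[K]_n) : \tr (A *m B) = \sum_k \sum_l A k l * B l k.
Proof. by apply: eq_bigr => k _; rewrite mxE. Qed.

Lemma mulmx3E (A Q B : 'M[K]_n) a b :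
  (A *m Q *m B) a b = \sum_k \sum_l Q k l * (A a k * B l b).
Proof.
rewrite exchange_big mxE; apply: eq_bigr => l _; rewrite mxE big_distrl.
by apply: eq_bigr => k _ /=; ring.
Qed.

End DoubleSums.

Section CharPoly.
Variables (R : realType) (n : nat).
Local Notation C := (Cplx R).
Local Notation M := 'M[C]_n.
Local Notation D := (@unitary_group R n).
Local Notation bm := (bmeas D).

Lemma bmeas_tr : bm (fun U : borelM R n => \tr (U : M)).
Proof. by apply: bmeas_sum => i _; exact: bmeas_entry. Qed.

Definition retr (U : M) : C := \tr U + conjc (\tr U).

Lemma bmeas_retr : bm (fun U : borelM R n => retr U).
Proof. by apply: bmeasD; [exact: bmeas_tr|apply: bmeas_conj; exact: bmeas_tr]. Qed.

Definition pbmeas (F : borelM R n -> {poly C}) := forall i, bm (fun U => (F U)`_i).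

Lemma pbmeas_cst p : pbmeas (fun=> p).
Proof. by move=> i; exact: bmeas_cst. Qed.

Lemma pbmeasD F G : pbmeas F -> pbmeas G -> pbmeas (fun U => F U + G U).
Proof. by move=> bF bG i; have := bmeasD (bF i) (bG i); apply: bmeas_ext => U _; rewrite coefD. Qed.

Lemma pbmeasM F G : pbmeas F -> pbmeas G -> pbmeas (fun U => F U * G U).
Proof.
move=> bF bG i; suff : bm (fun U => \sum_(j < i.+1) (F U)`_j * (G U)`_(i - j)).
  by apply: bmeas_ext => U _; rewrite coefM.
by apply: bmeas_sum => j _; apply: bmeasM; [exact: bF|exact: bG].
Qed.

Lemma pbmeas_char_poly : pbmeas (fun U : borelM R n => char_poly (U : M)).
Proof.
have bent i j : pbmeas (fun U : borelM R n => char_poly_mx (U : M) i j).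
  have b1 : pbmeas (fun U : borelM R n => ((U : M) i j)%:P).
    move=> k; case: k => [|k].
      by apply: bmeas_ext (@bmeas_entry R n i j) => U _; rewrite coefC.
    by apply: bmeas_ext (bmeas_cst D 0) => U _; rewrite coefC.
  have := pbmeasD (pbmeas_cst ('X%:M i j)) (pbmeasM (pbmeas_cst (-1)) b1).
  by move=> b k; apply: bmeas_ext (b k) => U _; rewrite mulN1r !mxE.
have bprod (s : seq 'I_n) (sg : 'S_n) :
    pbmeas (fun U : borelM R n => \prod_(i <- s) char_poly_mx (U : M) i (sg i)).
  elim: s => [|i s IH].
    by move=> k; apply: bmeas_ext (pbmeas_cst 1 k) => U _; rewrite big_nil.
  by move=> k; apply: bmeas_ext (pbmeasM (bent i (sg i)) IH k) => U _; rewrite big_cons.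
have bsum (s : seq 'S_n) : pbmeas (fun U : borelM R n =>
    \sum_(sg <- s) (-1) ^+ sg * \prod_(i < n) char_poly_mx (U : M) i (sg i)).
  elim: s => [|sg s IH].
    by move=> k; apply: bmeas_ext (pbmeas_cst 0 k) => U _; rewrite big_nil.
  move=> k; apply: bmeas_ext (pbmeasD (pbmeasM (pbmeas_cst ((-1) ^+ sg)) (bprod _ sg)) IH k) => U _.
  by rewrite big_cons.
exact: bsum.
Qed.

Lemma sde_retr Q : projector Q ->
  sde Q retr (fun U => \sum_k \sum_l Q k l * (U l k - conjc (U k l))).
Proof.
move=> pQ; have dtr : sde Q (fun U : M => \tr U) (fun U => \tr (Q *m U)).
  exact: (sde_sum (index_enum _) (fun i => sde_entry Q i i)).
apply: (sde_ext pQ _ _ (sdeD dtr (sde_conj dtr))) => // U _.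
rewrite -!conjCE mxtrace_mulE rmorph_sum.
rewrite [X in _ - X](_ : _ = \sum_k \sum_l Q k l * Num.conj (U k l)); last first.
  rewrite exchange_big; apply: eq_bigr => k _; rewrite rmorph_sum; apply: eq_bigr => l _.
  rewrite rmorphM /=; congr (_ * _).
  by rewrite -[in RHS]pQ.2 !mxE.
rewrite -mulN1r dsumZ dsumD; apply: eq_dsum => k l.
by rewrite mulrBr mulN1r.
Qed.

End CharPoly.

Section Unitary.
Variables (R : realType) (n : nat).
Local Notation C := (Cplx R).
Local Notation M := 'M[C]_n.
Local Notation D := (@unitary_group R n).
Local Notation "A ^t*" := (map_mx Num.conj (A ^T)).
Variable z : C.
Hypothesis zn : n%:R + 1 <= cn z.
Implicit Types U : M.

Lemma mxtrace_Rz U : \tr (Rz z U) = n%:R - z * \tr (res z U).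
Proof. by rewrite /Rz raddfB /= mxtrace1 mxtraceZ. Qed.

Lemma dsum_Rz U : D U ->
  \sum_a \sum_b ((1%:M - Rz z U) a a * Rz z U b b + Rz z U a b * Rz z U b a) =
  n%:R + (n%:R - 2) * (z * \tr (res z U))
    - z ^+ 2 * (\tr (res z U) ^+ 2 - \tr (res z U *m res z U)).
Proof.
move=> DU; rewrite -dsumD -mxtrace_mulE.
rewrite [X in X + _](_ : _ = \tr (1%:M - Rz z U) * \tr (Rz z U)); last first.
  by rewrite /mxtrace big_distrl; apply: eq_bigr => a _; rewrite big_distrr.
have -> : 1%:M - Rz z U = z *: res z U by rewrite /Rz opprB addrC subrK.
have -> : \tr (Rz z U *m Rz z U) = n%:R - 2 * (z * \tr (res z U)) + z ^+ 2 * \tr (res z U *m res z U).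
  rewrite /Rz mulmxBl mul1mx mulmxBr mulmx1 -scalemxAl -scalemxAr scalerA.
  rewrite !raddfB /= mxtrace1 !mxtraceZ.
  by move: (\tr (res z U)) (\tr (_ *m _)) => x y; ring.
rewrite mxtrace_Rz mxtraceZ; move: (\tr (res z U)) (\tr (_ *m _)) => x y; ring.
Qed.

Lemma dsum_RzU U : D U ->
  \sum_a \sum_b Rz z U a b * (U b a - conjc (U a b)) =
  \tr U + z * (n%:R - z * \tr (res z U)) + \tr (res z U).
Proof.
move=> DU; have UU : U *m U ^t* = 1%:M by exact/unitarymxP.
have UU' := mulmx1C UU.
have RU : Rz z U = - (U *m res z U) by rewrite mul_res// opprK.
have -> : \sum_a \sum_b Rz z U a b * (U b a - conjc (U a b)) =
    \tr (Rz z U *m U) - \tr (Rz z U *m U ^t*).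
  rewrite !mxtrace_mulE -mulN1r dsumZ dsumD; apply: eq_dsum => a b.
  by rewrite !mxE mulrBr mulN1r.
have -> : \tr (Rz z U *m U ^t*) = - \tr (res z U).
  by rewrite RU mulNmx raddfN /= mxtrace_mulC mulmxA UU' mul1mx.
have -> : \tr (Rz z U *m U) = \tr U + z * (n%:R - z * \tr (res z U)).
  rewrite -mxtrace_Rz {1}/Rz mulmxBl mul1mx -scalemxAl raddfB /= mxtraceZ.
  by rewrite mxtrace_mulC mul_res// raddfN /= mulrN opprK.
by rewrite opprK.
Qed.

Lemma char_poly_zdet U : D U ->
  [/\ (char_poly U).[z] = zdet z U, (char_poly U)^`().[z] = zdet z U * \tr (res z U) &
   (char_poly U)^`()^`().[z] = zdet z U * (\tr (res z U) ^+ 2 - \tr (res z U *m res z U))].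
Proof.
move=> DU; have UU : U *m U ^t* = 1%:M by exact/unitarymxP.
have nU : U \is normalmx by apply/normalmxP; rewrite UU (mulmx1C UU).
have [e1 e2 e3] := char_poly_resolvent nU (resolvent_unit zn DU).
by rewrite e2 e3 e1.
Qed.

End Unitary.

(** * Schwinger-Dyson equations for the weighted characteristic polynomial *)

Section HaarSystem.
Variables (R : realType) (n : nat) (P : probability (borelM R n) R).
Hypothesis hP : is_haar P.
Local Notation C := (Cplx R).
Local Notation M := 'M[C]_n.
Local Notation D := (@unitary_group R n).
Local Notation bm := (bmeas D).
Variable t : C.
Local Notation E U := (cexp (t * retr U)).

Lemma bmeas_cexp_retr : bm (fun U : borelM R n => E U).
Proof. by apply: bmeas_cexp; apply: bmeasM; [exact: bmeas_cst|exact: bmeas_retr]. Qed.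

Lemma sde_cexp_retr (Q : M) : projector Q ->
  sde Q (fun U => E U) (fun U => E U * (t * \sum_k \sum_l Q k l * (U l k - conjc (U k l)))).
Proof.
move=> pQ; have := sde_cexp pQ (sdeM pQ (sde_cst Q t) (sde_retr pQ)).
by apply: sde_ext => // U _; rewrite mul0r add0r.
Qed.

Section Point.
Variable z : C.
Hypothesis zn : n%:R + 1 <= cn z.
Local Notation W U := (zdet z U * E U).
Local Notation dW k l U := (W U * (Rz z U l k + t * (U l k - conjc (U k l)))).

Lemma bmeas_W : bm (fun U : borelM R n => W U).
Proof. by apply: bmeasM; [exact: bmeas_zdet|exact: bmeas_cexp_retr]. Qed.

Lemma bmeas_dW k l : bm (fun U : borelM R n => dW k l U).
Proof.
apply: bmeasM; first exact: bmeas_W.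
apply: bmeasD; first exact: bmeas_Rz.
apply: bmeasM; first exact: bmeas_cst.
by apply: bmeasB; [exact: bmeas_entry|apply: bmeas_conj; exact: bmeas_entry].
Qed.

Lemma sde_W (c : 'cV[C]_n) (r : 'rV[C]_n) : projector (c *m r) ->
  sde (c *m r) (fun U => W U) (fun U => \sum_k \sum_l (c *m r) k l * dW k l U).
Proof.
move=> pQ; apply: (sde_ext pQ _ _ (sdeM pQ (sde_zdet zn pQ) (sde_cexp_retr pQ))) => // U _.
rewrite mxtrace_mulE; move: (c *m r) => Q.
rewrite [LHS](_ : _ = W U * (\sum_k \sum_l Q k l * Rz z U l k +
   t * \sum_k \sum_l Q k l * (U l k - conjc (U k l)))); last first.
  by move: (zdet z U) (E U) (\sum_k _) (\sum_k _) => a b x y; ring.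
rewrite dsumZ dsumD dsumZ; apply: eq_dsum => k l.
by move: (W U) (Q k l) (Rz z U l k) (_ - _) => a b x y; ring.
Qed.

Lemma Ex_dW k l : Ex P (fun U => dW k l U) = 0.
Proof.
apply: (schwinger_dyson hP bmeas_W (H := fun k l U => dW k l U)) => [{}k {}l|].
  exact: bmeas_dW.
exact: sde_W.
Qed.

(** The Schwinger-Dyson equation for an entry of [Rz] times the weighted determinant, taken at k =
    a, l = b. With this choice the sum over a and b involves only traces. *)
Lemma Ex_RzW a b : Ex P (fun U => (1%:M - Rz z U) a a * Rz z U b b * W U + Rz z U a b * dW a b U) = 0.
Proof.
apply: (schwinger_dyson hP (G := fun U => Rz z U a b * W U)
  (H := fun k l U => (1%:M - Rz z U) a k * Rz z U l b * W U + Rz z U a b * dW k l U)).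
- by apply: bmeasM; [exact: bmeas_Rz|exact: bmeas_W].
- move=> k l; apply: bmeasD; last by apply: bmeasM; [exact: bmeas_Rz|exact: bmeas_dW].
  apply: bmeasM; last exact: bmeas_W.
  apply: bmeasM; last exact: bmeas_Rz.
  have := bmeasB (bmeas_cst D (1%:M a k : C)) (bmeas_Rz zn a k).
  by apply: bmeas_ext => U _; rewrite !mxE.
move=> c r pQ; apply: (sde_ext pQ _ _ (sdeM pQ (sde_Rz zn a b pQ) (sde_W pQ))) => // U _.
rewrite mulmx3E dsumZ mulrC dsumZ dsumD; apply: eq_dsum => k l.
move: (dW k l U) (W U) ((1%:M - Rz z U) a k) (Rz z U l b) (Rz z U a b) ((c *m r) k l).
by move=> x1 x2 x3 x4 x5 x6; ring.
Qed.

End Point.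

(** The operator of [opuc_system] applied to the characteristic polynomial; the factor t [retr U] is
    what t d/dt brings down from the exponential. *)
Definition defect (U : M) : {poly C} := let p := char_poly U in
  (t * retr U) *: p - ((n%:R *: p - 'X * p^`()) - 2 *: (n%:R *: p +
     (n%:R - 2) *: ('X * p^`()) - 'X ^+ 2 * p^`()^`())
   - (2 * t) *: ('X * (n%:R *: p - 'X * p^`())) - (2 * t) *: p^`()).

Lemma Ex_defect_horner (z : C) : n%:R + 1 <= cn z ->
  Ex P (fun U => (defect U).[z] * E U) = 0.
Proof.
move=> zn.
pose T1 a b (U : borelM R n) := (1%:M - Rz z (U : M)) a a * Rz z (U : M) b b * (zdet z (U : M) * E U) +
  Rz z (U : M) a b * (zdet z (U : M) * E U * (Rz z (U : M) b a + t * ((U : M) b a - conjc ((U : M) a b)))).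
pose T2 k (U : borelM R n) := zdet z (U : M) * E U * (Rz z (U : M) k k + t * ((U : M) k k - conjc ((U : M) k k))).
have b1 a b : bm (T1 a b).
  apply: bmeasD; last by apply: bmeasM; [exact: bmeas_Rz|exact: bmeas_dW].
  apply: bmeasM; last exact: bmeas_W.
  apply: bmeasM; last exact: bmeas_Rz.
  have := bmeasB (bmeas_cst D (1%:M a a : C)) (bmeas_Rz zn a a).
  by apply: bmeas_ext => U _; rewrite !mxE.
have b2 k : bm (T2 k) := bmeas_dW zn k k.
pose S1 U := \sum_a \sum_b T1 a b U; pose S2 U := \sum_k T2 k U.
have bS1 : bm S1 by apply: bmeas_sum => a _; apply: bmeas_sum => b _.
have bS2 : bm S2 by apply: bmeas_sum => k _.
have E1 : Ex P S1 = 0.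
  rewrite (Ex_sum hP) => [|a _]; last by apply: bmeas_sum => b _.
  rewrite big1// => a _; rewrite (Ex_sum hP) => [|b _//].
  by rewrite big1// => b _; exact: Ex_RzW.
have E2 : Ex P S2 = 0.
  by rewrite (Ex_sum hP) => [|k _//]; rewrite big1// => k _; exact: Ex_dW.
(* The combination 2 S1 - S2 is chosen so that 2 tr U - (tr U - conj(tr U)) = [retr U]. *)
transitivity (2 * 0 - 0 : C); last by rewrite mulr0 subr0.
rewrite -{1}E1 -{1}E2 -(ExZ hP _ bS1) -(ExB hP (bmeasM (bmeas_cst D 2) bS1) bS2).
apply: eq_Ex => U DU; have [e0 e1 e2] := char_poly_zdet zn DU.
have -> : S1 U = zdet z U * E U *
  (\sum_a \sum_b ((1%:M - Rz z U) a a * Rz z U b b + Rz z U a b * Rz z U b a) +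
   t * \sum_a \sum_b Rz z U a b * (U b a - conjc (U a b))).
  rewrite dsumZ dsumD dsumZ; apply: eq_dsum => a b; rewrite /T1.
  by move: (zdet z U) (E U) ((1%:M - Rz z U) a a) (Rz z U b b) (Rz z U a b) (Rz z U b a) (_ - _) =>
    x1 x2 x3 x4 x5 x6 x7; ring.
have -> : S2 U =
  zdet z U * E U * (\tr (Rz z U) + t * (\tr U - conjc (\tr U))).
  rewrite /S2 /T2 -big_distrr big_split /=; congr (_ * (_ + _)).
  by rewrite -big_distrr /= sumrB -!conjCE /mxtrace rmorph_sum.
rewrite dsum_Rz// dsum_RzU// mxtrace_Rz /defect.
rewrite !(hornerD, hornerN, hornerZ, hornerM, horner_exp, hornerX) e0 e1 e2 /retr.
move: (E U) (zdet z U) (\tr (res z U)) (\tr (_ *m _)) (\tr U) (conjc _) => x1 x2 x3 x4 x5 x6.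
by ring.
Qed.

Lemma coef_defect U i : (defect U)`_i = t * retr U * (char_poly U)`_i -
  (- ((n%:R - i%:R) * (2 * i%:R + 1)) * (char_poly U)`_i
   - 2 * t * (n%:R - i%:R + 1) * (if i is j.+1 then (char_poly U)`_j else 0)
   - 2 * t * (i%:R + 1) * (char_poly U)`_i.+1).
Proof. by rewrite /defect coefB coefZ coef_system. Qed.

Lemma bmeas_coef_pred i :
  bm (fun U : borelM R n => if i is j.+1 then (char_poly (U : M))`_j else 0).
Proof. by case: i => [|i]; [exact: bmeas_cst|exact: pbmeas_char_poly]. Qed.

Lemma bmeas_coef_defect i : bm (fun U : borelM R n => (defect U)`_i).
Proof.
have b := @pbmeas_char_poly R n.
suff : bm (fun U : borelM R n => t * retr U * (char_poly (U : M))`_i -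
  (- ((n%:R - i%:R) * (2 * i%:R + 1)) * (char_poly (U : M))`_i
   - 2 * t * (n%:R - i%:R + 1) * (if i is j.+1 then (char_poly (U : M))`_j else 0)
   - 2 * t * (i%:R + 1) * (char_poly (U : M))`_i.+1)).
  by apply: bmeas_ext => U _; rewrite coef_defect.
apply: bmeasB.
  apply: bmeasM; last exact: b.
  by apply: bmeasM; [exact: bmeas_cst|exact: bmeas_retr].
apply: bmeasB; last by apply: bmeasM; [exact: bmeas_cst|exact: b].
apply: bmeasB; first by apply: bmeasM; [exact: bmeas_cst|exact: b].
by apply: bmeasM; [exact: bmeas_cst|exact: bmeas_coef_pred].
Qed.

Lemma size_defect U : (size (defect U) <= n.+2)%N.
Proof.
have p0 j : (n < j)%N -> (char_poly U)`_j = 0.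
  by move=> nj; rewrite nth_default// size_char_poly.
apply/leq_sizeP => j nj; rewrite coef_defect.
rewrite p0 ?(p0 j.+1); [|by lia..].
case: j nj => // j nj; rewrite p0//.
by rewrite !mulr0 !subr0.
Qed.

Lemma Ex_coef_defect i : Ex P (fun U => (defect U)`_i * E U) = 0.
Proof.
pose p := \poly_(j < n.+2) Ex P (fun U => (defect U)`_j * E U).
have bS j : bm (fun U : borelM R n => (defect U)`_j * E U).
  by apply: bmeasM; [exact: bmeas_coef_defect|exact: bmeas_cexp_retr].
have rp (z : C) : n%:R + 1 <= cn z -> root p z.
  move=> zn; apply/eqP; rewrite -[RHS](Ex_defect_horner zn).
  rewrite (horner_coef_wide _ (size_poly _ _)).
  have bSz (j : 'I_n.+2) : bm (fun U : borelM R n => z ^+ j * ((defect U)`_j * E U)).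
    by apply: bmeasM => //; exact: bmeas_cst.
  rewrite (eq_bigr (fun j : 'I_n.+2 => Ex P (fun U => z ^+ j * ((defect U)`_j * E U)))) => [|j _]; last first.
    by rewrite (ExZ hP)// coef_poly ltn_ord mulrC.
  rewrite -(Ex_sum hP)//; apply: eq_Ex => U _.
  rewrite (horner_coef_wide _ (size_defect U)) big_distrl; apply: eq_bigr => j _ /=.
  by rewrite mulrCA mulrA.
have p0 : p = 0.
  (* The degree is at most n + 1, and n + 1, ..., 2 n + 2 are n + 2 distinct roots. *)
  apply: (@roots_geq_poly_eq0 _ p (mkseq (fun k => (n.+1 + k)%:R) n.+2)).
  - apply/allP => _ /mapP[k _ ->]; apply: rp.
    by rewrite cn_nat natr1 ler_nat leq_addr.
  - by rewrite mkseq_uniq// => a b /(mulrIn (oner_neq0 _)) /addnI.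
  - by rewrite size_mkseq size_poly.
have [iN|iN] := ltnP i n.+2.
  by have := congr1 (fun q : {poly C} => q`_i) p0; rewrite coef_poly iN coef0.
rewrite -[RHS](Ex_cst hP); apply: eq_Ex => U _.
by rewrite nth_default ?mul0r// (leq_trans (size_defect U)).
Qed.

End HaarSystem.

Section HaarMoments.
Variables (R : realType) (n : nat) (P : probability (borelM R n) R).
Hypothesis hP : is_haar P.
Local Notation C := (Cplx R).
Local Notation M := 'M[C]_n.
Local Notation D := (@unitary_group R n).
Local Notation bm := (bmeas D).

(** The index [j] counts derivatives in t of the weighted average of the i-th coefficient. *)
Definition hmom j i (t : C) : C :=
  Ex P (fun U : M => (char_poly U)`_i * retr U ^+ j * cexp (t * retr U)).

Lemma expder_hmom i : expder (hmom ^~ i).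
Proof.
have fD : (P D < +oo)%E by rewrite hP.1 ltry.
exact: (expder_cintegral (@measurable_unitary R n) fD (@bmeas_retr R n) (@pbmeas_char_poly R n i)).
Qed.

Lemma hmom_system i t : t * hmom 1 i t =
     - ((n%:R - i%:R) * (2 * i%:R + 1)) * hmom 0 i t
     - 2 * t * (n%:R - i%:R + 1) * (if i is j.+1 then hmom 0 j t else 0)
     - 2 * t * (i%:R + 1) * hmom 0 i.+1 t.
Proof.
have b := @pbmeas_char_poly R n; have bE := @bmeas_cexp_retr R n t.
have b1 : bm (fun U : borelM R n => (char_poly (U : M))`_i * retr U ^+ 1 * cexp (t * retr U)).
  by apply: bmeasM => //; apply: bmeasM; [exact: b|apply: bmeasX; exact: bmeas_retr].
have b0 j : bm (fun U : borelM R n => (char_poly (U : M))`_j * retr U ^+ 0 * cexp (t * retr U)).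
  by apply: bmeasM => //; apply: bmeasM; [exact: b|apply: bmeasX; exact: bmeas_retr].
have b0' : bm (fun U : borelM R n => (if i is j.+1 then (char_poly (U : M))`_j else 0) * cexp (t * retr U)).
  by apply: bmeasM => //; exact: bmeas_coef_pred.
have pE : (if i is j.+1 then hmom 0 j t else 0) =
    Ex P (fun U : borelM R n => (if i is j.+1 then (char_poly (U : M))`_j else 0) * cexp (t * retr U)).
  case: (i) => [|j]; last by apply: eq_Ex => U _; rewrite expr0 mulr1.
  by rewrite -[LHS](Ex_cst hP); apply: eq_Ex => U _; rewrite mul0r.
have bZ (c : C) F : bm F -> bm (fun U => c * F U) by move=> bF; apply: bmeasM => //; exact: bmeas_cst.
have lin A B G F1 F2 F3 F4 : bm F1 -> bm F2 -> bm F3 -> bm F4 ->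
    Ex P (fun U => t * F1 U - (A * F2 U - B * F3 U - G * F4 U)) =
    t * Ex P F1 - (A * Ex P F2 - B * Ex P F3 - G * Ex P F4).
  move=> c1 c2 c3 c4; have c23 := bmeasB (bZ A _ c2) (bZ B _ c3).
  rewrite (ExB hP (bZ t _ c1) (bmeasB c23 (bZ G _ c4))) (ExB hP c23 (bZ G _ c4)).
  by rewrite (ExB hP (bZ A _ c2) (bZ B _ c3)) !(ExZ hP).
apply/eqP; rewrite -subr_eq0 pE /hmom -lin//; apply/eqP.
rewrite -[RHS](Ex_coef_defect hP t i); apply: eq_Ex => U _.
rewrite coef_defect expr1 expr0.
move: (cexp (t * retr U)) (retr U) (if i is j.+1 then (char_poly U)`_j else 0) => x1 x2 x3.
by move: (char_poly U)`_i (char_poly U)`_i.+1 => x4 x5; ring.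
Qed.

End HaarMoments.

(** * The group integral as a Toeplitz determinant, and dependence on the product rs *)

Section ToeplitzHaar.
Variable R : realType.
Local Notation C := (Cplx R).

(** The characteristic polynomial is monic, so the integral is the average of its leading
    coefficient. The differences with [Dopuc] solve the linear system, and the leading one is 1 - 1
    = 0 at t = 0; uniqueness makes it vanish. *)
Lemma expect_tr_Dn n (P : probability (borelM R n.+1) R) (hP : is_haar P) (t : C) :
  expect_tr P t t = Dn n.+1 t.
Proof.
have /boolp.choice[W dW] : forall i, exists W : C -> C, qdiff (Dopuc n.+1 i) W.
  by move=> i; have [W _ dW] := exptype_qdiff (@exptype_Dopuc R n.+1 i); exists W.
have -> : expect_tr P t t = hmom P 0 n.+1 t.
  apply: eq_Ex => U _.
  have -> : (char_poly U)`_n.+1 = 1.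
    by have := char_poly_monic U; rewrite monicE lead_coefE size_char_poly => /eqP.
  by rewrite expr0 !mul1r -mulrDr.
have eh i : exptype (hmom P 0 i) by exists (hmom P ^~ i) => //; exact: expder_hmom.
apply/eqP; rewrite -subr_eq0; apply/eqP.
have DE s : Dn n.+1 s = Dopuc n.+1 n.+1 s by rewrite /Dopuc eqxx.
rewrite DE.
apply: (@linear_system_unique R n.+1 (fun i t => hmom P 0 i t - Dopuc n.+1 i t)
  (fun i t => hmom P 1 i t + - 1 * W i t)) => //.
- by move=> i; apply: exptypeB => //; exact: exptype_Dopuc.
- move=> i; have [G G0 dG] := @exptype_Dopuc R n.+1 i.
  have GW : G 1%N =1 W i by have := dG.1 0%N; rewrite G0 => /qdiff_unique; apply.
  have := qdiffD ((expder_hmom hP i).1 0%N) (qdiffZ (-1) (dG.1 0%N) (ballbdd_expder 0 dG)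
    (ballbdd_expder 1 dG)).
  by apply: qdiff_ext => s; rewrite ?GW// G0 mulN1r.
- move=> i s iN; have := hmom_system hP i s; have := Dopuc_system (dW i) s.
  rewrite mulN1r mulrBr => -> ->.
  have -> : (if i is j.+1 then hmom P 0 j s - Dopuc n.+1 j s else 0) =
    (if i is j.+1 then hmom P 0 j s else 0) - (if i is j.+1 then Dopuc n.+1 j s else 0).
    by case: (i) => [|j]; rewrite ?subr0.
  move: (if i is _.+1 then hmom _ _ _ _ else _) (if i is _.+1 then Dopuc _ _ _ else _).
  move: (hmom P 0 i s) (hmom P 0 i.+1 s) (Dopuc n.+1 i s) (Dopuc n.+1 i.+1 s) => a b c d x y.
  ring.
- move=> s; have -> : Dopuc n.+1 n.+2 s = 0.
    by rewrite /Dopuc gtn_eqF ?leqnn// insubF// ltnNge leqnSn.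
  rewrite subr0 -[RHS](Ex_cst hP); apply: eq_Ex => U _.
  by rewrite nth_default ?size_char_poly// !mul0r.
rewrite -DE Dn0 -(Ex_cst hP 1); apply/eqP; rewrite subr_eq0; apply/eqP.
apply: eq_Ex => U _; rewrite mul0r cexp0 expr0 !mulr1.
by have := char_poly_monic U; rewrite monicE lead_coefE size_char_poly => /eqP.
Qed.

Lemma exists_phase m : (0 < m)%N -> exists2 w : C, cn w = 1 & w ^+ m = -1.
Proof.
move=> m0; exists (m.-root (-1)); last exact: rootCK.
have : cn (m.-root (-1) : C) ^+ m = 1 by rewrite -cnX rootCK// cnN cn1.
by move=> /eqP; rewrite pexpr_eq1 ?cn_ge0// => /eqP.
Qed.

Variables (n : nat) (P : probability (borelM R n) R).
Hypothesis hP : is_haar P.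
Local Notation M := 'M[C]_n.
Local Notation D := (@unitary_group R n).
Local Notation bm := (bmeas D).

(** Translation by a scalar w of modulus 1 multiplies the moment by w^j conj(w)^k, which a suitable
    root of -1 makes equal to -1. *)
Lemma mixed_moment0 j k : j != k -> Ex P (fun U : M => (\tr U) ^+ j * conjc (\tr U) ^+ k) = 0.
Proof.
move=> jk.
have bT := @bmeas_tr R n; have bF : bm (fun U : borelM R n => (\tr (U : M)) ^+ j * conjc (\tr (U : M)) ^+ k).
  by apply: bmeasM; apply: bmeasX => //; exact: bmeas_conj.
suff [w w1 wjk] : exists2 w : C, cn w = 1 & w ^+ j * conjc w ^+ k = -1.
  have uw : (w%:M : M) \is unitarymx.
    apply/unitarymxP; apply/matrixP => a b.
    rewrite mul_scalar_mx !mxE eq_sym; case: eqP => _; rewrite ?mulr1n ?mulr0n ?rmorph0 ?mulr0//.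
    exact: cn1_conj.
  have := Ex_inv hP uw bF.
  rewrite (eq_Ex P (G := fun U => -1 * ((\tr U) ^+ j * conjc (\tr U) ^+ k))) => [|U _]; last first.
    rewrite -wjk mul_scalar_mx mxtraceZ -!conjCE rmorphM !exprMn.
    by move: (w ^+ j) (_ ^+ k) (_ ^+ k) (_ ^+ j) => x1 x2 x3 x4; ring.
  rewrite (ExZ hP)// mulN1r => /eqP; rewrite eq_sym -subr_eq0 opprK -mulr2n mulrn_eq0 /=.
  by move=> /eqP.
have [[m [m0 ->]]|[m [m0 ->]]] : {m | (0 < m)%N /\ k = (j + m)%N} + {m | (0 < m)%N /\ j = (k + m)%N}.
  case: (ltngtP j k) jk => // jk _; [left; exists (k - j)%N|right; exists (j - k)%N]; lia.
- have [w w1 wm] := exists_phase m0; exists w => //.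
  by rewrite -conjCE exprD mulrA -exprMn cn1_conj// expr1n mul1r -rmorphXn wm rmorphN1.
- have [w w1 wm] := exists_phase m0; exists w => //.
  by rewrite -conjCE exprD mulrAC -exprMn cn1_conj// expr1n mul1r wm.
Qed.

(** Taylor expansion at 0 in r and then in s has terms r^j s^k times a mixed moment; only j = k
    survives, where the factor is (r s)^j. *)
Lemma expect_tr_mul (r s r' s' : C) : r * s = r' * s' -> expect_tr P r s = expect_tr P r' s'.
Proof.
move=> rs; have mD := @measurable_unitary R n.
have fD : (P D < +oo)%E by rewrite hP.1 ltry.
have bT := @bmeas_tr R n; have bT' := bmeas_conj bT.
pose psi s (U : borelM R n) : C := cexp (s * conjc (\tr (U : M))).
have bpsi z : bm (psi z).
  by apply: bmeas_cexp; apply: bmeasM => //; exact: bmeas_cst.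
have E0 a b : expect_tr P a b = cintegral P D (fun U : M => psi b U * (\tr U) ^+ 0 * cexp (a * \tr U)).
  by apply: eq_Ex => U _; rewrite expr0 mulr1 cexpD mulrC.
rewrite !E0; apply: (@expder_taylor_eq R _ _ 0 r 0 r'
  (expder_cintegral mD fD bT (bpsi s)) (expder_cintegral mD fD bT (bpsi s'))) => j.
rewrite !subr0.
have bpow a : bm (fun U : borelM R n => a ^+ j * (\tr (U : M)) ^+ j).
  by apply: bmeasM; [exact: bmeas_cst|exact: bmeasX].
have E1 a b : cintegral P D (fun U : M => psi b U * (\tr U) ^+ j * cexp (0 * \tr U)) * a ^+ j =
    cintegral P D (fun U : M => (a ^+ j * (\tr U) ^+ j) * conjc (\tr U) ^+ 0 * cexp (b * conjc (\tr U))).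
  rewrite mulrC -(ExZ hP); first by apply: eq_Ex => U _; rewrite mul0r cexp0 expr0 !mulr1 mulrA mulrAC mulrC mulrA.
  apply: bmeasM; first by apply: bmeasM => //; exact: bmeasX.
  by apply: bmeas_cexp; apply: bmeasM => //; exact: bmeas_cst.
rewrite !E1; apply: (@expder_taylor_eq R _ _ 0 s 0 s'
  (expder_cintegral mD fD bT' (bpow r)) (expder_cintegral mD fD bT' (bpow r'))) => k.
rewrite !subr0.
have E2 a b : cintegral P D (fun U : M => (a ^+ j * (\tr U) ^+ j) * conjc (\tr U) ^+ k *
    cexp (0 * conjc (\tr U))) * b ^+ k = a ^+ j * b ^+ k * Ex P (fun U : M => (\tr U) ^+ j * conjc (\tr U) ^+ k).
  rewrite mulrAC -(ExZ hP); last by apply: bmeasM; exact: bmeasX.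
  congr (_ * _); apply: eq_Ex => U _; rewrite mul0r cexp0 mulr1 mulrA //.
refine (etrans (E2 r s) (etrans _ (esym (E2 r' s')))); have [->|jk] := eqVneq j k; first by rewrite -2!exprMn rs.
by rewrite (mixed_moment0 jk) 2!mulr0.
Qed.

End ToeplitzHaar.

(** * The logarithmic formula *)

Section RealLine.
Variable R : realType.
Local Notation C := (Cplx R).
Implicit Types (f g L l phi : R -> R) (x t : R).

Lemma is_derive_quadratic f x (a K : R) : 0 <= K ->
  (forall h, `|h| <= 1 -> `|f (x + h) - f x - h * a| <= K * h ^+ 2) -> is_derive x 1 f a.
Proof.
move=> K0 HK.
have cvF : (fun h => h^-1 *: (f (h *: 1 + x) - f x)) @ (0 : R)^' --> a.
  apply/cvgrPdist_le => e e0.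
  exists (Num.min 1 (e / (K + 1))) => /=.
    by rewrite lt_min ltr01 divr_gt0// ltr_wpDl.
  move=> h /=; rewrite sub0r normrN lt_min => /andP[h1 hd] hn0.
  have h0 : 0 < `|h| by rewrite normr_gt0.
  have -> : a - h^-1 *: (f (h *: 1 + x) - f x) = - (h^-1 * (f (x + h) - f x - h * a)).
    by rewrite [h *: 1]mulr1 [h + x]addrC; rewrite /GRing.scale /=; field.
  rewrite normrN normrM normfV ler_pdivrMl//.
  apply: (le_trans (HK _ (ltW h1))); rewrite -real_normK ?num_real// expr2 mulrCA ler_pM2l//.
  move: hd; rewrite ltr_pdivlMr ?ltr_wpDl// => /ltW /(le_trans _); apply.
  by rewrite mulrC ler_wpM2l ?(ltW h0)// lerDl.
split; first by apply/cvg_ex; exists a.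
exact: (cvg_lim (@norm_hausdorff _ _) cvF).
Qed.

Lemma qdiff_Re (F F' : C -> C) x : qdiff F F' ->
  is_derive x 1 (fun y : R => complex.Re (F y%:C)) (complex.Re (F' x%:C)).
Proof.
move=> dF; have [K K0 HK] := dF (`|x| + 1).
apply: (is_derive_quadratic K0) => h h1.
have xh : `|x + h| <= `|x| + 1 by apply: (le_trans (ler_normD _ _)); rewrite lerD2l.
have := HK x%:C h%:C; rewrite (_ : x%:C + h%:C = (x + h)%:C); last by rewrite rmorphD.
rewrite !cn_real lerDl ler01 xh real_normK ?num_real// => /(_ isT isT); apply: le_trans.
apply: le_trans (Re_le_cn _); rewrite !(cReD, cReN, cReM) /=.
by rewrite mul0r subr0.
Qed.

Lemma qdiff_Im (F F' : C -> C) x : qdiff F F' ->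
  is_derive x 1 (fun y : R => complex.Im (F y%:C)) (complex.Im (F' x%:C)).
Proof.
move=> dF; have [K K0 HK] := dF (`|x| + 1).
apply: (is_derive_quadratic K0) => h h1.
have xh : `|x + h| <= `|x| + 1 by apply: (le_trans (ler_normD _ _)); rewrite lerD2l.
have := HK x%:C h%:C; rewrite (_ : x%:C + h%:C = (x + h)%:C); last by rewrite rmorphD.
rewrite !cn_real lerDl ler01 xh real_normK ?num_real// => /(_ isT isT); apply: le_trans.
apply: le_trans (Im_le_cn _); rewrite !(cImD, cImN, cImM) /=.
by rewrite mul0r addr0.
Qed.

Lemma qdiff_real (F F' : C -> C) : qdiff F F' -> (forall x, complex.Im (F x%:C) = 0) ->
  forall x, complex.Im (F' x%:C) = 0.
Proof.
move=> dF F0 x; have [_ <-] := qdiff_Im x dF.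
rewrite (_ : (fun y : R => _) = cst 0); first exact: derive_cst.
exact/funext.
Qed.

Lemma is_derive_continuous f x a : is_derive x 1 f a -> {for x, continuous f}.
Proof.
by move=> [df _]; apply: differentiable_continuous; exact/derivable1_diffP.
Qed.

Section LogKernel.
Variable t : R.
Hypothesis t0 : 0 < t.
Let s x := (ln t - ln x) * x.

(** For 0 < x < t, ln(t / x) = 2 ln sqrt(t / x) <= 2 sqrt(t / x), so the kernel is at most 2 sqrt(t
    x). *)
Lemma cvg_log_kernel0 : s x @[x --> 0^'+] --> (0 : R).
Proof.
apply/cvgrPdist_le => e e0; near=> x.
have x0 : 0 < x by near: x; exact: nbhs_right_gt.
have xt : x < t by near: x; exact: nbhs_right_lt.
have xe : x < e ^+ 2 / (4 * t).
  by near: x; apply: nbhs_right_lt; rewrite divr_gt0 ?exprn_gt0 ?mulr_gt0.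
rewrite sub0r normrN /s.
have q0 : 0 < Num.sqrt (t / x) by rewrite sqrtr_gt0 divr_gt0.
have qE : Num.sqrt (t / x) ^+ 2 = t / x by rewrite sqr_sqrtr// ltW// divr_gt0.
have lE : ln t - ln x = 2 * ln (Num.sqrt (t / x)).
  by rewrite -ln_div ?posrE// -[in LHS]qE lnXn// mulr_natl.
have l0 : 0 <= ln t - ln x by rewrite subr_ge0 ler_ln ?posrE// ltW.
have lq := ln_sublinear q0.
rewrite ger0_norm ?mulr_ge0 ?(ltW x0)//.
apply: (@le_trans _ _ (2 * Num.sqrt (t / x) * x)).
  by rewrite lE ler_wpM2r ?(ltW x0)// ler_wpM2l// ltW.
rewrite -(@ler_pXn2r _ 2)// ?nnegrE ?mulr_ge0 ?(ltW e0) ?(ltW x0) ?(ltW q0)//.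
rewrite !exprMn qE (_ : 2 ^+ 2 * (t / x) * x ^+ 2 = 4 * t * x); last by field; rewrite gt_eqF.
by move: xe; rewrite ltr_pdivlMr ?mulr_gt0// mulrC => /ltW.
Unshelve. all: by end_near. Qed.

Lemma is_derive_log_kernel x : 0 < x -> is_derive x 1 s (ln t - ln x - 1).
Proof.
move=> x0; have dl := is_derive1_ln x0.
have := cderM (cderD (cderC (ln t) x) (cderM (cderC (-1) x) dl)) (cder_id x).
rewrite (_ : (fun _ => _) = s); last by apply/funext => y; rewrite /s mulN1r.
move=> H; apply: (is_derive_eq H); field; by rewrite gt_eqF.
Qed.

Variables (L l phi : R -> R).
Hypotheses (dL : forall x, is_derive x 1 L (l x))
  (dl : forall x, is_derive x 1 (fun y => y * l y) (4 * x * phi x))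
  (cl : continuous l) (cphi : continuous phi) (L0 : L 0 = 0).

Lemma continuous_log_kernel : {within `[0, t], continuous (fun x => s x * phi x)}.
Proof.
have cx x : 0 < x -> {for x, continuous (fun x => s x * phi x)}.
  move=> x0; apply: cvgM; last exact: cphi.
  exact: (is_derive_continuous (is_derive_log_kernel x0)).
apply/continuous_within_itvP => //; split.
- by move=> x; rewrite in_itv /= => /andP[x0 _]; exact: cx.
- rewrite (_ : s 0 * phi 0 = 0 * phi 0); last by rewrite /s mulr0.
  by apply: cvgM; [exact: cvg_log_kernel0|apply: cvg_at_right_filter; exact: cphi].
- by apply: cvg_at_left_filter; exact: cx.
Qed.

(** Since (x l)' = 4 x phi and L' = l, the function ((ln t - ln x) x l + L) / 4 is an antiderivative
    on x > 0; it tends to 0 at 0 and equals L(t) / 4 at t. *)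
Lemma Rintegral_log_kernel :
  Rintegral (@lebesgue_measure R) `[0, t] (fun x => s x * phi x) = L t / 4.
Proof.
pose K x := (s x * l x + L x) / 4.
have dK x : 0 < x -> is_derive x 1 K (s x * phi x).
  move=> x0; have dln := is_derive1_ln x0.
  have d1 := cderD (cderC (ln t) x) (cderM (cderC (-1) x) dln).
  have := cderM (cderD (cderM d1 (dl x)) (dL x)) (cderC 4^-1 x).
  rewrite (_ : (fun _ => _) = K); last by apply/funext => y; rewrite /K /s mulN1r mulrA.
  by move=> H; apply: (is_derive_eq H); rewrite /s; field; rewrite gt_eqF.
have K0 : K 0 = 0 by rewrite /K /s L0 mulr0 mul0r addr0 mul0r.
have Kt : K t = L t / 4 by rewrite /K /s subrr !mul0r add0r.
have cs0 : K x @[x --> 0^'+] --> (0 * l 0 + L 0) * 4^-1.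
  apply: cvgM; last exact: cvg_cst.
  apply: cvgD; last by apply: cvg_at_right_filter; exact: (is_derive_continuous (dL 0)).
  by apply: cvgM; [exact: cvg_log_kernel0|apply: cvg_at_right_filter; exact: cl].
rewrite L0 mul0r addr0 mul0r in cs0.
rewrite /Rintegral (@continuous_FTC2 _ _ K 0 t t0 continuous_log_kernel).
- by rewrite -EFinB /= K0 subr0 Kt.
- split.
  + by move=> x; rewrite in_itv /= => /andP[x0 _]; have [] := dK x x0.
  + by rewrite K0.
  + by apply: cvg_at_left_filter; exact: (is_derive_continuous (dK t t0)).
- move=> x; rewrite in_itv /= => /andP[x0 _]; rewrite derive1E.
  by have [_ ->] := dK x x0.
Qed.

End LogKernel.
End RealLine.

(** * Positivity on the real line *)

Section Positivity.
Variables (R : realType) (n : nat) (P : probability (borelM R n) R).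
Hypothesis hP : is_haar P.
Local Notation C := (Cplx R).
Local Notation M := 'M[C]_n.
Local Notation D := (@unitary_group R n).

Lemma cn_tr_le U : D U -> cn (\tr U) <= n%:R.
Proof.
move=> DU; apply: (le_trans (cn_sum _ _ _)); rewrite -[leRHS]mulr1 mulr_natl.
rewrite -[X in _ *+ X]card_ord -sumr_const; apply: ler_sum => i _.
exact: unitary_entry_le.
Qed.

Lemma cexp_retr_real (x : R) (U : M) :
  cexp (x%:C * retr U) = (expR (x * (2 * complex.Re (\tr U))))%:C.
Proof.
rewrite -cexp_real; congr cexp; rewrite /retr; case: (\tr U) => a b.
by apply: cplx_ext; rewrite ?(cReM, cImM) /=; ring.
Qed.

(** The integrand is exp(2 x Re tr U), bounded below on U(n) by a positive constant because |tr U|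
    <= n. *)
Lemma expect_tr_real (x : R) : complex.Im (expect_tr P x%:C x%:C) = 0 /\
  0 < complex.Re (expect_tr P x%:C x%:C).
Proof.
have -> : expect_tr P x%:C x%:C = Ex P (fun U => cexp (x%:C * retr U)).
  by apply: eq_Ex => U _; rewrite -mulrDr.
have bE := @bmeas_cexp_retr R n x%:C.
split.
  transitivity (Rintegral P D (fun U : borelM R n => complex.Im (cexp (x%:C * retr U)))); first by [].
  rewrite (@eq_Rintegral _ _ _ P D (cst 0)) => [|U _]; last by rewrite cexp_retr_real.
  by rewrite /Rintegral integral0.
pose c := expR (- (`|x| * (2 * n%:R))).
have cU U : D U -> c <= expR (x * (2 * complex.Re (\tr U))).
  move=> DU; rewrite ler_expR lerNl -mulrN; apply: (le_trans (ler_norm _)).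
  rewrite normrM normrN normrM ler_wpM2l// [`|2|]ger0_norm// ler_wpM2l//.
  by apply: le_trans (cn_tr_le DU); exact: Re_le_cn.
have c0 : 0 < c by exact: expR_gt0.
suff : 0 <= complex.Re (Ex P (fun U => cexp (x%:C * retr U) - c%:C)).
  rewrite (ExB hP bE (bmeas_cst D _)) (Ex_cst hP) cReD cReN subr_ge0.
  exact: lt_le_trans.
suff : 0 <= Rintegral P D (fun U : borelM R n => complex.Re (cexp (x%:C * retr U) - c%:C)) by [].
apply: Rintegral_ge0 => U DU.
by rewrite cexp_retr_real cReD cReN /= subr_ge0 cU.
Qed.

End Positivity.

Section LogFormula.
Variables (R : realType) (n : nat) (P : probability (borelM R n.+1) R).
Hypothesis hP : is_haar P.
Local Notation C := (Cplx R).

Lemma Dn_log_integral (t : R) : 0 < t ->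
  let I := fun tau : R => (ln (t / tau) * tau)%:C * Phi n.+1 (tau%:C : C) in
  cintegrable (@lebesgue_measure R) `[0, t] I /\
  Dn n.+1 (t%:C : C) = cexp (4 * cintegral (@lebesgue_measure R) `[0, t] I).
Proof.
move=> t0 I.
have [D1 e1 q1] := exptype_qdiff (exptype_Dn R n.+1).
have [D2 e2 q2] := exptype_qdiff e1.
have [W1 _ qW] := exptype_qdiff (@exptype_Dopuc R n.+1 0).
have toda := toda_Dn q1 q2 e1 e2.
have Dre (x : R) := expect_tr_real hP x.
have {}Dre (x : R) : complex.Im (Dn n.+1 (x%:C : C)) = 0 /\ 0 < complex.Re (Dn n.+1 (x%:C : C)).
  by have := Dre x; rewrite expect_tr_Dn.
have D1re := qdiff_real q1 (fun x => (Dre x).1).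
have D2re := qdiff_real q2 D1re.
pose d (x : R) := complex.Re (Dn n.+1 (x%:C : C)).
pose d1 (x : R) := complex.Re (D1 x%:C); pose d2 (x : R) := complex.Re (D2 x%:C).
pose w1 (x : R) := complex.Re (Dopuc n.+1 0 (x%:C : C)).
pose w2 (x : R) := complex.Im (Dopuc n.+1 0 (x%:C : C)).
have DE x : Dn n.+1 (x%:C : C) = (d x)%:C by apply: cplx_ext => //=; exact: (Dre x).1.
have D1E x : D1 x%:C = (d1 x)%:C by apply: cplx_ext => //=; exact: D1re.
have D2E x : D2 x%:C = (d2 x)%:C by apply: cplx_ext => //=; exact: D2re.
have WE x : Dopuc n.+1 0 (x%:C : C) = w1 x +i* w2 x by apply: cplx_ext.
have d0 x : 0 < d x := (Dre x).2.
have dd (x : R) : is_derive x 1 d (d1 x) := qdiff_Re x q1.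
have dd1 (x : R) : is_derive x 1 d1 (d2 x) := qdiff_Re x q2.
have dw1 (x : R) := qdiff_Re x qW; have dw2 (x : R) := qdiff_Im x qW.
pose phi x := 1 - (w1 x ^+ 2 - w2 x ^+ 2) / d x ^+ 2.
(* All terms but the square of D p(0) are known to be real. The imaginary part of the Toda equation
   therefore gives w1 w2 = 0 for x > 0, so that square is real, which is all that [phi] requires. *)
have todaR x : d x * (d1 x + x * d2 x) - x * d1 x ^+ 2 = 4 * x * (d x ^+ 2 * phi x) /\
    x * (w1 x * w2 x) = 0.
  have := toda x%:C; rewrite DE D1E D2E WE => E.
  have [ER EI] := (congr1 (@complex.Re R) E, congr1 (@complex.Im R) E).
  split; last first.
    apply: (mulfI (_ : 8 != 0 :> R)); first by rewrite pnatr_eq0.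
    rewrite mulr0 -[RHS]oppr0; move: EI.
    rewrite !expr2 !(cReD, cReN, cReM, cImD, cImN, cImM) /=.
    move: (d x) (d1 x) (d2 x) (w1 x) (w2 x) => a b c e f.
    by move=> H; transitivity (- (- (8 * (x * (e * f))))); [rewrite opprK|congr (- _); move: H; lra].
  have -> : d x ^+ 2 * phi x = d x ^+ 2 - (w1 x ^+ 2 - w2 x ^+ 2).
    by rewrite /phi; field; rewrite gt_eqF ?d0.
  move: ER; rewrite !expr2 !(cReD, cReN, cReM, cImD, cImN, cImM) /=.
  by move: (d x) (d1 x) (d2 x) (w1 x) (w2 x) => a b c e f H; lra.
have PhiR x : 0 < x -> Phi n.+1 (x%:C : C) = (phi x)%:C.
  move=> x0; have Dx : Dn n.+1 (x%:C : C) != 0.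
    by rewrite DE; apply/eqP => /(congr1 (@complex.Re R)) /= E; have := d0 x; rewrite E ltxx.
  rewrite PhiE//; have := DopucE 0 Dx; rewrite -/(verb _ _) => E.
  have -> : verb (fc (x%:C : C)) n.+1 = Dopuc n.+1 0 (x%:C : C) / Dn n.+1 (x%:C : C).
    by rewrite -E mulrC mulKf.
  have ww : w1 x * w2 x = 0.
    by have [_ /eqP] := todaR x; rewrite mulf_eq0 gt_eqF//= => /eqP.
  rewrite expr_div_n DE WE -rmorphXn.
  have -> : (w1 x +i* w2 x : C) ^+ 2 = (w1 x ^+ 2 - w2 x ^+ 2)%:C.
    rewrite expr2; apply: cplx_ext; rewrite ?(cReM, cImM) /=; first by rewrite -!expr2.
    by rewrite [w2 x * w1 x]mulrC ww addr0.
  by rewrite -fmorphV -rmorphM -[X in X - _]/(1%:C) -rmorphB.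
pose L x := ln (d x); pose l x := d1 x / d x.
have dL (x : R) : is_derive x 1 L (l x).
  have := is_derive1_comp (is_derive1_ln (d0 x)) (dd x).
  by move=> H; apply: (is_derive_eq H); rewrite /l mulrC.
have dl (x : R) : is_derive x 1 (fun y => y * l y) (4 * x * phi x).
  have dn0 : d x != 0 by rewrite gt_eqF ?d0.
  have := cderM (cder_id x) (cderM (dd1 x) (cderV dn0 (dd x))).
  move=> H; apply: (is_derive_eq H).
  apply: (mulfI (expf_neq0 2 dn0)).
  rewrite [RHS](_ : _ = 4 * x * (d x ^+ 2 * phi x)); last by ring.
  rewrite -(todaR x).1; field; exact: dn0.
have cd : continuous d by move=> x; exact: (is_derive_continuous (dd x)).
have cdV : continuous (fun x => (d x)^-1).
  by move=> x; apply: cvgV; [rewrite gt_eqF ?d0|exact: cd].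
have cl : continuous l.
  by move=> x; apply: cvgM; [exact: (is_derive_continuous (dd1 x))|exact: cdV].
have cphi : continuous phi.
  have cw1 : continuous w1 by move=> x; exact: (is_derive_continuous (dw1 x)).
  have cw2 : continuous w2 by move=> x; exact: (is_derive_continuous (dw2 x)).
  have -> : phi = fun x => 1 - (w1 x * w1 x - w2 x * w2 x) * ((d x)^-1 * (d x)^-1).
    by apply/funext => x; rewrite /phi -!expr2 exprVn.
  move=> x; apply: cvgB; first exact: cvg_cst.
  apply: cvgM; last by apply: cvgM; exact: cdV.
  by apply: cvgB; apply: cvgM; solve [exact: cw1|exact: cw2].
have L0 : L 0 = 0.
  by rewrite /L /d -[(0 : R)%:C]/(0 : C) Dn0 /= ln1.
pose g x := (ln t - ln x) * x * phi x.
have IE x : x \in `[0, t]%classic -> I x = (g x)%:C.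
  rewrite inE /= in_itv /= => /andP[x0 _]; rewrite /I /g.
  (* At x = 0 both integrands vanish through the factor x, whatever the value of the logarithm
     there. *)
  have [->|xn0] := eqVneq x 0; first by rewrite !mulr0 !mul0r.
  have {xn0} : 0 < x by rewrite lt_def xn0.
  by move=> {}x0; rewrite PhiR// -rmorphM ln_div ?posrE.
have cg : {within `[0, t], continuous g} := continuous_log_kernel t0 cphi.
have ig : (@lebesgue_measure R).-integrable `[0, t] (EFin \o g).
  by apply: continuous_compact_integrable => //; exact: segment_compact.
split.
  split; first by apply: eq_integrable ig => // x xt /=; rewrite IE.
  by apply: eq_integrable (integrable0 _ _) => // x xt /=; rewrite IE.
have IR : Rintegral (@lebesgue_measure R) `[0, t] (fun x => complex.Re (I x)) = L t / 4.
  rewrite -(Rintegral_log_kernel t0 dL dl cl cphi L0).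
  by apply: eq_Rintegral => x xt; rewrite IE.
have II : Rintegral (@lebesgue_measure R) `[0, t] (fun x => complex.Im (I x)) = 0.
  transitivity (Rintegral (@lebesgue_measure R) `[0, t] (cst 0)); last by rewrite /Rintegral integral0.
  by apply: eq_Rintegral => x xt; rewrite IE.
rewrite /cintegral IR II.
rewrite (_ : 4 * _ = (L t)%:C); first by rewrite cexp_real DE /L lnK ?posrE.
by apply: cplx_ext; rewrite ?(cReM, cImM) /=; field.
Qed.

End LogFormula.

Theorem mainTheorem1 (R : realType) (n : nat) (hn : (1 <= n)%N)
    (P : probability (borelM R n) R) (hP : is_haar P) :
  [/\ (forall r s r' s' : Cplx R, r * s = r' * s' ->
         expect_tr P r s = expect_tr P r' s'),
      (forall t : Cplx R, expect_tr P t t = Dn n t),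
      meromorphic (@Phi R n),
      (* the differential equation, as an identity of meromorphic functions:
         it holds, with all its terms defined, near every point z0 of the plane
         except possibly at z0 *)
      (forall z0 : Cplx R, \forall t \near z0^',
         let F : Cplx R -> Cplx R := @Phi R n in
         let F' : Cplx R -> Cplx R := (F^`())%classic in
         let F'' : Cplx R -> Cplx R := (F^`(2))%classic in
         [/\ toeplitz n (symbol t) \in unitmx,
             t != 0 /\ F t != 0 /\ F t - 1 != 0,
             derivable F t 1,
             derivable F' t 1 &
             F'' t = 1 / 2 * (1 / (F t - 1) + 1 / F t) * F' t ^+ 2
                        - 1 / t * F' t
                        - 8 * F t * (F t - 1)
                        + 2 * n%:R ^+ 2 / t ^+ 2 * ((F t - 1) / F t)]) &
      (forall t : R, 0 < t ->
         let I := fun tau : R =>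
           (ln (t / tau) * tau)%:C * Phi n (tau%:C : Cplx R) in
         cintegrable (@lebesgue_measure R) `[0, t] I /\
         Dn n (t%:C : Cplx R) =
           cexp (4 * cintegral (@lebesgue_measure R) `[0, t] I))].
Proof.
case: n hn P hP => // n _ P hP; split.
- by move=> r s r' s'; apply: expect_tr_mul.
- exact: (expect_tr_Dn hP).
- exact: meromorphic_Phi.
- exact: painleve_Phi.
- exact: (Dn_log_integral hP).
Qed.
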